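(* Let $f\colon\mathbb N\to\mathbb S^1$ be an MRT function with associated sequences $(t_m),(s_m)$. For $d\in\mathbb Z_+$, let $(X,\mu_d,T)$ be the Furstenberg system for Cesàro averages of $f$, taken along a sequence of intervals $[N_m]$ that satisfies $s_{m+1}^{1/(d+1)}\prec N_m\prec s_{m+1}^{1/d}$ (for $d=0$ we simply assume that $s_{m+1}\prec N_m\le t_{m+1}$). Then $(X,\mu_d,T)$ has trivial spectrum, is strongly stationary, and is isomorphic to the level $d$ unipotent system $(\mathbb T^{d+1},m_{\mathbb T^{d+1}},S_d)$.
   Context: $\mathbb N=\{1,2,\ldots\}$, $\mathbb Z_+=\{0,1,2,\ldots\}$, $\mathbb S^1$ is the complex unit circle, $\mathbb U$ is the closed complex unit disc, $\mathbb T=\mathbb R/\mathbb Z$, $m_{\mathbb T^{d+1}}$ is Haar probability measure on $\mathbb T^{d+1}$, $[N]=\{1,\ldots,N\}$, $\mathbb E_{n\in[N]}a(n)=\frac1N\sum_{n=1}^Na(n)$. For positive sequences, $a(m)\prec b(m)$ means $a(m)/b(m)\to0$ as $m\to\infty$. $(N_m)$ denotes a strictly increasing sequence of positive integers. MRT function: a completely multiplicative $f\colon\mathbb N\to\mathbb S^1$ for which there exist strictly increasing sequences of integers $(t_m)$, with $t_1:=1$, and $(s_m)$ such that for each $m\in\mathbb N$: (i) $t_m<s_{m+1}<s_{m+1}^2\le t_{m+1}$; (ii) $f(p)=p^{is_{m+1}}$ for each prime $p\in(t_m,t_{m+1}]$; (iii) $|f(p)-p^{is_{m+1}}|\le1/t_m^2$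 for each prime $1<p\le t_m$. Let $X=\mathbb U^{\mathbb Z}$ with the product topology and let $T\colon X\to X$ be the shift $(Tx)(k)=x(k+1)$. Extend $f$ to $\mathbb Z$ arbitrarily (the extension does not matter) and view it as a point of $X$. The Furstenberg system of $f$ for Cesàro averages along $([N_m])$ is $(X,\mu,T)$, where $\mu=\lim_{m\to\infty}\mathbb E_{n\in[N_m]}\delta_{T^nf}$ (weak-star limit); part of the claim is that this limit exists for the stated sequences. Level $d$ unipotent system: $S_d\colon\mathbb T^{d+1}\to\mathbb T^{d+1}$, $S_d(x_0,\ldots,x_d)=(x_0,x_1+x_0,\ldots,x_d+x_{d-1})$ (so $S_0=\mathrm{id}$ on $\mathbb T$). The spectrum of $(X,\mu,T)$ is the set of $\alpha\in[0,1)$ for which there is a non-zero $g\in L^2(\mu)$ with $g\circ T=e^{2\pi i\alpha}g$; it is trivial if it equals $\{0\}$. With $F_0(x)=x(0)$, the system $(X,\mu,T)$ is strongly stationary if $\int\prod_{j=1}^\ell T^{n_j}F_j\,d\mu=\int\prod_{j=1}^\ell T^{rn_j}F_j\,d\mu$ for all $\ell,r\in\mathbb N$, $n_1,\ldots,n_\ell\in\mathbb Z$ and $F_1,\ldots,F_\ell\in\{F_0,\overline{F_0}\}$, where $T^nF=F\circ T^n$. Isomorphic means measure-theoretically isomorphic. *)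

(* Defs.v *)
From HB Require Import structures.
From mathcomp Require Import all_boot all_order all_algebra ring_quotient.
From mathcomp Require Import complex.
From mathcomp Require Import all_classical all_reals all_analysis.

Set Implicit Arguments.
Unset Strict Implicit.
Unset Printing Implicit Defensive.

Import Order.TTheory GRing.Theory Num.Theory.
Import numFieldNormedType.Exports.

Local Open Scope classical_set_scope.
Local Open Scope ring_scope.
Local Open Scope complex_scope.

Definition expi {R : realType} (a : R) : R[i] := cos a +i* sin a.

(* Sequences indexed by {1, 2, ...} are functions on nat whose value at 0 is
   irrelevant. *)

Definition increasing_from1 (u : nat -> int) : Prop :=
  forall m n : nat, (0 < m)%N -> (m < n)%N -> u m < u n.

Definition prec {R : realType} (a b : nat -> R) : Prop :=
  (fun m => a m / b m) @ \oo --> (0 : R).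

(* [p ^ (i s)] for a positive integer [p]. *)
Definition cpow_i {R : realType} (p : nat) (s : int) : R[i] :=
  expi (s%:~R * ln (p%:R : R)).

Definition completely_multiplicative {R : realType} (f : nat -> R[i]) : Prop :=
  f 1%N = 1 /\
  forall m n : nat, (0 < m)%N -> (0 < n)%N -> f (m * n)%N = f m * f n.

Record MRT {R : realType} (f : nat -> R[i]) (t s : nat -> int) : Prop := {
  MRT_unit : forall n : nat, (0 < n)%N -> `|f n| = 1;
  MRT_mul : completely_multiplicative f;
  MRT_t_incr : increasing_from1 t;
  MRT_s_incr : increasing_from1 s;
  MRT_t1 : t 1%N = 1;
  MRT_ts : forall m : nat, (0 < m)%N ->
    [/\ t m < s m.+1, s m.+1 < s m.+1 ^+ 2 & s m.+1 ^+ 2 <= t m.+1];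
  MRT_large : forall m p : nat, (0 < m)%N -> prime p ->
    t m < p%:Z -> p%:Z <= t m.+1 -> f p = cpow_i p (s m.+1);
  MRT_small : forall m p : nat, (0 < m)%N -> prime p ->
    p%:Z <= t m -> `|f p - cpow_i p (s m.+1)| <= ((t m)%:~R ^+ 2)^-1 }.

Definition growth (R : realType) (t s : nat -> int) (d : nat)
    (N : nat -> nat) : Prop :=
  let s' m : R := (s m.+1)%:~R in
  let N' m : R := (N m)%:R in
  if d is 0%N then
    prec s' N' /\ forall m : nat, (0 < m)%N -> (N m)%:Z <= t m.+1
  else
    prec (fun m => s' m `^ (d.+1%:R)^-1) N' /\
    prec N' (fun m => s' m `^ (d%:R)^-1).

(* R[i]^o is R[i] with its topology as a normed field. *)
Definition unit_disc (R : realType) : set (R[i]^o) :=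
  [set z : R[i]^o | `|z| <= 1].
Arguments unit_disc R : clear implicits.

Lemma unit_disc0 (R : realType) : (0 : R[i]^o) \in unit_disc R.
Proof. by rewrite inE /unit_disc /= normr0 ler01. Qed.

HB.instance Definition _ (R : realType) :=
  isPointed.Build (unit_disc R) (exist _ 0 (unit_disc0 R)).

Definition Xtop (R : realType) := prod_topology (fun _ : int => unit_disc R).

Definition Xspace (R : realType) := g_sigma_algebraType (@open (Xtop R)).

Section shift.
Context {R : realType}.
Implicit Type x : Xspace R.

Definition shiftX x : Xspace R := fun k : int => x (k + 1).

(* [shiftX_z n] is the [n]-th iterate of the shift for every integer [n], as the
   next three lemmas say. *)
Definition shiftX_z (n : int) x : Xspace R := fun k : int => x (k + n).

Lemma shiftX_z1 x : shiftX_z 1 x = shiftX x.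
Proof. by []. Qed.

Lemma shiftX_z_nat (n : nat) x : shiftX_z n%:Z x = iter n shiftX x.
Proof.
elim: n => [|n IHn]; first by apply/funext => k; rewrite /shiftX_z addr0.
rewrite iterS -IHn; apply/funext => k.
by rewrite /shiftX /shiftX_z -addrA -intS.
Qed.

Lemma shiftX_zD (m n : int) x : shiftX_z m (shiftX_z n x) = shiftX_z (m + n) x.
Proof. by apply/funext => k; rewrite /shiftX_z -addrA. Qed.

Definition F0 x : R[i] := set_val (x 0).

Definition extends (f : nat -> R[i]) x : Prop :=
  forall n : nat, (0 < n)%N -> set_val (x n%:Z) = f n.

(* [mu] is the weak-star limit of the averages over [n] in [1, N m] of the Dirac
   masses at [T^n x]. *)
Definition furstenberg_system (x : Xspace R) (N : nat -> nat)
    (mu : probability (Xspace R) R) : Prop :=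
  forall phi : Xtop R -> R, continuous phi ->
    (fun m => (N m)%:R^-1 * \sum_(1 <= n < (N m).+1) phi (shiftX_z n%:Z x))
      @ \oo --> (\int[mu]_y (phi y))%R.

End shift.

Section complex_valued.
Context {d : measure_display} {X : measurableType d} {R : realType}.
Variable mu : {measure set X -> \bar R}.
Implicit Type g : X -> R[i].

Definition cmeasurable g : Prop :=
  measurable_fun setT (fun x => complex.Re (g x)) /\
  measurable_fun setT (fun x => complex.Im (g x)).

Definition cintegral g : R[i] :=
  (\int[mu]_x complex.Re (g x))%R +i* (\int[mu]_x complex.Im (g x))%R.

Definition in_L2 g : Prop :=
  cmeasurable g /\ (\int[mu]_x ((complex.Re `|g x|) ^+ 2)%:E < +oo)%E.

Definition spectrum (T : X -> X) : set R :=
  [set alpha | 0 <= alpha < 1 /\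
    exists g, [/\ in_L2 g, ~ {ae mu, forall x, g x = 0} &
      {ae mu, forall x, g (T x) = expi (2 * pi * alpha) * g x}]].

End complex_valued.

Definition strongly_stationary {R : realType}
    (mu : probability (Xspace R) R) : Prop :=
  forall (l r : nat) (n : 'I_l -> int) (F : 'I_l -> Xspace R -> R[i]),
    (0 < l)%N -> (0 < r)%N ->
    (forall j, F j = F0 \/ F j = (fun x => (F0 x)^*)) ->
    cintegral mu (fun x => \prod_(j < l) F j (shiftX_z (n j) x)) =
    cintegral mu (fun x => \prod_(j < l) F j (shiftX_z (r%:Z * n j) x)).

(* An isomorphism is an invertible bimeasurable measure-preserving map between
   forward-invariant sets of full measure, intertwining [T] and [S]. *)
Definition isomorphic_systems {d d' : measure_display} {X : measurableType d}
    {Y : measurableType d'} {R : realType}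
    (mu : {measure set X -> \bar R}) (T : X -> X)
    (nu : {measure set Y -> \bar R}) (S : Y -> Y) : Prop :=
  exists (X0 : set X) (Y0 : set Y) (phi : X -> Y),
    [/\ [/\ measurable X0, mu (~` X0) = 0%E & T @` X0 `<=` X0],
        [/\ measurable Y0, nu (~` Y0) = 0%E & S @` Y0 `<=` Y0],
        set_bij X0 Y0 phi,
        (forall B, measurable B -> B `<=` Y0 ->
           measurable (X0 `&` phi @^-1` B) /\ mu (X0 `&` phi @^-1` B) = nu B) /\
        (forall A, measurable A -> A `<=` X0 -> measurable (phi @` A)) &
        forall x, X0 x -> phi (T x) = S (phi x)].

Definition integers (R : realType) : zmodClosed R :=
  GRing.ZmodClosed.clone R (@Num.int_num_subdef R) _.
Arguments integers R : clear implicits.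

Lemma integersE (R : realType) (a : R) :
  (a \in integers R) = (a \is a Num.int).
Proof. by []. Qed.

Definition circle (R : realType) := Quotient.quot (integers R).
Arguments circle R : clear implicits.
HB.instance Definition _ (R : realType) := GRing.Zmodule.on (circle R).
HB.instance Definition _ (R : realType) := isPointed.Build (circle R) 0.

Section circle.
Context {R : realType}.

Definition circle_proj (a : measurableTypeR R) : circle R :=
  (\pi_(circle R) (a : R))%qT.

(* The quotient sigma-algebra; it is the Borel sigma-algebra of R / Z, as the
   projection restricts to a Borel isomorphism from [0, 1[. *)
Definition circle_measurable : set (set (circle R)) :=
  [set A | measurable (circle_proj @^-1` A)].

Lemma circle_measurable0 : circle_measurable set0.
Proof. by rewrite /circle_measurable /= preimage_set0. Qed.

Lemma circle_measurableC A : circle_measurable A -> circle_measurable (~` A).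
Proof. by rewrite /circle_measurable /= preimage_setC; exact: measurableC. Qed.

Lemma circle_measurable_bigcup (F : (set (circle R))^nat) :
  (forall i, circle_measurable (F i)) -> circle_measurable (\bigcup_i F i).
Proof.
move=> mF; rewrite /circle_measurable /= preimage_bigcup.
exact: bigcupT_measurable.
Qed.

Definition circle_display : measure_display.
Proof. exact: default_measure_display. Qed.

HB.instance Definition _ := @isMeasurable.Build circle_display (circle R)
  circle_measurable circle_measurable0 circle_measurableC
  circle_measurable_bigcup.

Lemma measurable_circle_proj : measurable_fun setT circle_proj.
Proof. by move=> _ A mA; rewrite setTI. Qed.

HB.instance Definition _ :=
  isMeasurableFun.Build _ _ _ _ circle_proj measurable_circle_proj.

Definition haar_circle : probability (circle R) R :=
  distribution (uniform_prob (@ltr01 R)) circle_proj.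

Definition torus_cons (n : nat) (z : circle R * n.-tuple (circle R)) :
  n.+1.-tuple (circle R) := [tuple of z.1 :: z.2].

Lemma measurable_torus_cons n : measurable_fun setT (@torus_cons n).
Proof. exact: (measurable_cons measurable_fst measurable_snd). Qed.

HB.instance Definition _ n :=
  isMeasurableFun.Build _ _ _ _ (@torus_cons n) (@measurable_torus_cons n).

(* The [n]-fold product of [haar_circle], that is, the Haar probability measure
   on the torus of dimension [n]. *)
Fixpoint haar_torus (n : nat) : probability (n.-tuple (circle R)) R :=
  if n is k.+1 then
    distribution (haar_circle \x haar_torus k)%E (@torus_cons k)
  else \d_([tuple] : 0.-tuple (circle R)).

Lemma haar_torus_setX n (A : set (circle R)) (B : set (n.-tuple (circle R))) :
  measurable A -> measurable B ->
  haar_torus n.+1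
    ((fun x => (thead x, [tuple of behead x])) @^-1` (A `*` B)) =
  (haar_circle A * haar_torus n B)%E.
Proof.
move=> mA mB; rewrite -product_measure1E //=.
rewrite /distribution /pushforward -comp_preimage.
congr (_ _); apply/seteqP; split => -[a b] /=; rewrite theadE;
  by have -> : [tuple of behead (torus_cons (a, b))] = b by apply: val_inj.
Qed.

Definition unipotent (d : nat) (x : d.+1.-tuple (circle R)) :
    d.+1.-tuple (circle R) :=
  [tuple tnth x i + (if (0 < i)%N then tnth x (inord i.-1) else 0) | i < d.+1].

End circle.

(* Main.v *)
From HB Require Import structures.
Require Import Defs.
From mathcomp Require Import all_boot all_order all_algebra.
From mathcomp Require Import complex ring lra zify.
From mathcomp Require Import all_classical all_reals all_analysis.
From mathcomp Require Import measurable_realfun.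

Set Implicit Arguments.
Unset Strict Implicit.
Unset Printing Implicit Defensive.

Import Order.TTheory GRing.Theory Num.Theory.
Import numFieldNormedType.Exports.

Local Open Scope classical_set_scope.
Local Open Scope ring_scope.
Local Open Scope complex_scope.
Import Normc.

(** Let [Delta] be the forward difference operator, and write [s] for
    [s m.+1] and [t] for [t m].

    On [[1, N m]] the function [f] is on average close to [n ^ (i s)]: the two
    functions agree at the primes [p] with [t < p <= t m.+1] and differ by at most
    [t ^ -2] at the primes up to [t], hence differ at [n] by at most [t ^ -2] times the
    number of prime factors of [n] up to [t], which is at most [t] on average
    ([sum_mult_close]). The average of a product of shifts of [f] and of its
    conjugate is therefore asymptotically that of [expi (s * (G(Delta) ln) n)],
    where the integer polynomial [G] is the signed sum of the powers
    [(1 + X) ^ k], [k] running over the shifts. Now [Delta ^ j ln] has size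
    [n ^ -j], and the hypothesis on [N] says that [s] lies strictly between
    [N ^ d] and [N ^ (d + 1)]. If [X ^ (d + 1)] divides [G], the phase tends
    to 0 and the average to 1 ([exp_sum_low]). Otherwise the average tends to 0:
    van der Corput's inequality replaces [G] by [((1 + X) ^ h - 1) * G], which
    reduces the problem to a [G] that vanishes to order exactly [d], and then the
    increments of the phase tend to 0 slowly enough for the method of Kusmin and
    Landau ([exp_sum_notlow]). So all the moments of [f] are 0 or 1, according to
    an algebraic condition on [G] ([moments]).

    The unipotent system has the same moments. Code a point [y] of the torus by
    the values of the character of the last coordinate along its orbit. On that
    coordinate [S - 1] is nilpotent of order [d + 1], so that the product of
    the code at the given shifts is the character of [y] whose frequency is [G]
    modulo [X ^ (d + 1)], and orthogonality of characters gives its integral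
    ([haar_torus_char], [torus_moment]). By the theorem of Stone and Weierstrass
    the moments determine a measure on the sequence space ([trig_dense]), so the
    averages converge to the image of the Haar measure
    ([torus_system_furstenberg]). As a point can be read off its code measurably
    ([orbit_seqK]), the two systems are isomorphic.

    Multiplying the shifts by [r] composes [G] with [(1 + X) ^ r - 1], which
    vanishes to order exactly 1; this preserves the order of vanishing of [G],
    hence the moments ([kappa_dilate]): the system is strongly stationary.

    Finally, let [h] be a bounded eigenfunction whose eigenvalue is not 1, and
    take a product of coordinates. If [X ^ (d + 1)] divides [X * G], the product
    is almost everywhere invariant, hence orthogonal to [h] ([J_invariant]).
    Otherwise its translates are pairwise orthogonal, whereas their inner products
    with [h] have the same modulus, which is 0 by Bessel's inequality
    ([J_orthogonal]). By density [h] vanishes almost everywhere. *)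

(** * Complex norms and exponentials *)

Section complex_norm.
Context {R : realType}.
Implicit Types (z w : R[i]) (a b : R).

Lemma ler_normcD z w : normc (z + w) <= normc z + normc w.
Proof. exact: (@le_normcD R). Qed.

Lemma normc_opp z : normc (- z) = normc z.
Proof. exact: (@normcN R). Qed.

Lemma normc_distC z w : normc (z - w) = normc (w - z).
Proof. by rewrite -normc_opp opprB. Qed.

Lemma normc_ge0 z : 0 <= normc z.
Proof. by case: z => a b; exact: sqrtr_ge0. Qed.

Lemma normc_sum (I : Type) (r : seq I) (P : pred I) (F : I -> R[i]) :
  normc (\sum_(i <- r | P i) F i) <= \sum_(i <- r | P i) normc (F i).
Proof.
elim/big_ind2 : _ => [|z a w b za wb|//]; first by rewrite normc0.
by rewrite (le_trans (ler_normcD _ _)) ?lerD.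
Qed.

Lemma normc_prod (I : Type) (r : seq I) (P : pred I) (F : I -> R[i]) :
  normc (\prod_(i <- r | P i) F i) = \prod_(i <- r | P i) normc (F i).
Proof. by apply: (big_morph _ (@normcM R)); exact: normc1. Qed.

Lemma ler_dist_normcD z w u : normc (z - u) <= normc (z - w) + normc (w - u).
Proof. by rewrite (le_trans _ (ler_normcD _ _))// addrA subrK. Qed.

Lemma normc_real a : normc a%:C = `|a|.
Proof. by rewrite /= expr0n addr0 sqrtr_sqr. Qed.

Lemma normc_nat n : normc (n%:R : R[i]) = n%:R.
Proof. by rewrite -(rmorph_nat (real_complex R)) normc_real normr_nat. Qed.

Lemma normc_Re z : `|complex.Re z| <= normc z.
Proof.
by case: z => a b /=; rewrite -sqrtr_sqr ler_wsqrtr// lerDl sqr_ge0.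
Qed.

Lemma normc_Im z : `|complex.Im z| <= normc z.
Proof.
by case: z => a b /=; rewrite -sqrtr_sqr ler_wsqrtr// lerDr sqr_ge0.
Qed.

Lemma normc_le_ReIm z : normc z <= `|complex.Re z| + `|complex.Im z|.
Proof.
case: z => a b /=; rewrite -(@ler_sqr R) ?nnegrE ?sqrtr_ge0 ?addr_ge0//.
rewrite sqr_sqrtr ?addr_ge0 ?sqr_ge0// sqrrD !real_normK ?num_real//.
by rewrite lerD2r lerDl mulrn_wge0// mulr_ge0.
Qed.

Lemma normc_conj z : normc z^* = normc z.
Proof. by case: z => a b /=; rewrite sqrrN. Qed.

Lemma normE z : `|z| = (normc z)%:C.
Proof. by []. Qed.

Lemma sqr_normcE z : (normc z ^+ 2)%:C = z * z^*.
Proof. by rewrite rmorphXn/= -normE sqr_normc. Qed.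

Lemma Re_mulJ z : complex.Re (z * z^*) = normc z ^+ 2.
Proof. by rewrite -sqr_normcE. Qed.

Lemma mulcJ_norm1 z : normc z = 1 -> z * z^* = 1.
Proof. by move=> z1; rewrite -sqr_normcE z1 expr1n. Qed.

End complex_norm.

Section expi.
Context {R : realType}.
Implicit Types (a b : R).

Lemma expi0 : expi 0 = 1 :> R[i].
Proof. by rewrite /expi cos0 sin0. Qed.

Lemma expiD a b : expi (a + b) = expi a * expi b.
Proof.
rewrite /expi cosD sinD; apply/eqP; rewrite eq_complex /= eqxx /=.
by rewrite addrC.
Qed.

Lemma expiN a : expi (- a) = (expi a)^*.
Proof. by rewrite /expi cosN sinN. Qed.

Lemma normc_expi a : normc (expi a) = 1.
Proof. by rewrite /= cos2Dsin2 sqrtr1. Qed.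

Lemma expiB a b : expi (a - b) = expi a * (expi b)^*.
Proof. by rewrite expiD expiN. Qed.

Lemma expi_sum (I : Type) (r : seq I) (P : pred I) (F : I -> R) :
  expi (\sum_(i <- r | P i) F i) = \prod_(i <- r | P i) expi (F i).
Proof. by apply: (big_morph _ expiD); exact: expi0. Qed.

Lemma expi_natmul a n : expi (n%:R * a) = expi a ^+ n.
Proof.
elim: n => [|n IH]; first by rewrite mul0r expi0 expr0.
by rewrite exprS -IH -expiD -natr1 mulrDl mul1r addrC.
Qed.

Let sin_MVT a b : a <= b ->
  exists2 c, c \in `[a, b] & sin b - sin a = cos c * (b - a).
Proof.
move=> ab; apply: MVT_segment => //.
by apply: continuous_subspaceT; exact: continuous_sin.
Qed.

Lemma sin_lip a b : `|sin a - sin b| <= `|a - b|.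
Proof.
wlog ab : a b / b <= a => [h|].
  by have [/h//|/ltW/h] := leP b a; rewrite distrC [X in _ <= X]distrC.
have [c _ ->] := sin_MVT ab.
by rewrite normrM ler_piMl// cos_max.
Qed.

Lemma cos_lip a b : `|cos a - cos b| <= `|a - b|.
Proof.
rewrite -!sinDpihalf (le_trans (sin_lip _ _))//.
by rewrite opprD addrACA subrr addr0.
Qed.

Lemma expi_lip a b : normc (expi a - expi b) <= 2 * `|a - b|.
Proof.
rewrite (le_trans (normc_le_ReIm _))// mulr_natl mulr2n.
by rewrite lerD// ?cos_lip ?sin_lip.
Qed.

(** By the mean value theorem [`|sin a|] is at least [`|a|] times the infimum of
    [cos] on [[0, `|a|]], which is at least [1 - `|a|]. *)
Lemma expi_sub1_ge a : `|a| <= 2^-1 -> `|a| / 2 <= normc (expi a - 1).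
Proof.
move=> a2; apply: le_trans (normc_Im _); rewrite /= subr0.
have key (b : R) : 0 <= b -> b <= 2^-1 -> b / 2 <= `|sin b|.
  move=> b0 b2.
  have [c] := sin_MVT b0.
  rewrite in_itv/= sin0 !subr0 => /andP[c0 cb] ->.
  have := cos_lip c 0; rewrite cos0 subr0 (ger0_norm c0) => cc.
  have c1 : 2^-1 <= cos c.
    have : `|cos c - 1| <= 2^-1 by rewrite (le_trans cc)// (le_trans cb).
    rewrite ler_norml => /andP[+ _]; lra.
  rewrite ger0_norm; last by rewrite mulr_ge0// (le_trans _ c1).
  by rewrite mulrC ler_wpM2r.
have [a0|a0] := leP 0 a.
  by move: a2; rewrite ger0_norm// => a2; exact: key.
move: a2; rewrite ltr0_norm// => a2.
by rewrite -(normrN (sin a)) -sinN; apply: key => //; rewrite oppr_ge0 ltW.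
Qed.

End expi.

(** * Averages of bounded complex sequences *)

Lemma near_all_lt (P : nat -> nat -> Prop) (H : nat) :
  (forall j, (j < H)%N -> \forall m \near \oo, P j m) ->
  \forall m \near \oo, forall j, (j < H)%N -> P j m.
Proof.
elim: H => [|H IH] PH; first by near=> m.
have PH' := PH H (ltnSn H).
have IH' := IH (fun j jH => PH j (ltnW jH)).
near=> m => j; rewrite ltnS leq_eqVlt => /predU1P[->|jH]; first by near: m.
by move: j jH; near: m.
Unshelve. all: by end_near. Qed.

Section averages.
Context {R : realType}.
Implicit Types (u w : nat -> R[i]) (e : R).

(** Convergence to 0 of the averages of [u m] over [[1, N m]], stated without
    division. *)
Definition small_avg (N : nat -> nat) (u : nat -> nat -> R[i]) : Prop :=
  forall e : R, 0 < e -> \forall m \near \oo,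
    normc (\sum_(1 <= n < (N m).+1) u m n) <= e * (N m)%:R.

Lemma normc_sum_le (a b : nat) u (B : R) : 0 <= B ->
  (forall n, (a <= n < b)%N -> normc (u n) <= B) ->
  normc (\sum_(a <= n < b) u n) <= B * (b - a)%:R.
Proof.
move=> B0 uB; rewrite (le_trans (normc_sum _ _ _))//.
rewrite (@le_trans _ _ (\sum_(a <= n < b) B))//.
  by apply: ler_sum_nat => n /uB.
by rewrite big_const_nat iter_addr addr0 mulr_natr.
Qed.

Lemma sum_shift_close (N h : nat) w (B : R) :
  (forall n, normc (w n) <= B) ->
  normc (\sum_(1 <= n < N.+1) w (n + h)%N - \sum_(1 <= n < N.+1) w n)
    <= 2 * h%:R * B.
Proof.
move=> wB; elim: h => [|h IH].
  by under eq_bigr do rewrite addn0; rewrite subrr normc0 mulr0 mul0r.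
have -> : \sum_(1 <= n < N.+1) w (n + h.+1)%N =
    \sum_(1 <= n < N.+1) w (n + h)%N + (w (N.+1 + h)%N - w h.+1).
  elim: N {IH} => [|N IH]; first by rewrite !big_geq// add0r add1n subrr.
  by rewrite !(@big_nat_recr _ _ _ N.+1)//= IH addnS addSn; ring.
rewrite addrAC (le_trans (ler_normcD _ _))//.
rewrite (le_trans (lerD IH (ler_normcD _ _)))// normc_opp.
have := wB (N.+1 + h)%N; have := wB h.+1; rewrite -[h.+1%:R]natr1.
by set x := normc _; set y := normc _ => xB yB; lra.
Qed.

(** The inequality of Cauchy and Schwarz without square roots; it is sharp when
    [k] is the root mean square of [v]. *)
Lemma sum_normc_AMGM (N : nat) (v : nat -> R[i]) (k Q : R) : 0 < k ->
  \sum_(1 <= n < N.+1) normc (v n) ^+ 2 <= Q ->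
  normc (\sum_(1 <= n < N.+1) v n) <= Q / (2 * k) + N%:R * k / 2.
Proof.
move=> k0 vQ; rewrite (le_trans (normc_sum _ _ _))//.
apply: (@le_trans _ _
    (\sum_(1 <= n < N.+1) (normc (v n) ^+ 2 / (2 * k) + k / 2))).
  apply: ler_sum => n _; set a := normc _.
  rewrite -subr_ge0.
  have -> : a ^+ 2 / (2 * k) + k / 2 - a = (a - k) ^+ 2 / (2 * k).
    by field; rewrite gt_eqF.
  by rewrite divr_ge0 ?sqr_ge0// mulr_ge0// ltW.
rewrite big_split/= lerD//.
  by rewrite -mulr_suml ler_wpM2r// invr_ge0 mulr_ge0// ltW.
by rewrite big_const_nat iter_addr addr0 subSS subn0 -[_ *+ _]mulr_natl mulrA.
Qed.

(** The finite form of van der Corput's inequality: correlations bounded by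
    [N / (2 k ^ 2)] at all lags below [k ^ 2] bound the sum by [O(N / k)], since
    up to boundary terms the sum is an average of its short moving sums,
    whose mean square is controlled by the correlations. *)
Lemma van_der_Corput_finite (N k : nat) u : (0 < k)%N ->
  (forall n, normc (u n) <= 1) ->
  (forall h, (0 < h < k ^ 2)%N ->
    normc (\sum_(1 <= n < N.+1) u (n + h)%N * (u n)^*) <=
      N%:R / (2 * (k ^ 2)%:R)) ->
  2 * (k ^ 2)%:R <= N%:R / (2 * (k ^ 2)%:R) :> R ->
  normc (\sum_(1 <= n < N.+1) u n) <= 3 / 2 * N%:R / k%:R + 2 * (k ^ 2)%:R.
Proof.
move=> k0 u1 uh HN; set H := (k ^ 2)%N in uh HN *.
have H0 : (0 < H)%N by rewrite expn_gt0 k0.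
have HR0 : 0 < H%:R :> R by rewrite ltr0n.
have kR0 : 0 < k%:R :> R by rewrite ltr0n.
pose C h h' := \sum_(1 <= n < N.+1) u (n + h)%N * (u (n + h')%N)^*.
have Chh h : normc (C h h) <= N%:R.
  rewrite (le_trans (@normc_sum_le _ _ _ 1 _ _))// ?mul1r ?subSS ?subn0//.
  by move=> n _; rewrite normcM normc_conj mulr_ile1// ?normc_ge0.
have Clt h h' : (h' < h < H)%N -> normc (C h h') <= N%:R / H%:R.
  move=> /andP[h'h hH].
  pose w n := u (n + (h - h'))%N * (u n)^*.
  have w1 n : normc (w n) <= 1.
    by rewrite /w normcM normc_conj mulr_ile1// ?normc_ge0.
  have -> : C h h' = \sum_(1 <= n < N.+1) w (n + h')%N.
    apply: eq_bigr => n _; rewrite /w; congr (u _ * _).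
    by rewrite -addnA (subnKC (ltnW h'h)).
  have s1 := @sum_shift_close N h' w 1 w1.
  have s2 : normc (\sum_(1 <= n < N.+1) w n) <= N%:R / (2 * H%:R).
    by apply: uh; rewrite subn_gt0 h'h (leq_ltn_trans (leq_subr _ _)).
  have s3 : 2 * h'%:R <= 2 * H%:R :> R.
    by rewrite ler_wpM2l// ler_nat ltnW// (ltn_trans h'h).
  have -> : N%:R / H%:R = N%:R / (2 * H%:R) + N%:R / (2 * H%:R) :> R.
    by field; rewrite gt_eqF.
  rewrite -(subrK (\sum_(1 <= n < N.+1) w n) (\sum_(1 <= n < N.+1) w (n + _)%N)).
  rewrite (le_trans (ler_normcD _ _))// lerD// (le_trans s1)// mulr1.
  exact: le_trans HN.
have CJ h h' : normc (C h h') = normc (C h' h).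
  rewrite -normc_conj /C rmorph_sum; congr normc; apply: eq_bigr => n _.
  by rewrite rmorphM /= conjcK mulrC.
have Call h h' : (h < H)%N -> (h' < H)%N -> h != h' ->
    normc (C h h') <= N%:R / H%:R.
  move=> hH h'H; rewrite neq_ltn => /orP[hh'|hh'].
    by rewrite CJ; apply: Clt; rewrite hh'.
  by apply: Clt; rewrite hh'.
pose v n := \sum_(h < H) u (n + h)%N.
have vQ : \sum_(1 <= n < N.+1) normc (v n) ^+ 2 <= 2 * H%:R * N%:R.
  have -> : \sum_(1 <= n < N.+1) normc (v n) ^+ 2 =
      complex.Re (\sum_(h < H) \sum_(h' < H) C h h').
    under eq_bigr do rewrite -Re_mulJ.
    rewrite -raddf_sum; congr complex.Re.
    under eq_bigr do rewrite rmorph_sum big_distrl/=.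
    rewrite exchange_big; apply: eq_bigr => h _.
    under eq_bigr do rewrite big_distrr/=.
    by rewrite exchange_big.
  rewrite (le_trans (ler_norm _))// (le_trans (normc_Re _))//.
  rewrite (le_trans (normc_sum _ _ _))//.
  apply: (@le_trans _ _ (\sum_(h < H) (2 * N%:R : R))); last first.
    by rewrite sumr_const card_ord -[leLHS]mulr_natr [leLHS]mulrAC.
  apply: ler_sum => h _; rewrite (le_trans (normc_sum _ _ _))//.
  rewrite (bigD1 h)//= mulr_natl mulr2n lerD//.
  apply: (@le_trans _ _ (\sum_(h' < H | h' != h) (N%:R / H%:R : R))).
    by apply: ler_sum => h' h'h; apply: Call => //; rewrite eq_sym.
  apply: (@le_trans _ _ (\sum_(h' < H) (N%:R / H%:R : R))).
    rewrite [leRHS](bigD1 h)//= lerDr divr_ge0//.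
  by rewrite sumr_const card_ord -[leLHS]mulr_natr divfK// gt_eqF.
(* The mean square of [v] is of the order of [H = k ^ 2]. *)
have sv := sum_normc_AMGM kR0 vQ.
(* Each of the [H] shifts in [v] changes the sum of [u] by a boundary term. *)
have HS : normc (\sum_(1 <= n < N.+1) v n -
    H%:R * \sum_(1 <= n < N.+1) u n) <= 2 * H%:R * H%:R.
  rewrite /v exchange_big/= -[H%:R * _]/(_ * _).
  have -> : H%:R * \sum_(1 <= n < N.+1) u n =
      \sum_(h < H) \sum_(1 <= n < N.+1) u n.
    by rewrite sumr_const card_ord mulr_natl.
  rewrite -sumrB (le_trans (normc_sum _ _ _))//.
  apply: (@le_trans _ _ (\sum_(h < H) (2 * H%:R : R))); last first.
    by rewrite sumr_const card_ord -[leLHS]mulr_natr.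
  apply: ler_sum => h _; rewrite (le_trans (@sum_shift_close _ _ _ 1 _))//.
  by rewrite mulr1 ler_wpM2l// ler_nat ltnW.
have HSn : H%:R * normc (\sum_(1 <= n < N.+1) u n) <=
    2 * H%:R * H%:R + (2 * H%:R * N%:R / (2 * k%:R) + N%:R * k%:R / 2).
  rewrite -[X in X * _]normc_nat -normcM.
  rewrite -[X in normc X](subrK (\sum_(1 <= n < N.+1) v n)).
  rewrite (le_trans (ler_normcD _ _))//.
  by rewrite lerD// normc_distC.
rewrite -(ler_pM2l HR0) (le_trans HSn)// le_eqVlt; apply/orP; left; apply/eqP.
by rewrite /H natrX; field; rewrite gt_eqF.
Qed.

(** If the correlations at each positive lag vanish on average then so does the
    sequence itself: [van_der_Corput_finite] applies for each fixed [k] once [m]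
    is large, and its bound divided by [N m] tends to [3 / (2 * k)]. *)
Lemma van_der_Corput (N : nat -> nat) (u : nat -> nat -> R[i]) :
  (forall k, \forall m \near \oo, (k <= N m)%N) ->
  (forall m n, normc (u m n) <= 1) ->
  (forall h, (0 < h)%N ->
    small_avg N (fun m n => u m (n + h)%N * (u m n)^*)) ->
  small_avg N u.
Proof.
move=> Noo u1 uh e e0.
pose k := (Num.truncn (4 / e)).+1.
have k0 : (0 < k)%N by [].
have kR0 : 0 < k%:R :> R by rewrite ltr0n.
have ke : 4 / e < k%:R by exact: truncnS_gt.
pose H := (k ^ 2)%N.
have HR0 : 0 < H%:R :> R by rewrite ltr0n expn_gt0.
have He0 : 0 < (2 * H%:R)^-1 :> R by rewrite invr_gt0 mulr_gt0.
pose K1 := (4 * H ^ 2)%N; pose K2 := (Num.truncn (4 * H%:R / e)).+1.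
have near1 := @near_all_lt (fun h m => (0 < h)%N ->
    normc (\sum_(1 <= n < (N m).+1) u m (n + h)%N * (u m n)^*) <=
      (2 * H%:R)^-1 * (N m)%:R) H.
have {}near1 : \forall m \near \oo, forall h, (h < H)%N -> (0 < h)%N ->
    normc (\sum_(1 <= n < (N m).+1) u m (n + h)%N * (u m n)^*) <=
      (2 * H%:R)^-1 * (N m)%:R.
  apply: near1 => h hH; case: (posnP h) => [->|h0]; first by near=> m.
  by have := uh _ h0 _ He0; apply: filterS.
near=> m.
have N1 : (K1 <= N m)%N by near: m; exact: Noo.
have N2 : (K2 <= N m)%N by near: m; exact: Noo.
have := @van_der_Corput_finite (N m) k (u m) k0 (u1 m).
move=> /(_ _ _)/le_trans; apply.
- move=> h /andP[h0 hH]; rewrite [leRHS]mulrC.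
  by move: h hH h0; near: m.
- rewrite ler_pdivlMr ?mulr_gt0// (@le_trans _ _ K1%:R)//.
    by rewrite /K1 natrM [in leRHS]natrX le_eqVlt; apply/orP; left; apply/eqP; rewrite -/H; ring.
  by rewrite ler_nat.
rewrite (@le_trans _ _ (e / 2 * (N m)%:R + e / 2 * (N m)%:R))//; last by lra.
apply: lerD.
  rewrite -mulrA mulrCA mulrC ler_wpM2r// ler_pdivrMr//.
  by move: ke; rewrite ltr_pdivrMr// => ke; lra.
have : 4 * H%:R / e < (N m)%:R.
  by rewrite (lt_le_trans (truncnS_gt _))// ler_nat.
by rewrite ltr_pdivrMr// => N3; rewrite -/H; lra.
Unshelve. all: by end_near. Qed.

(** Kusmin and Landau's method: where the increments [delta n] of the phase are
    small but bounded below by [lo], each [expi (psi n)] is a discrete derivative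
    divided by [expi (delta n) - 1]; summation by parts leaves only the boundary
    terms and the variation of that denominator. *)
Lemma Kusmin_Landau (psi : nat -> R) (a b : nat) (lo eta : R) :
  let delta n := psi n.+1 - psi n in
  (a <= b)%N -> 0 < lo -> 0 <= eta ->
  (forall n, (a <= n <= b)%N -> lo <= `|delta n| <= 2^-1) ->
  (forall n, (a <= n < b)%N -> `|delta n.+1 - delta n| <= eta) ->
  normc (\sum_(a <= n < b) expi (psi n)) <=
    4 / lo + (b - a)%:R * (8 * eta / lo ^+ 2).
Proof.
move=> delta ab lo0 eta0 dlo deta.
pose z n := expi (delta n) - 1.
have zlo n : (a <= n <= b)%N -> lo / 2 <= normc (z n).
  move=> /dlo/andP[d1 d2]; apply: le_trans (expi_sub1_ge d2).
  by rewrite ler_wpM2r.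
have zneq0 n : (a <= n <= b)%N -> z n != 0.
  move=> /zlo zn; apply/negP => /eqP z0; move: zn; rewrite z0 normc0.
  by rewrite leNgt divr_gt0.
have ziN n : (a <= n <= b)%N -> normc (z n)^-1 <= 2 / lo.
  move=> nab; rewrite normcV -[2 / lo]invrK lef_pV2 ?posrE ?invr_gt0 ?divr_gt0//.
    by rewrite invf_div zlo.
  by rewrite (lt_le_trans _ (zlo _ nab))// divr_gt0.
have step n : (a <= n < b)%N -> expi (psi n) =
    (expi (psi n.+1) / z n.+1 - expi (psi n) / z n) -
    (((z n.+1)^-1 - (z n)^-1) * expi (psi n.+1)).
  move=> /andP[an nb].
  have zn : z n != 0 by apply: zneq0; rewrite an ltnW.
  have -> : expi (psi n.+1) = expi (psi n) * (z n + 1).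
    by rewrite /z subrK /delta -expiD; congr expi; ring.
  rewrite mulrBl; move: (_^-1) => y; field.
  exact: zn.
have -> : \sum_(a <= n < b) expi (psi n) =
    (expi (psi b) / z b - expi (psi a) / z a) -
    \sum_(a <= n < b) (((z n.+1)^-1 - (z n)^-1) * expi (psi n.+1)).
  by rewrite -(telescope_sumr (fun n => expi (psi n) / z n) ab) -sumrB; exact: eq_big_nat.
rewrite (le_trans (ler_normcD _ _))// normc_opp lerD//.
  rewrite (le_trans (ler_normcD _ _))// normc_opp !normcM !normc_expi !mul1r.
  rewrite (le_trans (lerD (ziN b _) (ziN a _))) ?leqnn ?ab//.
  by rewrite -mulrDl; have -> : 2 + 2 = 4 :> R by ring.
rewrite mulrC; apply: normc_sum_le.
  by rewrite divr_ge0 ?sqr_ge0// mulr_ge0.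
move=> n nab; rewrite normcM normc_expi mulr1.
have nab1 : (a <= n.+1 <= b)%N by case/andP: nab => an ->; rewrite ltnW.
have nab2 : (a <= n <= b)%N by case/andP: nab => -> /ltnW ->.
have -> : (z n.+1)^-1 - (z n)^-1 = (z n - z n.+1) * ((z n.+1)^-1 * (z n)^-1).
  by field; rewrite !zneq0.
rewrite !normcM.
have d1 : normc (z n - z n.+1) <= 2 * eta.
  have -> : z n - z n.+1 = expi (delta n) - expi (delta n.+1).
    by rewrite /z opprB addrA subrK.
  rewrite (le_trans (expi_lip _ _))//.
  by rewrite ler_wpM2l// distrC deta.
have -> : 8 * eta / lo ^+ 2 = 2 * eta * (2 / lo * (2 / lo)).
  by field; rewrite gt_eqF.
by rewrite ler_pM ?mulr_ge0 ?normc_ge0// ler_pM ?normc_ge0 ?ziN.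
Qed.

End averages.

(** * Iterated differences of the logarithm *)

Section log_differences.
Context {R : realType}.
Implicit Types (x y : R) (j d : nat).

Fixpoint dlog j x : R :=
  if j is i.+1 then dlog i (x + 1) - dlog i x else ln x.

(** Up to a constant, the inverse of the derivative of the [j]-th difference of
    the logarithm. *)
Definition rising j x : R := \prod_(i < j.+1) (x + i%:R).

Lemma rising_recr j x : rising j.+1 x = rising j x * (x + j.+1%:R).
Proof. by rewrite /rising big_ord_recr. Qed.

Lemma rising_recl j x : rising j.+1 x = x * rising j (x + 1).
Proof.
rewrite /rising big_ord_recl/= addr0; congr (_ * _); apply: eq_bigr => i _.
by rewrite -addrA nat1r.
Qed.

Lemma rising_ge j x : 0 < x -> x ^+ j.+1 <= rising j x.
Proof.
move=> x0; elim: j => [|j IH].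
  by rewrite /rising big_ord1 addr0.
rewrite rising_recr exprSr ler_pM ?exprn_ge0// ?(ltW x0)//.
by rewrite lerDl.
Qed.

Lemma rising_le j x : 0 < x -> rising j x <= (x + j%:R) ^+ j.+1.
Proof.
move=> x0; rewrite /rising -[X in _ ^+ X]card_ord -prodr_const.
apply: ler_prod => i _; rewrite addr_ge0 ?(ltW x0)//= lerD2l ler_nat.
by rewrite -ltnS.
Qed.

Lemma rising_gt0 j x : 0 < x -> 0 < rising j x.
Proof. by move=> x0; rewrite (lt_le_trans _ (rising_ge j x0))// exprn_gt0. Qed.

(** Differences commute with derivation, and those of [x^-1] telescope into
    inverses of products of consecutive translates of [x]. *)
Lemma is_derive_dlog j x : 0 < x ->
  is_derive x 1 (dlog j) ((-1) ^+ j * j`!%:R / rising j x).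
Proof.
elim: j x => [|j IH] x x0.
  rewrite expr0 mul1r fact0 div1r /rising big_ord1 addr0.
  exact: is_derive1_ln.
have x10 : 0 < x + 1 by rewrite addr_gt0.
have d0 := IH x x0.
have d1 := IH (x + 1) x10.
have ds : is_derive x 1 (fun y => y + 1) (1 : R).
  by rewrite -[X in is_derive _ _ _ X]addr0; exact: is_deriveD.
have d2 := @is_derive1_comp R (dlog j) (fun y => y + 1) x _ _ d1 ds.
have d3 := is_deriveB d2 d0; rewrite mulr1 in d3.
have e : dlog j.+1 = dlog j \o (fun y => y + 1) - dlog j by apply/funext.
rewrite e; apply: is_derive_eq d3 _.
have r0 := rising_gt0 j x0; have r1 := rising_gt0 j x10.
have rr : x * rising j (x + 1) = rising j x * (x + j.+1%:R).
  by rewrite -rising_recl rising_recr.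
have xj : 0 < x + j.+1%:R by rewrite addr_gt0.
have -> : (rising j (x + 1)) = rising j x * (x + j.+1%:R) / x.
  by rewrite -rr mulrC mulKf// gt_eqF.
rewrite rising_recr factS exprS natrM -natr1.
rewrite -natr1 in xj.
by field; rewrite !gt_eqF.
Qed.

(** The mean value theorem turns the last difference into a derivative, so that
    [dlog j.+1 x] has the exact order [x ^- j.+1]. *)
Lemma dlogS_mean j x : 0 < x -> exists2 y, x <= y <= x + 1 &
  dlog j.+1 x = (-1) ^+ j * j`!%:R / rising j y.
Proof.
move=> x0; have [|||y] := @MVT_segment R (dlog j)
    (fun y => (-1) ^+ j * j`!%:R / rising j y) x (x + 1).
- by rewrite lerDl.
- move=> y; rewrite in_itv/= => /andP[xy _]; apply: is_derive_dlog.
  exact: lt_trans xy.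
- apply: derivable_within_continuous => y; rewrite in_itv/= => /andP[xy _].
  by have [] := is_derive_dlog j (lt_le_trans x0 xy).
by rewrite in_itv/= => xy e; exists y => //=; rewrite e addrAC subrr add0r mulr1.
Qed.

Lemma dlogS_le j x : 0 < x -> `|dlog j.+1 x| <= j`!%:R / x ^+ j.+1.
Proof.
move=> x0; have [y /andP[xy _] ->] := dlogS_mean j x0.
have y0 := lt_le_trans x0 xy.
rewrite !normrM normrX normrN1 expr1n mul1r normfV.
rewrite (ger0_norm (ltW (rising_gt0 _ y0))) normr_nat ler_wpM2l//.
rewrite lef_pV2 ?posrE ?exprn_gt0 ?rising_gt0//.
rewrite (le_trans _ (rising_ge _ y0))//.
by rewrite lerXn2r// nnegrE ltW.
Qed.

Lemma dlogS_ge j x : 0 < x -> ((x + j.+1%:R) ^+ j.+1)^-1 <= `|dlog j.+1 x|.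
Proof.
move=> x0; have [y /andP[xy yx] ->] := dlogS_mean j x0.
have y0 := lt_le_trans x0 xy.
rewrite !normrM normrX normrN1 expr1n mul1r normfV.
rewrite (ger0_norm (ltW (rising_gt0 _ y0))) normr_nat.
apply: (@le_trans _ _ (rising j y)^-1); last first.
  by rewrite ler_peMl ?invr_ge0 ?(ltW (rising_gt0 _ y0))// ler1n fact_gt0.
rewrite lef_pV2 ?posrE ?exprn_gt0 ?rising_gt0 ?addr_gt0//.
rewrite (le_trans (rising_le _ y0))// lerXn2r ?nnegrE ?addr_ge0 ?(ltW x0) ?(ltW y0)//.
by rewrite -natr1 [_ + 1]addrC addrA lerD2r.
Qed.

(** The operator [G(Delta)] applied to the logarithm, [Delta] being the forward
    difference; thus [(1 + X) ^ k] acts as the translation by [k]. *)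
Definition polylog (G : {poly int}) x : R :=
  \sum_(j < size G) (G`_j)%:~R * dlog j x.

Lemma polylog_wide (n : nat) (G : {poly int}) x : (size G <= n)%N ->
  polylog G x = \sum_(j < n) (G`_j)%:~R * dlog j x.
Proof.
move=> Gn; rewrite /polylog (big_ord_widen n (fun j => (G`_j)%:~R * dlog j x) Gn).
rewrite big_mkcond; apply: eq_bigr => i _; case: ltnP => // Gi.
by rewrite nth_default// mul0r.
Qed.

Lemma polylogD G H x : polylog (G + H) x = polylog G x + polylog H x.
Proof.
pose n := maxn (size G) (size H).
rewrite !(@polylog_wide n) ?leq_maxl ?leq_maxr ?size_polyD//.
by rewrite -big_split; apply: eq_bigr => i _; rewrite coefD rmorphD mulrDl.
Qed.

Lemma polylogN G x : polylog (- G) x = - polylog G x.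
Proof.
rewrite /polylog size_polyN -sumrN; apply: eq_bigr => i _.
by rewrite coefN rmorphN mulNr.
Qed.

Lemma polylog0 x : polylog 0 x = 0.
Proof. by rewrite /polylog size_poly0 big_ord0. Qed.

Lemma polylog1 x : polylog 1 x = ln x.
Proof. by rewrite /polylog size_poly1 big_ord1 coef1 mul1r. Qed.

Lemma polylog_sum (I : Type) (r : seq I) (F : I -> {poly int}) x :
  polylog (\sum_(i <- r) F i) x = \sum_(i <- r) polylog (F i) x.
Proof.
by apply: (big_morph (polylog^~ x)) => [G H|]; rewrite (polylogD, polylog0).
Qed.

Lemma polylogMX G x : polylog ('X * G) x = polylog G (x + 1) - polylog G x.
Proof.
rewrite (@polylog_wide (size G).+1); last first.
  by rewrite mulrC (leq_trans (size_polyMleq _ _))// size_polyX addn2.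
rewrite big_ord_recl coefXM mul0r add0r /polylog -sumrB.
by apply: eq_bigr => i _; rewrite coefXM/= mulrBr.
Qed.

Lemma polylog_shift k G x :
  polylog ((1 + 'X) ^+ k * G) x = polylog G (x + k%:R).
Proof.
elim: k x => [|k IH] x; first by rewrite mul1r addr0.
rewrite exprS -mulrA mulrDl mul1r polylogD polylogMX addrC subrK IH.
by rewrite -addrA [1 + _]addrC natr1.
Qed.

(** Divisibility by [X ^ (d + 1)]; a boolean, as it will be the value of a moment. *)
Definition low d (G : {poly int}) : bool := [forall j : 'I_d.+1, G`_j == 0].

Lemma lowP d (G : {poly int}) :
  reflect (forall j, (j <= d)%N -> G`_j = 0) (low d G).
Proof.
apply: (iffP forallP) => [h j jd|h j]; last by rewrite h// -ltnS.
by apply/eqP; exact: (h (Ordinal (jd : (j < d.+1)%N))).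
Qed.

(** The term of least degree of [G] dominates at infinity. *)
Lemma polylog_small d (G : {poly int}) : low d G ->
  exists2 C : R, 0 <= C & forall x, 1 <= x -> `|polylog G x| <= C / x ^+ d.+1.
Proof.
move=> /lowP G0; exists (\sum_(j < size G) `|(G`_j)%:~R| * j.-1`!%:R).
  by apply: sumr_ge0 => j _; rewrite mulr_ge0.
move=> x x1; rewrite /polylog (le_trans (ler_norm_sum _ _ _))// mulr_suml.
have x0 : 0 < x by rewrite (lt_le_trans _ x1).
apply: ler_sum => j _; rewrite normrM -mulrA.
have [jd|jd] := leqP j d; first by rewrite G0// normr0 !mul0r.
rewrite ler_wpM2l//; case: (nat_of_ord j) jd => // i di.
rewrite (le_trans (dlogS_le _ x0))//= ler_wpM2l//.
by rewrite lef_pV2 ?posrE ?exprn_gt0// ler_weXn2l.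
Qed.

(** The remaining terms are smaller by a factor [x], hence at most half of the
    leading one from some point [x0] on. *)
Lemma polylog_large d (G : {poly int}) :
  (forall j, (j <= d)%N -> G`_j = 0) -> G`_d.+1 != 0 ->
  exists2 c : R, 0 < c & exists2 x0 : R, 1 <= x0 &
    forall x, x0 <= x -> c / x ^+ d.+1 <= `|polylog G x|.
Proof.
move=> G0 Gd.
pose H := G - (G`_d.+1)%:P * 'X^(d.+1).
have lowH : low d.+1 H.
  apply/lowP => j; rewrite leq_eqVlt coefB coefCM coefXn => /predU1P[->|jd].
    by rewrite eqxx mulr1 subrr.
  by rewrite (ltn_eqF jd) mulr0 subr0 G0.
have [C C0 HC] := polylog_small lowH.
(* The leading term is at least [(2 * x) ^- d.+1], as [d.+1 <= x]; half of it is
   kept. *)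
pose c : R := (2 ^+ d.+2)^-1.
have c0 : 0 < c by rewrite invr_gt0 exprn_gt0.
exists c => //; exists (1 + d.+1%:R + C / c).
  by rewrite -addrA lerDl addr_ge0// divr_ge0// ltW.
move=> x xge.
have Cc : 0 <= C / c by rewrite divr_ge0// ltW.
have x1 : 1 <= x.
  by rewrite (le_trans _ xge)// -addrA lerDl addr_ge0.
have x0 : 0 < x by rewrite (lt_le_trans _ x1).
have xd : d.+1%:R <= x.
  by rewrite (le_trans _ xge)// -[leLHS]addr0 lerD// lerDr.
have xC : C <= c * x.
  rewrite mulrC -ler_pdivrMr// (le_trans _ xge)// lerDr.
  by rewrite addr_ge0.
have -> : G = (G`_d.+1)%:P * 'X^(d.+1) + H by rewrite /H addrC subrK.
have main : polylog ((G`_d.+1)%:P * 'X^(d.+1)) x = (G`_d.+1)%:~R * dlog d.+1 x.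
  rewrite (@polylog_wide d.+2); last first.
    by rewrite mul_polyC (leq_trans (size_scale_leq _ _))// size_polyXn.
  rewrite (bigD1 ord_max)//= coefCM coefXn eqxx mulr1 big1 ?addr0// => i id.
  by rewrite coefCM coefXn -val_eqE/= in id *; rewrite (negPf id) mulr0 mul0r.
rewrite polylogD main.
set u := _%:~R * _; set v := polylog _ _.
have uge : ((2 * x) ^+ d.+1)^-1 <= `|u|.
  apply: (@le_trans _ _ `|dlog d.+1 x|).
    rewrite (le_trans _ (dlogS_ge _ x0))//.
    rewrite lef_pV2 ?posrE ?exprn_gt0 ?addr_gt0 ?mulr_gt0//.
    by rewrite lerXn2r ?nnegrE ?addr_ge0 ?mulr_ge0 ?(ltW x0)//; lra.
  rewrite /u normrM ler_peMl// -intr_norm ler1z -gtz0_ge1 normr_gt0//.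
have vle : `|v| <= C / x ^+ d.+2 by exact: HC.
have vle2 : `|v| <= c / x ^+ d.+1.
  rewrite (le_trans vle)// exprSr invfM mulrA mulrAC ler_wpM2r//.
    by rewrite invr_ge0 exprn_ge0// ltW.
  by rewrite ler_pdivrMr.
have e : ((2 * x) ^+ d.+1)^-1 = 2 * (c / x ^+ d.+1).
  rewrite /c exprMn [2 ^+ d.+2]exprS.
  by field; rewrite !expf_neq0// gt_eqF.
have := ler_normB (u + v) v; rewrite addrK => tri.
lra.
Qed.

End log_differences.

(** * Exponential sums along differences of the logarithm *)

(** A difference operator, that is, an [H] that vanishes at 0, raises the order
    of vanishing, by exactly one if [H`_1] is not zero. *)
Lemma coefM_order (H G : {poly int}) (j : nat) :
  H`_0 = 0 -> (forall i, (i < j)%N -> G`_i = 0) ->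
  (forall i, (i <= j)%N -> (H * G)`_i = 0) /\ (H * G)`_j.+1 = H`_1 * G`_j.
Proof.
move=> H0 G0; split=> [i ij|]; rewrite coefM.
  apply: big1 => -[[|k] ki] _ /=; first by rewrite H0 mul0r.
  by rewrite G0 ?mulr0// (leq_trans _ ij)// subnS prednK ?leq_subr ?subn_gt0.
rewrite !big_ord_recl/= H0 mul0r add0r /bump/= subSS subn0 big1 ?addr0// => k _.
by rewrite G0 ?mulr0//; have := ltn_ord k; rewrite /= /bump; lia.
Qed.

Lemma coef_1DXn (h : nat) :
  ((1 + 'X : {poly int}) ^+ h)`_0 = 1 /\ ((1 + 'X : {poly int}) ^+ h)`_1 = h%:Z.
Proof.
elim: h => [|h [IH0 IH1]]; first by rewrite expr0 !coef1.
rewrite exprS mulrDl mul1r !coefD !coefXM/= IH0 IH1 addr0; split=> //.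
by rewrite -addn1 PoszD.
Qed.

Lemma coef_1DXn_sub1 (h : nat) :
  ((1 + 'X : {poly int}) ^+ h - 1)`_0 = 0 /\
  ((1 + 'X : {poly int}) ^+ h - 1)`_1 = h%:Z.
Proof.
have [e0 e1] := coef_1DXn h.
by rewrite !coefB e0 e1 !coef1/= subrr subr0.
Qed.

Lemma lowPn d (G : {poly int}) : ~~ low d G ->
  exists2 j, (j <= d)%N & G`_j != 0 /\ forall i, (i < j)%N -> G`_i = 0.
Proof.
move=> /forallPn[k Gk].
have ex : exists k, G`_k != 0 by exists k.
case: (ex_minnP ex) => j Gj jmin; exists j.
  by rewrite (leq_trans (jmin _ Gk))// -ltnS.
split=> // i ij; apply/eqP; apply: contraLR ij => Gi.
by rewrite -leqNgt jmin.
Qed.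

Section exponential_sums.
Context {R : realType}.
Variables (N : nat -> nat) (S : nat -> R) (d : nat).
Hypothesis Noo : forall k, \forall m \near \oo, (k <= N m)%N.
Hypothesis S_gt0 : \forall m \near \oo, 0 < S m.
Hypothesis S_small : forall e : R, 0 < e ->
  \forall m \near \oo, S m <= e * (N m)%:R ^+ d.+1.
Hypothesis S_large : forall e : R, 0 < e ->
  \forall m \near \oo, (N m)%:R ^+ d <= e * S m.

(** The terms with [n <= q * N m] contribute at most a multiple of [q] to an
    average; beyond the cut [n] is comparable with [N m], so that powers of [n]
    can be replaced by powers of [N m]. *)
Definition cut (q : R) m := (Num.truncn (q * (N m)%:R)).+1.

Lemma cut_le q m n : (cut q m <= n)%N -> q * (N m)%:R <= n%:R.
Proof.
by move=> h; rewrite ltW// (lt_le_trans (truncnS_gt _))// ler_nat.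
Qed.

Lemma Noo_real (A : R) : \forall m \near \oo, A <= (N m)%:R.
Proof.
have := Noo (Num.truncn A).+1; apply: filterS => m h.
by rewrite ltW// (lt_le_trans (truncnS_gt _))// ler_nat.
Qed.

Lemma small_avg_cut (u : nat -> nat -> R[i]) :
  (forall m n, normc (u m n) <= 2) ->
  (forall q e : R, 0 < q < 1 -> 0 < e -> \forall m \near \oo,
     normc (\sum_(cut q m <= n < (N m).+1) u m n) <= e * (N m)%:R) ->
  small_avg N u.
Proof.
move=> u2 uq e e0.
pose q : R := Num.min (e / 8) 2^-1.
have q0 : 0 < q by rewrite lt_min !divr_gt0// invr_gt0/=.
have q1 : q < 1 by rewrite gt_min; apply/orP; right; lra.
have qe : q <= e / 8 by rewrite ge_min lexx.
have e2 : 0 < e / 2 by rewrite divr_gt0.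
have q01 : 0 < q < 1 by rewrite q0.
have near1 := uq q _ q01 e2.
have near2 := Noo_real (8 / e).
have near3 := Noo 1%N.
near=> m.
have h1 : normc (\sum_(cut q m <= n < (N m).+1) u m n) <= e / 2 * (N m)%:R.
  by near: m.
have h2 : 8 / e <= (N m)%:R by near: m.
have h3 : (1 <= N m)%N by near: m.
have qN0 : 0 <= q * (N m)%:R by rewrite mulr_ge0// ltW.
have /andP[qNt _] := truncn_itv qN0.
have cutN : (cut q m <= (N m).+1)%N.
  rewrite ltnS -(ler_nat R) (le_trans qNt)// ler_piMl//.
  exact: ltW.
rewrite (@big_cat_nat _ _ _ (cut q m))//=.
rewrite (le_trans (ler_normcD _ _))//.
have hs : normc (\sum_(1 <= i < cut q m) u m i) <= 2 * (q * (N m)%:R).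
  rewrite (le_trans (@normc_sum_le R _ _ _ 2 _ _))//.
  by rewrite /cut subSS subn0 ler_wpM2l.
rewrite (le_trans (lerD hs h1))//.
have : q * (N m)%:R <= e / 8 * (N m)%:R by rewrite ler_wpM2r.
move: h2; rewrite ler_pdivrMr// => h2.
lra.
Unshelve. all: by end_near. Qed.

Lemma cut_facts (q A : R) : 0 < q < 1 -> \forall m \near \oo,
  [/\ 0 < S m, (1 <= N m)%N, (cut q m <= (N m).+1)%N & forall n,
     (cut q m <= n)%N -> [/\ 1 <= n%:R :> R, A <= n%:R & q * (N m)%:R <= n%:R]].
Proof.
move=> /andP[q0 q1].
have near2 := Noo_real (A / q); have near3 := Noo 1%N.
near=> m.
have h2 : A / q <= (N m)%:R by near: m.
have h3 : (1 <= N m)%N by near: m.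
have qN0 : 0 <= q * (N m)%:R by rewrite mulr_ge0// ltW.
split=> //.
- by near: m.
- have /andP[qNt _] := truncn_itv qN0.
  rewrite ltnS -(ler_nat R) (le_trans qNt)// ler_piMl//.
  exact: ltW.
- move=> n hn; have := cut_le hn => qn; split=> //.
  + by rewrite ler1n (leq_trans _ hn).
  + by rewrite (le_trans _ qn)// mulrC -ler_pdivrMr.
Unshelve. all: by end_near. Qed.

Lemma polylog_cut_le (G : {poly int}) (k : nat) (q C : R) m (n : nat) :
  0 < q -> (1 <= N m)%N -> 0 <= C -> 0 < S m ->
  (forall x, 1 <= x -> `|polylog G x| <= C / x ^+ k) ->
  1 <= n%:R :> R -> q * (N m)%:R <= n%:R ->
  `|S m * polylog G n%:R| <= S m * C / (q * (N m)%:R) ^+ k.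
Proof.
move=> q0 N1 C0 S0 GC n1 qn.
have N0 : 0 < (N m)%:R :> R by rewrite ltr0n.
rewrite normrM gtr0_norm// -mulrA ler_wpM2l ?(ltW S0)//.
rewrite (le_trans (GC _ n1))// ler_wpM2l//.
have n0 : 0 < n%:R :> R by rewrite (lt_le_trans _ n1).
rewrite lef_pV2 ?posrE ?exprn_gt0 ?mulr_gt0//.
by rewrite lerXn2r// nnegrE ?mulr_ge0// ltW.
Qed.

(** The phase has size [S / n ^ (d + 1)], which tends to 0 beyond the cut. *)
Lemma exp_sum_low (G : {poly int}) : low d G ->
  small_avg N (fun m n => expi (S m * polylog G n%:R) - 1).
Proof.
move=> Gd; have [C C0 GC] := @polylog_small R _ _ Gd.
apply: small_avg_cut => [m n|q e q01 e0].
  by rewrite (le_trans (ler_normcD _ _))// normc_opp normc_expi normc1.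
have /andP[q0 q1] := q01.
have near1 := cut_facts 0 q01.
pose e' := e * q ^+ d.+1 / (2 * (C + 1)).
have e'0 : 0 < e' by rewrite divr_gt0 ?mulr_gt0 ?exprn_gt0// ltr_wpDl.
have near2 := S_small e'0.
near=> m.
have [S0 N1 cN hn] : [/\ 0 < S m, (1 <= N m)%N, (cut q m <= (N m).+1)%N &
    forall n, (cut q m <= n)%N ->
    [/\ 1 <= n%:R :> R, 0 <= n%:R :> R & q * (N m)%:R <= n%:R]].
  by near: m.
have Se : S m <= e' * (N m)%:R ^+ d.+1 by near: m.
have N0 : 0 < (N m)%:R :> R by rewrite ltr0n.
suff bd n : (cut q m <= n < (N m).+1)%N ->
    normc (expi (S m * polylog G n%:R) - 1) <= e.
  apply: le_trans (normc_sum_le (ltW e0) bd) _.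
  by rewrite (ler_wpM2l (ltW e0))// ler_nat /cut subSS leq_subr.
move=> /andP[/hn[n1 _ qn] _].
rewrite -[X in _ - X]expi0 (le_trans (expi_lip _ _))// subr0.
have := @polylog_cut_le G d.+1 q C m n q0 N1 C0 S0 GC n1 qn.
rewrite -[2]/(2%:R) => /(ler_wpM2l (ler0n R 2))/le_trans; apply.
have NX0 : 0 < (N m)%:R ^+ d.+1 :> R by rewrite exprn_gt0.
have qX0 : 0 < q ^+ d.+1 by rewrite exprn_gt0.
rewrite exprMn mulrA ler_pdivrMr ?mulr_gt0//.
apply: (@le_trans _ _ (2 * (e' * (N m)%:R ^+ d.+1 * (C + 1)))).
  by rewrite ler_wpM2l// ler_pM ?(ltW S0)// lerDl.
rewrite le_eqVlt; apply/orP; left; apply/eqP; rewrite /e'; field.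
by rewrite gt_eqF// ltr_wpDl.
Unshelve. all: by end_near. Qed.

(** If [G] vanishes to order exactly [d], the increments of the phase have the
    exact size [S / N ^ (d + 1)] beyond the cut, and their variation the size
    [S / N ^ (d + 2)]. The former tends to 0, so that [Kusmin_Landau] applies and
    bounds the average by a multiple of [N ^ d / S]. *)
Lemma exp_sum_top (G : {poly int}) :
  (forall i, (i < d)%N -> G`_i = 0) -> G`_d != 0 ->
  small_avg N (fun m n => expi (S m * polylog G n%:R)).
Proof.
move=> G0 Gd.
have X0 : ('X : {poly int})`_0 = 0 by rewrite coefX.
have X1 : ('X : {poly int})`_1 = 1 by rewrite coefX.
have [XG0 XGd] := coefM_order X0 G0; rewrite X1 mul1r in XGd.
have XGlt i : (i < d.+1)%N -> ('X * G)`_i = 0 by exact: XG0.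
have [XXG0 _] := coefM_order X0 XGlt.
have [C1 C10 HC1] : exists2 C : R, 0 <= C &
    forall x, 1 <= x -> `|polylog ('X * G) x| <= C / x ^+ d.+1.
  by apply: polylog_small; exact/lowP.
have [C2 C20 HC2] : exists2 C : R, 0 <= C &
    forall x, 1 <= x -> `|polylog ('X * ('X * G)) x| <= C / x ^+ d.+2.
  by apply: polylog_small; exact/lowP.
have [||c c0 [x0 x01 Hc]] := @polylog_large R d ('X * G).
- exact: XG0.
- by rewrite XGd.
apply: small_avg_cut => [m n|q e q01 e0].
  by rewrite normc_expi ler1n.
have /andP[q0 q1] := q01.
have near1 := cut_facts x0 q01.
(* The largest ratio [S / N ^ (d + 1)] for which all increments are at most 1/2. *)
pose e1 := q ^+ d.+1 / (2 * (C1 + 1)).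
have e10 : 0 < e1 by rewrite divr_gt0 ?mulr_gt0 ?exprn_gt0// ltr_wpDl.
have near2 := S_small e10.
(* The two summands come from the boundary terms and from the variation. *)
pose K := 4 * 2 ^+ d.+1 / c +
  8 * C2 * (2 ^+ d.+1) ^+ 2 / (q ^+ d.+2 * c ^+ 2).
have K0 : 0 < K.
  rewrite /K ltr_pwDl ?divr_gt0 ?mulr_gt0 ?exprn_gt0//.
  have q0' := ltW q0; have c0' := ltW c0.
  apply: divr_ge0; first by rewrite mulr_ge0 ?sqr_ge0// mulr_ge0.
  by apply: mulr_ge0; exact: exprn_ge0.
have eK : 0 < e / K by rewrite divr_gt0.
have near3 := S_large eK.
near=> m.
have [S0 N1 cN hn] : [/\ 0 < S m, (1 <= N m)%N, (cut q m <= (N m).+1)%N &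
    forall n, (cut q m <= n)%N ->
    [/\ 1 <= n%:R :> R, x0 <= n%:R & q * (N m)%:R <= n%:R]].
  by near: m.
have Se : S m <= e1 * (N m)%:R ^+ d.+1 by near: m.
have Sl : (N m)%:R ^+ d <= e / K * S m by near: m.
have N0 : 0 < (N m)%:R :> R by rewrite ltr0n.
have NX0 k : 0 < (N m)%:R ^+ k :> R by rewrite exprn_gt0.
have qX0 k : 0 < q ^+ k :> R by rewrite exprn_gt0.
pose lo := S m * c / (2 * (N m)%:R) ^+ d.+1.
pose eta := S m * C2 / (q * (N m)%:R) ^+ d.+2.
have lo0 : 0 < lo by rewrite divr_gt0 ?exprn_gt0 ?mulr_gt0.
have eta0 : 0 <= eta.
  by rewrite divr_ge0 ?exprn_ge0 ?mulr_ge0 ?(ltW S0) ?(ltW q0).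
pose psi n : R := S m * polylog G n%:R.
have dpsi n : psi n.+1 - psi n = S m * polylog ('X * G) n%:R.
  by rewrite /psi -mulrBr polylogMX natr1.
have dlo n : (cut q m <= n <= (N m).+1)%N ->
    lo <= `|psi n.+1 - psi n| <= 2^-1.
  move=> /andP[an nN]; have [n1 nx0 qn] := hn _ an.
  rewrite dpsi; apply/andP; split.
    rewrite normrM gtr0_norm// /lo -mulrA ler_wpM2l ?(ltW S0)//.
    apply: le_trans (Hc _ nx0); rewrite ler_wpM2l ?(ltW c0)//.
    have n0 : 0 < n%:R :> R by rewrite (lt_le_trans _ n1).
    rewrite lef_pV2 ?posrE ?exprn_gt0 ?mulr_gt0//.
    rewrite lerXn2r ?nnegrE ?mulr_ge0 ?(ltW n0)// -natrM ler_nat.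
    by rewrite (leq_trans nN)// mul2n -addnn -addn1 leq_add2l.
  rewrite (le_trans (polylog_cut_le q0 N1 C10 S0 HC1 n1 qn))//.
  rewrite exprMn ler_pdivrMr ?mulr_gt0//.
  apply: (@le_trans _ _ (e1 * (N m)%:R ^+ d.+1 * (C1 + 1))).
    by rewrite ler_pM ?(ltW S0)// lerDl.
  rewrite le_eqVlt; apply/orP; left; apply/eqP; rewrite /e1; field.
  by rewrite gt_eqF// ltr_wpDl.
have ddelta n : (cut q m <= n < (N m).+1)%N ->
    `|(psi n.+2 - psi n.+1) - (psi n.+1 - psi n)| <= eta.
  move=> /andP[an nN]; have [n1 nx0 qn] := hn _ an.
  rewrite !dpsi -mulrBr -natr1 -polylogMX.
  exact: (polylog_cut_le q0 N1 C20 S0 HC2 n1 qn).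
have KL := Kusmin_Landau cN lo0 eta0 dlo ddelta.
rewrite (le_trans KL)//.
apply: (@le_trans _ _ (4 / lo + (N m)%:R * (8 * eta / lo ^+ 2))).
  rewrite lerD2l; apply: ler_wpM2r.
    by rewrite divr_ge0 ?sqr_ge0// mulr_ge0.
  by rewrite ler_nat /cut subSS leq_subr.
have -> : 4 / lo + (N m)%:R * (8 * eta / lo ^+ 2) =
    K * ((N m)%:R ^+ d / S m) * (N m)%:R.
  rewrite /lo /eta /K !exprMn !exprS.
  field; rewrite !gt_eqF ?exprn_gt0//.
rewrite ler_wpM2r// mulrA ler_pdivrMr//.
by move: Sl; rewrite mulrAC ler_pdivlMr// mulrC.
Unshelve. all: by end_near. Qed.

(** Descending induction on the order of vanishing of [G]: the correlation of
    the sequence at lag [h] is the sequence for [((1 + 'X) ^+ h - 1) * G], which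
    vanishes to one more order. *)
Lemma exp_sum_notlow (G : {poly int}) : ~~ low d G ->
  small_avg N (fun m n => expi (S m * polylog G n%:R)).
Proof.
move=> /lowPn[j jd [Gj Glt]].
have [i jid] : exists i, (j + i)%N = d by exists (d - j)%N; rewrite subnKC.
elim: i j G {jd} jid Gj Glt => [|i IH] j G jid Gj Glt.
  by rewrite addn0 in jid; subst j; exact: exp_sum_top.
apply: van_der_Corput => // [m n|h h0]; first by rewrite normc_expi.
have [H0 H1] := coef_1DXn_sub1 h.
have [HG0 HG1] := coefM_order H0 Glt.
have := IH j.+1 (((1 + 'X) ^+ h - 1) * G).
rewrite addSnnS H1 in HG1 * => /(_ jid).
rewrite HG1 mulf_neq0 ?eqz_nat -?lt0n// => /(_ isT HG0).
move=> sa e e0; have := sa e e0; apply: filterS => m.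
under eq_bigr => n _.
  rewrite mulrBl mul1r polylogD polylogN polylog_shift -natrD mulrBr expiB.
  over.
by [].
Unshelve. all: by end_near. Qed.

End exponential_sums.

(** * Closeness of the multiplicative function to an Archimedean character *)

Lemma sum_half_le (n m : nat) :
  (\sum_(1 <= k < m.+1) n %/ 2 ^ k + n %/ 2 ^ m <= n)%N.
Proof.
elim: m => [|m IH]; first by rewrite big_geq// add0n divn1.
rewrite (leq_trans _ IH)// big_nat_recr//= -addnA leq_add2l addnn.
by rewrite expnSr divnMA -muln2 leq_divM.
Qed.

(** Legendre's formula bounds the exponent by a geometric series. *)
Lemma logn_fact_le (p n : nat) : prime p -> (logn p n`! <= n)%N.
Proof.
move=> pp; rewrite logn_fact// (leq_trans _ (sum_half_le n n))//.
rewrite (leq_trans _ (leq_addr _ _))//; apply: leq_sum => k _.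
by case: k => // k; rewrite leq_div2l ?expn_gt0// leq_exp2r ?prime_gt1.
Qed.

Lemma logn_factE (p n : nat) : (logn p n`! = \sum_(1 <= k < n.+1) logn p k)%N.
Proof.
elim: n => [|n IH]; first by rewrite big_geq// logn1.
by rewrite factS lognM ?fact_gt0// big_nat_recr//= IH addnC.
Qed.

Section closeness.
Context {R : realType}.
Variables (f : nat -> R[i]) (s : int) (T T' : nat) (tau : R).
Hypothesis f_unit : forall n, (0 < n)%N -> normc (f n) = 1.
Hypothesis f_mul : completely_multiplicative f.
Hypothesis tau0 : 0 <= tau.
Hypothesis f_large : forall p, prime p -> (T < p)%N -> (p <= T')%N ->
  f p = cpow_i p s.
Hypothesis f_small : forall p, prime p -> (p <= T)%N ->
  normc (f p - cpow_i p s) <= tau.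

Lemma cpow_iM (m n : nat) : (0 < m)%N -> (0 < n)%N ->
  cpow_i (m * n) s = cpow_i m s * cpow_i n s :> R[i].
Proof.
move=> m0 n0; rewrite /cpow_i natrM lnM ?posrE ?ltr0n//.
by rewrite mulrDr expiD.
Qed.

Definition small_factors (n : nat) : nat :=
  (\sum_(p < T.+1 | prime p) logn p n)%N.

(** Each prime factor up to [T] costs at most [tau] and the others nothing,
    since all values have modulus one. *)
Lemma mult_close n : (0 < n)%N -> (n <= T')%N ->
  normc (f n - cpow_i n s) <= tau * (small_factors n)%:R.
Proof.
have [f1 fM] := f_mul.
have [k] := ubnP n; elim: k n => // k IH n; rewrite ltnS => nk n0 nT.
have [n1|n1] := leqP n 1.
  have -> : n = 1%N by apply/eqP; rewrite eqn_leq n1.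
  by rewrite f1 /cpow_i ln1 mulr0 expi0 subrr normc0 mulr_ge0.
pose p := pdiv n; have pp : prime p := pdiv_prime n1.
pose q := (n %/ p)%N.
have pq : n = (p * q)%N by rewrite mulnC divnK// pdiv_dvd.
have q0 : (0 < q)%N by move: n0; rewrite pq muln_gt0 => /andP[].
have p0 := prime_gt0 pp.
have qn : (q < n)%N by rewrite ltn_Pdiv// prime_gt1.
have IHq := IH q (leq_trans qn nk) q0 (leq_trans (ltnW qn) nT).
rewrite pq fM// cpow_iM//.
have -> : f p * f q - cpow_i p s * cpow_i q s =
    (f p - cpow_i p s) * f q + cpow_i p s * (f q - cpow_i q s) by ring.
rewrite (le_trans (ler_normcD _ _))// !normcM f_unit// mulr1 normc_expi mul1r.
have -> : small_factors (p * q) =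
    ((\sum_(r < T.+1 | prime r) logn r p) + small_factors q)%N.
  rewrite /small_factors -big_split; apply: eq_bigr => r rp.
  by rewrite lognM.
rewrite natrD mulrDr lerD//.
have [pT|pT] := leqP p T; last first.
  rewrite f_large ?subrr ?normc0 ?mulr_ge0//.
  by rewrite (leq_trans _ nT)// dvdn_leq// pdiv_dvd.
rewrite (le_trans (f_small pp pT))// ler_peMr// ler1n.
rewrite (bigD1 (Ordinal (pT : (p < T.+1)%N)))//= (leq_trans _ (leq_addr _ _))//.
by rewrite lognE pp p0 dvdnn.
Qed.

(** A prime [p] occurs at most [N] times, with multiplicity, in the
    factorizations of the integers up to [N], by [logn_fact_le]; and there are at
    most [T] primes to count. *)
Lemma sum_mult_close (N : nat) : (N <= T')%N ->
  \sum_(1 <= n < N.+1) normc (f n - cpow_i n s) <= tau * T%:R * N%:R.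
Proof.
move=> NT.
apply: (@le_trans _ _
    (\sum_(1 <= n < N.+1) tau * (small_factors n)%:R)).
  apply: ler_sum_nat => n /andP[n0 nN].
  by apply: mult_close => //; rewrite (leq_trans _ NT).
rewrite -mulr_sumr -mulrA ler_wpM2l// -natr_sum -natrM ler_nat.
rewrite /small_factors exchange_big/=.
apply: (@leq_trans (\sum_(p < T.+1 | prime p) N)).
  by apply: leq_sum => p pp; rewrite -logn_factE logn_fact_le.
rewrite big_mkcond big_ord_recl/= add0n.
apply: (@leq_trans (\sum_(p < T) N)); first by apply: leq_sum => p _; case: ifP.
by rewrite sum_nat_const card_ord.
Qed.

End closeness.

(** * Correlations of the multiplicative function *)

Section monomials.
Context {R : realType}.

(** Coding monomials by lists turns products into concatenations and
    conjugation into negation of the booleans. *)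
Definition mono (l : seq (int * bool)) (y : int -> R[i]) : R[i] :=
  \prod_(kb <- l) (if kb.2 then (y kb.1)^* else y kb.1).

Definition coord (x : Xspace R) (k : int) : R[i] := set_val (x k).

(** The exponents of a monomial, as a polynomial in the difference operator;
    the translation by [K] makes the coordinates natural numbers. *)
Definition gpoly (K : nat) (l : seq (int * bool)) : {poly int} :=
  \sum_(kb <- l) (if kb.2 then - (1 + 'X) ^+ absz (kb.1 + K%:Z)
                  else (1 + 'X) ^+ absz (kb.1 + K%:Z)).

Lemma prod_close (I : Type) (l : seq I) (a b : I -> R[i]) :
  (forall i, normc (a i) <= 1) -> (forall i, normc (b i) <= 1) ->
  normc (\prod_(i <- l) a i - \prod_(i <- l) b i) <=
    \sum_(i <- l) normc (a i - b i).
Proof.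
move=> a1 b1; elim: l => [|i l IH]; first by rewrite !big_nil subrr normc0.
rewrite !big_cons.
set A := \prod_(_ <- _) _; set B := \prod_(_ <- _) _.
have -> : a i * A - b i * B = (a i - b i) * A + b i * (A - B) by ring.
rewrite (le_trans (ler_normcD _ _))// !normcM lerD//.
  rewrite ler_piMr ?normc_ge0// normc_prod.
  have : \prod_(j <- l) normc (a j) <= \prod_(j <- l) 1.
    by apply: ler_prod => j _; rewrite normc_ge0 a1.
  by rewrite big1_eq.
by rewrite (le_trans _ IH)// ler_piMl ?normc_ge0.
Qed.

Lemma coord_le1 (x : Xspace R) k : normc (coord x k) <= 1.
Proof.
have : unit_disc R (coord x k) by exact: set_valP.
by rewrite /unit_disc/= normE -[1]/(1%:C) lecR.
Qed.

Lemma mono_le1 l (x : Xspace R) : normc (mono l (coord x)) <= 1.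
Proof.
rewrite /mono normc_prod.
have : \prod_(kb <- l) normc (if kb.2 then (coord x kb.1)^* else coord x kb.1)
    <= \prod_(kb <- l) 1.
  apply: ler_prod => kb _; rewrite normc_ge0/=.
  by case: kb.2; rewrite ?normc_conj coord_le1.
by rewrite big1_eq.
Qed.

End monomials.

Lemma sum_addn_le (R : realType) (a : nat -> R) (n h M : nat) :
  (forall j, 0 <= a j) -> (n + h <= M)%N ->
  \sum_(1 <= i < n.+1) a (i + h)%N <= \sum_(1 <= i < M.+1) a i.
Proof.
move=> a0 nhM.
have -> : \sum_(1 <= i < n.+1) a (i + h)%N = \sum_(1 + h <= i < n.+1 + h) a i.
  by rewrite big_addn addnK.
rewrite [leRHS](@big_cat_nat _ _ _ (1 + h)%N)//=; last first.
  by rewrite ltnS (leq_trans _ nhM)// leq_addl.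
rewrite [X in _ <= _ + X](@big_cat_nat _ _ _ (n.+1 + h)%N)//=; last first.
  by rewrite leq_add2r.
by rewrite addrCA lerDl addr_ge0// sumr_ge0.
Qed.

Section moments.
Context {R : realType}.
Variables (f : nat -> R[i]) (t s : nat -> int) (d : nat) (N : nat -> nat).
Variable x : Xspace R.
Hypothesis f_MRT : MRT f t s.
Hypothesis x_f : extends f x.
Hypothesis N_pos : forall m : nat, (0 < m)%N -> (0 < N m)%N.
Hypothesis N_incr : increasing_from1 (fun m => (N m)%:Z).
Hypothesis N_growth : growth R t s d N.

Let S m : R := (s m.+1)%:~R.

Lemma increasing_from1_ge (u : nat -> int) m : increasing_from1 u ->
  1 <= u 1%N -> (0 < m)%N -> m%:Z <= u m.
Proof.
move=> uincr u1; elim: m => // m IH _; case: (posnP m) => [->//|m0].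
have := uincr m m.+1 m0 (ltnSn m); have := IH m0; lia.
Qed.

Lemma t_ge m : (0 < m)%N -> m%:Z <= t m.
Proof.
by apply: increasing_from1_ge; [case: f_MRT|have [_ _ _ _ ->] := f_MRT].
Qed.

Lemma s_ge m : (0 < m)%N -> m.+1%:Z <= s m.+1.
Proof.
move=> m0; have [_ _ _ _ _ /(_ m m0)[tS _ _] _ _] := f_MRT.
by have := t_ge m0; lia.
Qed.

Lemma N_to_infty k : \forall m \near \oo, (k <= N m)%N.
Proof.
near=> m.
have m0 : (0 < m)%N by near: m; exact: nbhs_infty_gt.
have km : (k <= m)%N by near: m; exact: nbhs_infty_ge.
rewrite (leq_trans km)// -lez_nat.
by apply: (increasing_from1_ge N_incr) => //; rewrite lez_nat N_pos.
Unshelve. all: by end_near. Qed.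

Lemma S_ge1 m : (0 < m)%N -> 1 <= S m.
Proof. by move=> m0; rewrite ler1z; have := s_ge m0; lia. Qed.

Lemma S_pos : \forall m \near \oo, 0 < S m.
Proof.
near=> m; rewrite (lt_le_trans _ (S_ge1 _))//.
by near: m; exact: nbhs_infty_gt.
Unshelve. all: by end_near. Qed.

Lemma prec_le (a b : nat -> R) (e : R) : prec a b -> 0 < e ->
  (forall m, (0 < m)%N -> 0 < b m) -> \forall m \near \oo, a m <= e * b m.
Proof.
move=> /cvgrPdist_le ab e0 b0; have := ab e e0 => near1.
near=> m.
have h : `|0 - a m / b m| <= e by near: m.
have m0 : (0 < m)%N by near: m; exact: nbhs_infty_gt.
move: h; rewrite sub0r normrN normrM normfV (gtr0_norm (b0 _ m0)).
rewrite ler_pdivrMr ?b0//; apply: le_trans; exact: ler_norm.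
Unshelve. all: by end_near. Qed.

Lemma powR_invK (a : R) k : 0 <= a -> (a `^ (k.+1%:R)^-1) ^+ k.+1 = a.
Proof.
by move=> a0; rewrite -powR_mulrn ?powR_ge0// -powRrM mulVf// powRr1.
Qed.

Lemma N_posR m : (0 < m)%N -> 0 < (N m)%:R :> R.
Proof. by move=> m0; rewrite ltr0n N_pos. Qed.

(** The growth hypothesis raised to the power [d + 1]. *)
Lemma S_small_growth (e : R) : 0 < e ->
  \forall m \near \oo, S m <= e * (N m)%:R ^+ d.+1.
Proof.
move=> e0; move: N_growth; rewrite /growth.
case: d => [[sN _]|k [sN _]].
  by have := prec_le sN e0 N_posR.
pose q : R := Num.min e 1.
have q0 : 0 < q by rewrite lt_min e0/=.
have near1 := prec_le sN q0 N_posR.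
near=> m.
have m0 : (0 < m)%N by near: m; exact: nbhs_infty_gt.
have S0 : 0 <= S m by rewrite (le_trans _ (S_ge1 m0)).
have h : S m `^ (k.+2%:R)^-1 <= q * (N m)%:R by near: m.
rewrite -(powR_invK k.+1 S0).
apply: (@le_trans _ _ ((q * (N m)%:R) ^+ k.+2)).
  by rewrite lerXn2r ?nnegrE ?powR_ge0// mulr_ge0// ltW.
rewrite exprMn ler_wpM2r// (@le_trans _ _ q)//; last by rewrite ge_min lexx.
by rewrite exprS ler_piMr ?(ltW q0)// exprn_ile1 ?(ltW q0)// ge_min lexx orbT.
Unshelve. all: by end_near. Qed.

(** For positive [d] this is the growth hypothesis raised to the power [d]; for
    [d = 0] it says that [S] tends to infinity. *)
Lemma S_large_growth (e : R) : 0 < e ->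
  \forall m \near \oo, (N m)%:R ^+ d <= e * S m.
Proof.
move=> e0; move: N_growth; rewrite /growth.
case: d => [_|k [_ sN]].
  near=> m; rewrite expr0 mulrC -ler_pdivrMr// div1r.
  have m0 : (0 < m)%N by near: m; exact: nbhs_infty_gt.
  have km : ((Num.truncn e^-1).+1 <= m)%N by near: m; exact: nbhs_infty_ge.
  rewrite ltW// (lt_le_trans (truncnS_gt _))//.
  rewrite (@le_trans _ _ m%:R)// ?ler_nat// -[m%:R]/(m%:~R) ler_int.
  by have := s_ge m0; lia.
pose q : R := Num.min e 1.
have q0 : 0 < q by rewrite lt_min e0/=.
have S0 m : (0 < m)%N -> 0 < S m by move=> m0; rewrite (lt_le_trans _ (S_ge1 m0)).
have near1 := prec_le sN q0 (fun m m0 => powR_gt0 _ (S0 m m0)).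
near=> m.
have m0 : (0 < m)%N by near: m; exact: nbhs_infty_gt.
have h : (N m)%:R <= q * S m `^ (k.+1%:R)^-1 by near: m.
rewrite -[X in _ <= _ * X](powR_invK k (ltW (S0 _ m0))).
apply: (@le_trans _ _ ((q * S m `^ (k.+1%:R)^-1) ^+ k.+1)).
  by rewrite lerXn2r ?nnegrE ?powR_ge0// mulr_ge0 ?powR_ge0// ltW.
rewrite exprMn ler_wpM2r ?exprn_ge0 ?powR_ge0//.
rewrite (@le_trans _ _ q)//; last by rewrite ge_min lexx.
by rewrite exprS ler_piMr ?(ltW q0)// exprn_ile1 ?(ltW q0)// ge_min lexx orbT.
Unshelve. all: by end_near. Qed.

Lemma N_le_t : \forall m \near \oo, (N m)%:Z <= t m.+1.
Proof.
have near1 := S_large_growth ltr01.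
move: N_growth near1; rewrite /growth; case: d => [[_ Nt] _|k _ near1].
  by near=> m; apply: Nt; near: m; exact: nbhs_infty_gt.
near=> m.
have m0 : (0 < m)%N by near: m; exact: nbhs_infty_gt.
have : (N m)%:R ^+ k.+1 <= 1 * S m by near: m.
have N1 : (1 <= N m)%N by exact: N_pos.
rewrite mul1r => NS.
have : (N m)%:R <= S m by rewrite (le_trans _ NS)// exprS ler_peMr// exprn_ege1// ler1n.
rewrite -[(N m)%:R]/((N m)%:~R) ler_int => Ns.
have [_ _ _ _ _ /(_ m m0)[_ s2 st] _ _] := f_MRT.
by rewrite (le_trans Ns)// (le_trans (ltW s2)).
Unshelve. all: by end_near. Qed.

(** The bound [t m ^- 2] at small primes beats their number, at most [t m]. *)
Lemma sum_f_close m : (0 < m)%N -> (N m)%:Z <= t m.+1 ->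
  \sum_(1 <= n < (N m).+1) normc (f n - cpow_i n (s m.+1)) <=
    (m%:R)^-1 * (N m)%:R.
Proof.
move=> m0 Nt; have tm := t_ge m0; have tm1 := t_ge (ltn0Sn m).
have tE : t m = `|t m|%N%:Z by lia.
have t0 : 0 < (t m)%:~R :> R by rewrite ltr0z; lia.
have tR : `|t m|%N%:R = (t m)%:~R :> R by rewrite [in RHS]tE.
have [f_unit fM _ _ _ _ f_large f_small] := f_MRT.
have := @sum_mult_close R f (s m.+1) `|t m|%N `|t m.+1|%N
  (((t m)%:~R ^+ 2)^-1).
have U n : (0 < n)%N -> normc (f n) = 1.
  by move=> n0; have := f_unit n n0; rewrite normE -[1]/(1%:C) => /complexI.
move=> /(_ U fM _ _ _ (N m) _)/le_trans; apply.
- by rewrite invr_ge0 sqr_ge0.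
- by move=> p pp Tp pT; apply: (f_large m p) => //; lia.
- move=> p pp pT; have : p%:Z <= t m by lia.
  move=> /(f_small m p m0 pp); rewrite normE.
  rewrite -(rmorph_int (real_complex R)) -rmorphXn -fmorphV lecR.
  exact.
- lia.
rewrite ler_wpM2r// tR expr2 invfM -mulrA mulVf ?gt_eqF// mulr1.
rewrite lef_pV2 ?posrE ?ltr0n//.
by rewrite -[m%:R]/(m%:~R) ler_int.
Qed.

Lemma cpow_i_sum (K : nat) l m n : (0 < n)%N ->
  expi (S m * polylog (gpoly K l) n%:R) =
  \prod_(kb <- l) (if kb.2
     then (cpow_i (n + absz (kb.1 + K%:Z)%R)%N (s m.+1))^*
     else cpow_i (n + absz (kb.1 + K%:Z)%R)%N (s m.+1)) :> R[i].
Proof.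
move=> n0; rewrite /gpoly polylog_sum mulr_sumr expi_sum.
apply: eq_bigr => -[k b] _ /=.
have e h : polylog ((1 + 'X) ^+ h) n%:R = ln (n + h)%N%:R :> R.
  by rewrite -[(1 + 'X) ^+ h]mulr1 polylog_shift polylog1 natrD.
by case: b; rewrite ?polylogN e /cpow_i// mulrN expiN.
Qed.

(** Up to boundary terms, a monomial evaluated along the orbit is on average
    the exponential of a phase [S (G(Delta) log)(n)], [G] encoding the
    exponents of the monomial; and the average of the latter tends to 0 or 1. *)
Lemma moments l (K : nat) :
  (forall kb, kb \in l -> 0 <= kb.1 + K%:Z) ->
  small_avg N (fun m n => mono l (coord (shiftX_z n%:Z x)) -
    (low d (gpoly K l))%:R : R[i]).
Proof.
move=> lK.
pose G := gpoly K l.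
have expG : small_avg N (fun m n => expi (S m * polylog G n%:R) -
    (low d G)%:R : R[i]).
  have [lowG|nlowG] := boolP (low d G).
    exact: (exp_sum_low N_to_infty S_pos S_small_growth).
  have := exp_sum_notlow N_to_infty S_pos S_small_growth S_large_growth nlowG.
  move=> h e e0; have := h e e0; apply: filterS => m.
  rewrite (_ : nat_of_bool false = 0%N)//.
  by under [X in normc X <= _ -> _]eq_bigr do rewrite -[expi _]subr0.
pose h (kb : int * bool) := absz (kb.1 + K%:Z).
pose H := (\sum_(kb <- l) h kb)%N.
have hH kb : kb \in l -> (h kb <= H)%N.
  by move=> kbl; rewrite /H (big_rem kb)//= leq_addr.
pose u n := mono l (coord (shiftX_z n%:Z x)) : R[i].
pose v m n := expi (S m * polylog G n%:R) : R[i].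
move=> e e0.
have e2 : 0 < e / 2 by rewrite divr_gt0.
have near1 := expG _ e2.
have near2 := N_le_t.
have near3 := N_to_infty.
have near4 := @Noo_real R N N_to_infty (8 * (K%:R + H%:R) / e).
pose m1 := (Num.truncn (4 * (size l)%:R / e : R)).+1.
near=> m.
have m0 : (0 < m)%N by near: m; exact: nbhs_infty_gt.
have mm1 : (m1 <= m)%N by near: m; exact: nbhs_infty_ge.
have mR0 : 0 < m%:R :> R by rewrite ltr0n.
have h1 : normc (\sum_(1 <= n < (N m).+1) (v m n - (low d G)%:R)) <=
  e / 2 * (N m)%:R by near: m.
have h2 : (N m)%:Z <= t m.+1 by near: m.
have h3 : (H <= N m)%N by near: m.
have h4 : 8 * (K%:R + H%:R) / e <= (N m)%:R by near: m.
have h5 : (size l)%:R / m%:R <= e / 4.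
  have : 4 * (size l)%:R / e < m%:R.
    by rewrite (lt_le_trans (truncnS_gt _))// ler_nat.
  by rewrite ltr_pdivrMr// => h5; rewrite ler_pdivrMr//; lra.
have uv n : (0 < n)%N -> normc (u (n + K)%N - v m n) <=
    \sum_(kb <- l) normc (f (n + h kb)%N - cpow_i (n + h kb)%N (s m.+1)).
  move=> n0; rewrite /u /v /G cpow_i_sum// /mono.
  rewrite (le_trans (prod_close _ _ _))//.
  - by move=> kb; case: kb.2; rewrite ?normc_conj coord_le1.
  - by move=> kb; case: kb.2; rewrite ?normc_conj normc_expi.
  rewrite [leLHS]big_seq [leRHS]big_seq; apply: ler_sum => kb kbl.
  have -> : coord (shiftX_z (n + K)%N%:Z x) kb.1 = f (n + h kb)%N.
    rewrite /coord /shiftX_z -x_f ?addn_gt0 ?n0//; congr (set_val (x _)).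
    by rewrite !PoszD /h gez0_abs ?lK// addrCA.
  by case: kb.2 => //; rewrite -rmorphB normc_conj.
have uv2 n : (0 < n)%N -> normc (u (n + K)%N - v m n) <= 2.
  move=> _; rewrite (le_trans (ler_normcD _ _))// normc_opp normc_expi.
  by rewrite -[2]/(1 + 1) lerD2r mono_le1.
pose A := \sum_(1 <= n < (N m).+1) normc (f n - cpow_i n (s m.+1)).
have hA : A <= (m%:R)^-1 * (N m)%:R by exact: sum_f_close.
have A0 : 0 <= A by apply: sumr_ge0 => n _; exact: normc_ge0.
have hsum : normc (\sum_(1 <= n < (N m).+1) (u (n + K)%N - v m n)) <=
    (size l)%:R * A + 2 * H%:R.
  have HN : (1 <= ((N m) - H).+1 <= (N m).+1)%N.
    by apply/andP; split=> //; rewrite ltnS leq_subr.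
  rewrite (@big_cat_nat _ _ _ ((N m) - H).+1)//=.
  rewrite (le_trans (ler_normcD _ _))// lerD//; last first.
    rewrite (le_trans (@normc_sum_le R _ _ _ 2 _ _))//.
      by move=> n /andP[n1 _]; apply: uv2; rewrite (leq_trans _ n1).
    by rewrite subSS subKn.
  rewrite (le_trans (normc_sum _ _ _))//.
  apply: (@le_trans _ _ (\sum_(1 <= n < ((N m) - H).+1)
      \sum_(kb <- l) normc (f (n + h kb)%N - cpow_i (n + h kb)%N (s m.+1)))).
    by apply: ler_sum_nat => n /andP[n1 _]; exact: uv.
  rewrite exchange_big/= big_seq.
  apply: (@le_trans _ _ (\sum_(kb <- l | kb \in l) A)).
    apply: ler_sum => kb kbl; have hkb := hH _ kbl.
    apply: (@sum_addn_le R (fun j => normc (f j - cpow_i j (s m.+1)))).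
      by move=> j; exact: normc_ge0.
    by rewrite -{2}(subnK h3) leq_add2l.
  by rewrite -big_seq big_const_seq count_predT iter_addr addr0 mulr_natl.
have ush : normc (\sum_(1 <= n < (N m).+1) u (n + K)%N -
    \sum_(1 <= n < (N m).+1) u n) <= 2 * K%:R * 1.
  by apply: sum_shift_close => n; exact: mono_le1.
have -> : \sum_(1 <= n < (N m).+1) (u n - (low d G)%:R) =
    (\sum_(1 <= n < (N m).+1) u n - \sum_(1 <= n < (N m).+1) u (n + K)%N) +
    (\sum_(1 <= n < (N m).+1) (u (n + K)%N - v m n) +
    \sum_(1 <= n < (N m).+1) (v m n - (low d G)%:R)).
  by rewrite !sumrB; ring.
rewrite (le_trans (ler_normcD _ _))//.
rewrite (le_trans (lerD (lexx _) (ler_normcD _ _)))//.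
rewrite normc_distC.
apply: (@le_trans _ _ (2 * K%:R * 1 + (((size l)%:R * A + 2 * H%:R) +
  e / 2 * (N m)%:R))).
  by rewrite lerD// lerD.
have hlA : (size l)%:R * A <= e / 4 * (N m)%:R.
  apply: (@le_trans _ _ ((size l)%:R / m%:R * (N m)%:R)).
    by rewrite -mulrA ler_wpM2l.
  by rewrite ler_wpM2r.
move: h4; rewrite ler_pdivrMr// => h4.
have K0 : 0 <= K%:R :> R by [].
have H0 : 0 <= H%:R :> R by [].
lra.
Unshelve. all: by end_near. Qed.

End moments.

(** * The Stone-Weierstrass theorem *)

(** The point is any element of [T]: it serves only to make [T] a pointed type. *)
Lemma compact_cover_pointed (T : topologicalType) (p : T) :
  @compact T = @cover_compact T.
Proof.
pose T' : ptopologicalType :=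
  HB.pack (Topological.sort T) (isPointed.Build T p) (Topological.class T).
exact: (@compact_cover T').
Qed.

Section Stone_Weierstrass.
Context {R : realType} {T : topologicalType}.
Variable p0 : T.
Hypothesis Tcompact : compact [set: T].
Variable A : set (T -> R).
Hypothesis A_cst : forall c, A (fun=> c).
Hypothesis A_add : forall f g, A f -> A g -> A (fun x => f x + g x).
Hypothesis A_mul : forall f g, A f -> A g -> A (fun x => f x * g x).
Hypothesis A_cont : forall f, A f -> continuous f.
Hypothesis A_sep : forall x y, x <> y -> exists2 f, A f & f x <> f y.

(** Membership in the uniform closure of [A], which will be shown to be a lattice
    that interpolates values at pairs of points. *)
Definition approx (f : T -> R) : Prop :=
  forall e : R, 0 < e -> exists2 g, A g & forall x, `|f x - g x| <= e.

(** A division-free iteration for the square root of [u ^ 2]: it increases to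
    [`|u|], uniformly on [[-1, 1]], and consists of polynomials. *)
Fixpoint abs_poly (n : nat) (u : R) : R :=
  if n is k.+1 then abs_poly k u + (u ^+ 2 - abs_poly k u ^+ 2) / 2 else 0.

(** The error [w] is multiplied at each step by a factor at most [1 - w / 2],
    and [2 / (n + 1)] decreases more slowly than that. *)
Lemma abs_poly_close n (u : R) : `|u| <= 1 ->
  0 <= `|u| - abs_poly n u <= 2 / n.+1%:R /\ `|u| - abs_poly n u <= `|u|.
Proof.
move=> u1; have u0 := normr_ge0 u.
elim: n => [|n [/andP[IH0 IH1] IH2]].
  by rewrite subr0 u0 lexx divr1 (le_trans u1)// ler1n.
rewrite /=; set p := abs_poly n u in IH0 IH1 IH2 *; set v := `|u| in u0 u1 IH0 IH1 IH2 *.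
have -> : u ^+ 2 = v ^+ 2 by rewrite /v real_normK// num_real.
pose w := v - p.
have wE : v - (p + (v ^+ 2 - p ^+ 2) / 2) = w * (1 - v + w / 2).
  by rewrite /w; field.
rewrite wE; rewrite -/w in IH0 IH1 IH2.
have step1 : w * (1 - v + w / 2) <= w * (1 - w / 2).
  by rewrite ler_wpM2l//; lra.
split; last by rewrite (le_trans step1)// (le_trans _ IH2)// ler_piMr//; lra.
apply/andP; split; first by rewrite mulr_ge0//; lra.
rewrite (le_trans step1)//.
clearbody w; clear wE step1 p; case: n IH1 => [|n] IH1.
  rewrite divff//; apply: (@le_trans _ _ (1 * 1)); last by rewrite mul1r.
  by apply: ler_pM => //; lra.
pose b : R := 2 / n.+2%:R.
have n0 : 0 < n.+2%:R :> R by [].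
have b1 : b <= 1 by rewrite ler_pdivrMr// mul1r ler_nat.
rewrite -/b in IH1.
apply: (@le_trans _ _ (b * (1 - b / 2))).
  rewrite -subr_ge0.
  have -> : b * (1 - b / 2) - w * (1 - w / 2) = (b - w) * (1 - (b + w) / 2).
    by field.
  by rewrite mulr_ge0// ?subr_ge0//; lra.
rewrite /b -[n.+3%:R]natr1; move: n0; set c := n.+2%:R => n0.
have -> : 2 / c * (1 - 2 / c / 2) = 2 * ((c - 1) / c ^+ 2).
  by field; rewrite gt_eqF.
rewrite ler_wpM2l// ler_pdivrMr ?exprn_gt0// mulrC ler_pdivlMr ?addr_gt0//.
by rewrite expr2; lra.
Qed.

Lemma A_abs_poly n f : A f -> A (fun x => abs_poly n (f x)).
Proof.
move=> Af; elim: n => [|n IH] /=; first exact: A_cst.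
apply: A_add => //.
apply: (@A_mul (fun x => f x ^+ 2 - abs_poly n (f x) ^+ 2) (fun=> 2^-1)) => //.
have Asqr g : A g -> A (fun x => g x ^+ 2).
  by move=> Ag; under eq_fun do rewrite expr2; exact: A_mul.
apply: A_add; first exact: Asqr.
under eq_fun do rewrite -mulN1r.
by apply: A_mul => //; exact: Asqr.
Qed.

Lemma cont_bounded (f : T -> R) : continuous f ->
  exists2 M : R, 0 < M & forall x, `|f x| <= M.
Proof.
move=> fc; have : compact (f @` [set: T]).
  by apply: continuous_compact => //; exact: continuous_subspaceT.
move=> /compact_bounded[M [_ /(_ (M + 1))]].
rewrite ltrDl ltr01 => /(_ isT) bd; exists (Num.max 1 (M + 1)).
  by rewrite lt_max ltr01.
by move=> x; rewrite le_max bd ?orbT//; exists x.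
Qed.

Lemma approx_A f : A f -> approx f.
Proof. by move=> Af e e0; exists f => // x; rewrite subrr normr0 ltW. Qed.

Lemma approx_add f g : approx f -> approx g -> approx (fun x => f x + g x).
Proof.
move=> fa ga e e0; have e2 : 0 < e / 2 by rewrite divr_gt0.
have [f' Af' ff'] := fa _ e2; have [g' Ag' gg'] := ga _ e2.
exists (fun x => f' x + g' x); first exact: A_add.
move=> x; rewrite opprD addrACA (le_trans (ler_normD _ _))//.
by rewrite [leRHS]splitr lerD.
Qed.

Lemma approx_scale c f : approx f -> approx (fun x => c * f x).
Proof.
move=> fa e e0; have c1 : 0 < `|c| + 1 by rewrite ltr_wpDl.
have [f' Af' ff'] := fa _ (divr_gt0 e0 c1).
exists (fun x => c * f' x); first exact: (A_mul (A_cst c)).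
move=> x; rewrite -mulrBr normrM.
apply: (@le_trans _ _ ((`|c| + 1) * (e / (`|c| + 1)))).
  by rewrite ler_pM// lerDl.
by rewrite mulrC divfK// gt_eqF.
Qed.

Lemma approx_abs f : approx f -> approx (fun x => `|f x|).
Proof.
move=> fa e e0; have e2 : 0 < e / 2 by rewrite divr_gt0.
have [g Ag fg] := fa _ e2.
have [M M0 gM] := cont_bounded (A_cont Ag).
pose n := Num.truncn (4 * M / e).
exists (fun x => M * abs_poly n (M^-1 * g x)).
  by apply: (A_mul (A_cst M)); apply: A_abs_poly; exact: (A_mul (A_cst _)).
move=> x; have gM1 : `|M^-1 * g x| <= 1.
  by rewrite normrM gtr0_norm ?invr_gt0// mulrC ler_pdivrMr// mul1r.
have [/andP[h1 h2] _] := abs_poly_close n gM1.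
have gE : `|g x| = M * `|M^-1 * g x|.
  by rewrite normrM gtr0_norm ?invr_gt0// mulVKf// gt_eqF.
rewrite -(subrK `|g x| `|f x|) -addrA (le_trans (ler_normD _ _))//.
rewrite [leRHS]splitr lerD//; first by rewrite (le_trans (ler_dist_dist _ _)).
rewrite gE -mulrBr normrM gtr0_norm// (ger0_norm h1).
rewrite (@le_trans _ _ (M * (2 / n.+1%:R)))//; first by rewrite ler_wpM2l// ltW.
have := truncnS_gt (4 * M / e); rewrite -/n ltr_pdivrMr// => hn.
by rewrite mulrA ler_pdivrMr//; lra.
Qed.

Lemma approx_max f g : approx f -> approx g ->
  approx (fun x => Num.max (f x) (g x)).
Proof.
move=> fa ga; under eq_fun do rewrite maxr_absE mulrC -[_ - g _]/(_ + (- _)).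
apply: approx_scale; apply: approx_add; first exact: approx_add.
apply: approx_abs; apply: approx_add => //.
by under eq_fun do rewrite -mulN1r; exact: approx_scale.
Qed.

Lemma approx_min f g : approx f -> approx g ->
  approx (fun x => Num.min (f x) (g x)).
Proof.
move=> fa ga; under eq_fun do rewrite minr_absE mulrC.
apply: approx_scale; apply: approx_add; first exact: approx_add.
under eq_fun do rewrite -mulN1r; apply: approx_scale.
apply: approx_abs; apply: approx_add => //.
by under eq_fun do rewrite -mulN1r; exact: approx_scale.
Qed.

Section uniform_approximation.
Variables (f : T -> R) (e : R).
Hypothesis f_cont : continuous f.
Hypothesis e0 : 0 < e.

Lemma interpolate x y : exists2 g, A g & g x = f x /\ g y = f y.
Proof.
have [<-|xy] := pselect (x = y); first by exists (fun=> f x).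
have [h Ah hxy] := A_sep xy.
exists (fun z => f x + (f y - f x) * ((h z + - h x) * (h y - h x)^-1)).
  apply: A_add => //; apply: (A_mul (A_cst _)).
  by apply: (@A_mul (fun z => h z + - h x) (fun=> _)) => //; exact: A_add.
have hyx : h y - h x != 0 by rewrite subr_eq0; apply/eqP => /esym.
by split; [rewrite subrr mul0r mulr0 addr0|rewrite divff// mulr1 addrC subrK].
Qed.

(** The minimum over a finite cover of interpolants between [x] and the centres
    of the cover. *)
Lemma approx_above x : exists2 g, approx g /\ continuous g &
  g x = f x /\ forall z, g z < f z + e.
Proof.
have /choice[a aP] : forall y, exists g, A g /\ (g x = f x /\ g y = f y).
  by move=> y; have [g Ag gxy] := interpolate x y; exists g.
pose U y := [set z | a y z < f z + e].
have openU y : setT y -> open (U y).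
  move=> _; have -> : U y = (fun z => f z + e - a y z) @^-1` [set r | 0 < r].
    by apply/seteqP; split => z /=; rewrite /U /= subr_gt0.
  apply: open_comp; last exact: open_gt.
  move=> z _; apply: cvgB; first by apply: cvgD; [exact: f_cont|exact: cvg_cst].
  by have [Aa _] := aP y; exact: A_cont.
have cov : [set: T] `<=` cover [set: T] U.
  by move=> z _; exists z => //; rewrite /U /=; have [_ [_ ->]] := aP z; rewrite ltrDl.
have := Tcompact; rewrite (compact_cover_pointed p0) => /(_ _ _ _ openU cov)[D _ Dcov].
have [g ga gP] : exists2 g, approx g /\ continuous g &
    g x = f x /\ forall y, y \in finmap.enum_fset D -> forall z, U y z -> g z < f z + e.
  elim: (finmap.enum_fset D) => [|y r [g [ga gc] [gx gr]]].
    exists (a x); last by split => //; have [_ [->]] := aP x.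
    by have [Ax _] := aP x; split; [exact: approx_A|exact: A_cont].
  have [Ay [ayx _]] := aP y.
  exists (fun z => Num.min (a y z) (g z)).
    split; first by apply: approx_min => //; exact: approx_A.
    by move=> z; apply: continuous_min; [exact: A_cont|exact: gc].
  split; first by rewrite ayx gx minxx.
  move=> w; rewrite inE => /predU1P[->|wr] z Uz; rewrite gt_min.
    by rewrite [X in X || _]Uz.
  by rewrite (gr _ wr) ?orbT.
exists g => //; split; first by case: gP.
move=> z; have [y yD Uy] := Dcov z I.
by case: gP => _ /(_ y yD z Uy).
Qed.

(** The maximum over a finite cover of the functions of [approx_above]. *)
Lemma approx_within : exists2 g, approx g & forall z, `|f z - g z| <= e.
Proof.
have /choice[a aP] : forall x, exists g, (approx g /\ continuous g) /\
    (g x = f x /\ forall z, g z < f z + e).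
  by move=> x; have [g ga gx] := approx_above x; exists g.
pose U x := [set z | f z - e < a x z].
have openU x : setT x -> open (U x).
  move=> _; have -> : U x = (fun z => a x z - (f z - e)) @^-1` [set r | 0 < r].
    by apply/seteqP; split => z /=; rewrite /U /= subr_gt0.
  apply: open_comp; last exact: open_gt.
  move=> z _; apply: cvgB; first by have [[_ ac] _] := aP x; exact: ac.
  by apply: cvgB; [exact: f_cont|exact: cvg_cst].
have cov : [set: T] `<=` cover [set: T] U.
  move=> z _; exists z => //; rewrite /U /=; have [_ [-> _]] := aP z.
  by rewrite ltrBlDr ltrDl.
have := Tcompact; rewrite (compact_cover_pointed p0) => /(_ _ _ _ openU cov)[D _ Dcov].
have [g ga [gf gP]] : exists2 g, approx g & (forall z, g z < f z + e) /\
    forall x, x \in finmap.enum_fset D -> forall z, U x z -> f z - e < g z.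
  elim: (finmap.enum_fset D) => [|x r [g ga [gf gr]]].
    by exists (a p0); have [[]] := aP p0 => // ? ? [].
  have [[ax _] [_ axf]] := aP x.
  exists (fun z => Num.max (a x z) (g z)); first exact: approx_max.
  split; first by move=> z; rewrite gt_max axf gf.
  move=> w; rewrite inE => /predU1P[->|wr] z Uz; rewrite lt_max.
    by rewrite [X in X || _]Uz.
  by rewrite (gr _ wr) ?orbT.
exists g => // z; have [x xD Ux] := Dcov z I.
have := gP x xD z Ux; have := gf z => h1 h2.
by rewrite ler_norml; apply/andP; split; lra.
Qed.

End uniform_approximation.

Theorem Stone_Weierstrass f : continuous f -> approx f.
Proof.
move=> fc e e0; have e2 : 0 < e / 2 by rewrite divr_gt0.
have [g ga fg] := approx_within fc e2; have [h Ah gh] := ga _ e2.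
exists h => // x; rewrite -(subrK (g x) (f x)) -addrA.
by rewrite (le_trans (ler_normD _ _))// [leRHS]splitr lerD.
Qed.

End Stone_Weierstrass.

(** * The space of sequences in the unit disc *)

Section complex_ReIm.
Context {R : realType}.

Lemma Re_conj (z : R[i]) : complex.Re z^* = complex.Re z.
Proof. by case: z. Qed.

Lemma Im_conj (z : R[i]) : complex.Im z^* = - complex.Im z.
Proof. by case: z. Qed.

Lemma ReM (z w : R[i]) : complex.Re (z * w) =
  complex.Re z * complex.Re w - complex.Im z * complex.Im w.
Proof. by case: z w => [a b] [c d]. Qed.

Lemma ImM (z w : R[i]) : complex.Im (z * w) =
  complex.Re z * complex.Im w + complex.Im z * complex.Re w.
Proof. by case: z w => [a b] [c d]. Qed.

Lemma ReD (z w : R[i]) : complex.Re (z + w) = complex.Re z + complex.Re w.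
Proof. by case: z w => [a b] [c d]. Qed.

Lemma ImD (z w : R[i]) : complex.Im (z + w) = complex.Im z + complex.Im w.
Proof. by case: z w => [a b] [c d]. Qed.

Lemma ReB (z w : R[i]) : complex.Re (z - w) = complex.Re z - complex.Re w.
Proof. by case: z w => [a b] [c d]. Qed.

Lemma ImB (z w : R[i]) : complex.Im (z - w) = complex.Im z - complex.Im w.
Proof. by case: z w => [a b] [c d]. Qed.

End complex_ReIm.

Section complex_continuity.
Context {R : realType} {T : topologicalType}.
Implicit Types (g h : T -> R[i]).

Lemma continuous_near (f : T -> R) :
  (forall (a : T) (e : R), 0 < e -> \forall b \near a, `|f a - f b| < e) ->
  continuous f.
Proof. by move=> h a; apply/cvgrPdist_lt => e; exact: h. Qed.

Lemma continuous_cst (c : R) : continuous (fun _ : T => c).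
Proof. by move=> x; exact: cvg_cst. Qed.

Lemma continuous_trunc (c : R) (u : T -> R) : continuous u ->
  continuous (fun x => Num.min 1 (c * u x)).
Proof.
move=> cu x; apply: (continuous_min (f := fun=> 1) (g := fun x => c * u x)).
  exact: cvg_cst.
by apply: cvgM; [exact: cvg_cst|exact: cu].
Qed.

Lemma continuous_maxr (u v : T -> R) : continuous u -> continuous v ->
  continuous (fun x => Num.max (u x) (v x)).
Proof. by move=> cu cv x; apply: continuous_max; [exact: cu|exact: cv]. Qed.

Definition ccontinuous (g : T -> R[i]) : Prop :=
  continuous (fun x => complex.Re (g x)) /\ continuous (fun x => complex.Im (g x)).

Lemma ccontinuous_cst (c : R[i]) : ccontinuous (fun=> c).
Proof. by split=> x; exact: cvg_cst. Qed.

Lemma ccontinuous_conj g : ccontinuous g -> ccontinuous (fun x => (g x)^*).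
Proof.
move=> [gr gi]; split=> x.
  by under eq_fun do rewrite Re_conj; exact: gr.
by under eq_fun do rewrite Im_conj; apply: cvgN; exact: gi.
Qed.

Lemma ccontinuousD g h : ccontinuous g -> ccontinuous h ->
  ccontinuous (fun x => g x + h x).
Proof.
move=> [gr gi] [hr hi]; split=> x.
  by under eq_fun do rewrite ReD; apply: cvgD; [exact: gr|exact: hr].
by under eq_fun do rewrite ImD; apply: cvgD; [exact: gi|exact: hi].
Qed.

Lemma ccontinuousM g h : ccontinuous g -> ccontinuous h ->
  ccontinuous (fun x => g x * h x).
Proof.
move=> [gr gi] [hr hi]; split=> x.
  under eq_fun do rewrite ReM.
  by apply: cvgB; apply: cvgM; [exact: gr|exact: hr|exact: gi|exact: hi].
under eq_fun do rewrite ImM.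
by apply: cvgD; apply: cvgM; [exact: gr|exact: hi|exact: gi|exact: hr].
Qed.

End complex_continuity.

Section sequence_space.
Context {R : realType}.
Implicit Types (x y : Xtop R) (k : int) (n : nat) (e : R).

(** The subtype carries the initial topology, so that its filters cluster as
    their images in [A]. *)
Lemma compact_set_type (T : topologicalType) (A : set T) :
  compact A -> compact [set: A].
Proof.
move=> cA F FF _.
have FA : (set_val @ F) A by apply: nearW => z; exact: set_valP.
have [p [Ap clp]] := cA (set_val @ F) _ FA.
exists (exist _ p (mem_set Ap)); split=> // U V FU [W [[B oB BW] Wp WV]].
have FU' : (set_val @ F) [set q | exists2 z : set_type A, U z & set_val z = q].
  by rewrite /fmap/=; apply: (@filterS _ F _ U) => // z Uz; exists z.
have Bp : nbhs p B.
  by apply: open_nbhs_nbhs; split=> //; move: Wp; rewrite -BW.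
have [q [[z Uz zq] Bq]] := clp _ _ FU' Bp.
by exists z; split=> //; apply: WV; rewrite -BW /= zq.
Qed.

Lemma normC_lt (z : R[i]) e : (`|z| < e%:C) = (normc z < e).
Proof. by rewrite normE ltcR. Qed.

(** The topology of [R[i]^o] has complex radii; only their real parts matter. *)
Lemma cvg_complexP {T : Type} (F : set_system T) {FF : Filter F}
    (g : T -> R[i]) (z : R[i]) :
  (forall e, 0 < e -> \near F, normc (z - g F) < e) <->
  (g : T -> R[i]^o) @ F --> (z : R[i]^o).
Proof.
split=> [h|].
  apply/(@cvgrPdist_lt _ R[i]^o) => e e0.
  have eE : e = (complex.Re e)%:C.
    by rewrite RRe_real// ger0_real// ltW.
  have : 0 < complex.Re e by move: e0; rewrite eE ltcR.
  by move=> /h; apply: filterS => t; rewrite eE normC_lt.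
move=> /(@cvgrPdist_lt _ R[i]^o) h e e0; have e0' : 0 < e%:C by rewrite ltcR.
by have := h _ e0'; apply: filterS => t; rewrite normC_lt.
Qed.

(** The image of a closed subset of the square [[-1, 1] ^ 2]. *)
Lemma compact_disc : compact (unit_disc R).
Proof.
pose K := [set p : R * R | p.1 ^+ 2 + p.2 ^+ 2 <= 1].
have cK : compact K.
  refine (@subclosed_compact _ K (`[-1, 1] `*` `[-1, 1]) _ _ _).
  - have -> : K = (fun p : R * R => p.1 ^+ 2 + p.2 ^+ 2) @^-1` [set r | r <= 1] by [].
    apply: preimage_closed; last exact: closed_le.
    move=> p _; apply: cvgD; rewrite expr2; under eq_fun do rewrite expr2.
      by apply: cvgM; exact: cvg_fst.
    by apply: cvgM; exact: cvg_snd.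
  - by apply: compact_setX; exact: segment_compact.
  - move=> [a b]; rewrite /K /= => ab.
    have a1 : a ^+ 2 <= 1 by rewrite (le_trans _ ab)// lerDl sqr_ge0.
    have b1 : b ^+ 2 <= 1 by rewrite (le_trans _ ab)// lerDr sqr_ge0.
    have nle1 (r : R) : r ^+ 2 <= 1 -> -1 <= r <= 1.
      by rewrite -ler_norml -(@expr_le1 _ 2 `|r|)// real_normK// num_real.
    by split; rewrite /= in_itv/= nle1.
have -> : unit_disc R = (fun p : R * R => (p.1 +i* p.2 : R[i]^o)) @` K.
  apply/seteqP; split=> [[a b]|_ [[a b] ab <-]].
    rewrite /unit_disc /= normE -[1]/(1%:C) lecR => ab; exists (a, b) => //.
    rewrite /K /=; move: ab; rewrite /= -(@ler_sqr R) ?nnegrE ?sqrtr_ge0//.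
    by rewrite sqr_sqrtr ?addr_ge0 ?sqr_ge0// expr1n.
  rewrite /unit_disc /= normE -[1]/(1%:C) lecR /= -(@ler_sqr R) ?nnegrE ?sqrtr_ge0//.
  by rewrite sqr_sqrtr ?addr_ge0 ?sqr_ge0// expr1n.
apply: continuous_compact => //; apply: continuous_subspaceT => p.
apply/cvg_complexP => e e0; have e2 : 0 < e / 2 by rewrite divr_gt0.
have c1 : q.1 @[q --> p] --> p.1 by exact: cvg_fst.
have c2 : q.2 @[q --> p] --> p.2 by exact: cvg_snd.
move/cvgrPdist_lt : c1 => /(_ _ e2) h1; move/cvgrPdist_lt : c2 => /(_ _ e2) h2.
near=> q; rewrite (le_lt_trans (normc_le_ReIm _))//= [ltRHS]splitr ltrD//.
  by near: q; exact: h1.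
by near: q; exact: h2.
Unshelve. all: by end_near. Qed.

Lemma compact_Xtop : compact [set: Xtop R].
Proof.
have := @tychonoff int (fun _ => unit_disc R) (fun _ => setT)
  (fun _ => compact_set_type compact_disc).
by congr compact; apply/seteqP; split.
Qed.

Lemma coord_near x k e : 0 < e ->
  \forall y \near x, normc (coord x k - coord y k) < e.
Proof.
move=> e0; have c : (fun y : Xtop R => set_val (y k) : R[i]^o) y @[y --> x]
    --> (set_val (x k) : R[i]^o).
  apply: (@continuous_comp _ _ _ (fun y : Xtop R => y k) set_val).
    exact: (@proj_continuous int (fun _ => unit_disc R) k).
  exact: initial_continuous.
by move/cvg_complexP : c; apply.
Qed.

Lemma ccontinuous_coord k : ccontinuous (fun x : Xtop R => coord x k).
Proof.
split; apply: continuous_near => x e e0; have h := coord_near x k e0.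
  by apply: filterS h => y; apply: le_lt_trans; rewrite -ReB normc_Re.
by apply: filterS h => y; apply: le_lt_trans; rewrite -ImB normc_Im.
Qed.

Lemma ccontinuous_mono l : ccontinuous (fun x : Xtop R => mono l (coord x)).
Proof.
elim: l => [|[k b] l IH].
  have -> : (fun x : Xtop R => mono [::] (coord x)) = fun=> 1.
    by apply/funext => x; rewrite /mono big_nil.
  exact: ccontinuous_cst.
have -> : (fun x : Xtop R => mono ((k, b) :: l) (coord x)) =
    (fun x => (if b then (coord x k)^* else coord x k) * mono l (coord x)).
  by apply/funext => x; rewrite /mono big_cons.
apply: ccontinuousM => //; case: b; last exact: ccontinuous_coord.
by apply: ccontinuous_conj; exact: ccontinuous_coord.
Qed.

End sequence_space.

(** * Integrals of bounded functions *)

Section bounded_integrals.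
Context {d : measure_display} {T : measurableType d} {R : realType}.
Implicit Types (u v : T -> R) (P : probability T R).

(** On a probability space such functions are integrable, and they are closed
    under products. *)
Definition bmeasurable u : Prop :=
  measurable_fun [set: T] u /\ exists M : R, forall x, `|u x| <= M.

Lemma bmeasurable_cst (c : R) : bmeasurable (fun=> c).
Proof. by split; [exact: measurable_cst|exists `|c|]. Qed.

Lemma bmeasurableD u v : bmeasurable u -> bmeasurable v ->
  bmeasurable (fun x => u x + v x).
Proof.
move=> [mu [M uM]] [mv [L vL]]; split; first exact: measurable_funD.
by exists (M + L) => x; rewrite (le_trans (ler_normD _ _))// lerD.
Qed.

Lemma bmeasurableM u v : bmeasurable u -> bmeasurable v ->
  bmeasurable (fun x => u x * v x).
Proof.
move=> [mu [M uM]] [mv [L vL]]; split; first exact: measurable_funM.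
by exists (M * L) => x; rewrite normrM ler_pM.
Qed.

Lemma bmeasurableB u v : bmeasurable u -> bmeasurable v ->
  bmeasurable (fun x => u x - v x).
Proof.
move=> bu bv; have := bmeasurableD bu (bmeasurableM (bmeasurable_cst (-1)) bv).
by congr bmeasurable; apply/funext => x; rewrite mulN1r.
Qed.

Lemma bmeasurable_sum (I : Type) (r : seq I) (F : I -> T -> R) :
  (forall i, bmeasurable (F i)) -> bmeasurable (fun x => \sum_(i <- r) F i x).
Proof.
move=> bF; elim: r => [|i r IH].
  have -> : (fun x => \sum_(i <- [::]) F i x) = fun=> 0.
    by apply/funext => x; rewrite big_nil.
  exact: bmeasurable_cst.
have -> : (fun x => \sum_(j <- i :: r) F j x) =
    (fun x => F i x + \sum_(j <- r) F j x).
  by apply/funext => x; rewrite big_cons.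
exact: bmeasurableD.
Qed.

Lemma bmeasurable_indic (A : set T) : measurable A ->
  bmeasurable (\1_A : T -> R).
Proof.
move=> mA; split; first exact: measurable_indic.
by exists 1 => x; rewrite indicE normr_nat lern1 leq_b1.
Qed.

Variable P : probability T R.

Lemma bmeasurable_integrable u : bmeasurable u ->
  P.-integrable [set: T] (EFin \o u).
Proof.
move=> [mu [M uM]]; apply: measurable_bounded_integrable => //.
  by rewrite -ge0_fin_numE// fin_num_measure.
by exists M; split; rewrite ?num_real// => y My x _ /=; exact: le_trans (uM x) (ltW My).
Qed.

Lemma expect_EFin u : bmeasurable u ->
  (\int[P]_x (u x)%:E = ((\int[P]_x u x)%R)%:E)%E.
Proof.
move=> bu; rewrite /Rintegral fineK//.
exact: (integrable_fin_num measurableT (bmeasurable_integrable bu)).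
Qed.

Lemma expect_cst (c : R) : (\int[P]_x c)%R = c.
Proof.
rewrite Rintegral_cst//; transitivity (c * fine (1%E : \bar R)).
  by congr (_ * fine _); exact: probability_setT.
by rewrite /= mulr1.
Qed.

Lemma expectD u v : bmeasurable u -> bmeasurable v ->
  (\int[P]_x (u x + v x))%R = (\int[P]_x u x)%R + (\int[P]_x v x)%R.
Proof. by move=> bu bv; apply: RintegralD => //; exact: bmeasurable_integrable. Qed.

Lemma expectB u v : bmeasurable u -> bmeasurable v ->
  (\int[P]_x (u x - v x))%R = (\int[P]_x u x)%R - (\int[P]_x v x)%R.
Proof. by move=> bu bv; apply: RintegralB => //; exact: bmeasurable_integrable. Qed.

Lemma expectZ (c : R) u : bmeasurable u ->
  (\int[P]_x (c * u x))%R = c * (\int[P]_x u x)%R.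
Proof. by move=> bu; apply: RintegralZl => //; exact: bmeasurable_integrable. Qed.

Lemma expect_sum (I : Type) (r : seq I) (F : I -> T -> R) :
  (forall i, bmeasurable (F i)) ->
  (\int[P]_x (\sum_(i <- r) F i x))%R = \sum_(i <- r) (\int[P]_x F i x)%R.
Proof.
move=> bF; elim: r => [|i r IH].
  rewrite big_nil -[RHS](expect_cst 0); apply: eq_Rintegral => x _.
  by rewrite big_nil.
rewrite big_cons -IH -expectD//; last exact: bmeasurable_sum.
by apply: eq_Rintegral => x _; rewrite big_cons.
Qed.

Lemma le_expect u v : bmeasurable u -> bmeasurable v ->
  (forall x, u x <= v x) -> (\int[P]_x u x)%R <= (\int[P]_x v x)%R.
Proof.
by move=> bu bv uv; apply: le_Rintegral => //; exact: bmeasurable_integrable.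
Qed.

Lemma expect_close u v (e : R) : bmeasurable u -> bmeasurable v ->
  (forall x, `|u x - v x| <= e) ->
  `|(\int[P]_x u x)%R - (\int[P]_x v x)%R| <= e.
Proof.
move=> bu bv uv; rewrite -expectB// ler_norml; apply/andP; split.
  rewrite -[leLHS]expect_cst; apply: le_expect; [exact: bmeasurable_cst|exact: bmeasurableB|].
  by move=> x; have := uv x; rewrite ler_norml => /andP[].
rewrite -[leRHS]expect_cst; apply: le_expect; [exact: bmeasurableB|exact: bmeasurable_cst|].
by move=> x; have := uv x; rewrite ler_norml => /andP[].
Qed.

Lemma expect_indic (A : set T) : measurable A ->
  (\int[P]_x (\1_A x : R))%R = fine (P A).
Proof. by move=> mA; rewrite /Rintegral integral_indic// setIT. Qed.

Lemma expect_lim (u_ : nat -> T -> R) u K :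
  (forall n, measurable_fun [set: T] (u_ n)) ->
  (forall n x, `|u_ n x| <= K) -> measurable_fun [set: T] u ->
  (forall x, u_ n x @[n --> \oo] --> u x) ->
  (\int[P]_x u_ n x)%R @[n --> \oo] --> (\int[P]_x u x)%R.
Proof.
move=> mu_ u1 mu ulim.
have [|||||intu _] := @dominated_convergence _ _ _ P setT measurableT
    (fun n => EFin \o u_ n) (EFin \o u) (EFin \o cst K).
- by move=> n; exact/measurable_EFinP.
- exact/measurable_EFinP.
- by apply: aeW => x _; apply: cvg_EFin; [exact: nearW|exact: ulim].
- by apply: bmeasurable_integrable; exact: bmeasurable_cst.
- by apply: aeW => x n _ /=; rewrite lee_fin.
move=> h; apply: fine_cvg; rewrite fineK//.
exact: (integrable_fin_num measurableT intu).
Qed.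

End bounded_integrals.

Lemma expect_push d d' (X : measurableType d) (Y : measurableType d')
    (R : realType) (P : probability X R) (phi : {mfun X >-> Y}) (u : Y -> R) :
  bmeasurable u ->
  (\int[distribution P phi]_y u y)%R = (\int[P]_x u (phi x))%R.
Proof.
move=> bu; have [mu [M uM]] := bu.
rewrite /Rintegral /distribution integral_pushforward//.
- exact/measurable_EFinP.
- have : bmeasurable (u \o phi).
    by split; [exact: measurableT_comp|exists M => x; exact: uM].
  exact: bmeasurable_integrable.
Qed.

(** * Continuous functions determine measures on the sequence space *)

Section distances.
Context {R : realType}.
Implicit Types (x y : Xtop R) (n : nat).

(** Pseudometrics that generate the product topology and increase with [n]; the
    distances to a closed set that they define are continuous functions. *)
Definition dist n x y : R := \sum_(i < n)
  (normc (coord x i%:Z - coord y i%:Z) + normc (coord x (- i%:Z) - coord y (- i%:Z))).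

Lemma dist_ge0 n x y : 0 <= dist n x y.
Proof. by apply: sumr_ge0 => i _; rewrite addr_ge0 ?normc_ge0. Qed.

Lemma dist_xx n x : dist n x x = 0.
Proof. by apply: big1 => i _; rewrite !subrr normc0 addr0. Qed.

Lemma dist_sym n x y : dist n x y = dist n y x.
Proof.
by apply: eq_bigr => i _; rewrite normc_distC [X in _ + X]normc_distC.
Qed.

Lemma dist_tri n x y z : dist n x z <= dist n x y + dist n y z.
Proof.
rewrite /dist -big_split; apply: ler_sum => i _ /=.
by rewrite addrACA lerD// ler_dist_normcD.
Qed.

Lemma dist_mono n m x y : (n <= m)%N -> dist n x y <= dist m x y.
Proof.
move=> nm; rewrite /dist -(big_mkord xpredT (fun i : nat =>
  normc (coord x i%:Z - coord y i%:Z) + normc (coord x (- i%:Z) - coord y (- i%:Z)))).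
rewrite -(big_mkord xpredT (fun i : nat =>
  normc (coord x i%:Z - coord y i%:Z) + normc (coord x (- i%:Z) - coord y (- i%:Z)))).
rewrite [leRHS](@big_cat_nat _ _ _ n)//= lerDl sumr_ge0// => i _.
by rewrite addr_ge0 ?normc_ge0.
Qed.

Lemma dist_coord n x y (k : int) : (`|k| < n)%N ->
  normc (coord x k - coord y k) <= dist n x y.
Proof.
move=> kn; rewrite /dist (bigD1 (Ordinal kn))//=.
rewrite (@le_trans _ _ (normc (coord x `|k|%N%:Z - coord y `|k|%N%:Z) +
    normc (coord x (- `|k|%N%:Z) - coord y (- `|k|%N%:Z))))//; last first.
  by rewrite lerDl sumr_ge0// => i _; rewrite addr_ge0 ?normc_ge0.
have [->|->] : k = `|k|%N%:Z \/ k = - `|k|%N%:Z by lia.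
  by rewrite lerDl normc_ge0.
by rewrite abszN lerDr normc_ge0.
Qed.

Lemma dist_near n x (e : R) : 0 < e -> \forall y \near x, dist n x y < e.
Proof.
elim: n e => [|n IH] e e0; first by near=> y; rewrite /dist big_ord0.
have e2 : 0 < e / 2 by rewrite divr_gt0.
have e4 : 0 < e / 4 by rewrite divr_gt0.
have h1 := IH _ e2.
have h2 := coord_near x n%:Z e4; have h3 := coord_near x (- n%:Z) e4.
apply: filterS3 h1 h2 h3 => y h1 h2 h3.
rewrite /dist big_ord_recr/= -/(dist n x y).
lra.
Unshelve. all: by end_near. Qed.

Lemma nbhs_dist x (U : set (Xtop R)) : nbhs x U ->
  exists n, forall y, dist n x y < n.+1%:R^-1 -> U y.
Proof.
pose F := filter_from [set: nat]
  (fun n => [set y : Xtop R | dist n x y < n.+1%:R^-1]).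
have FF : Filter F.
  apply: filter_fromT_filter; first by exists 0%N.
  move=> i j; exists (maxn i j) => y /= h.
  have ninv a b : (a <= b)%N -> b.+1%:R^-1 <= a.+1%:R^-1 :> R.
    by move=> ab; rewrite lef_pV2 ?posrE// ler_nat.
  split=> /=.
    rewrite (le_lt_trans (dist_mono _ _ (leq_maxl i j)))// (lt_le_trans h)//.
    exact/ninv/leq_maxl.
  rewrite (le_lt_trans (dist_mono _ _ (leq_maxr i j)))// (lt_le_trans h)//.
  exact/ninv/leq_maxr.
suff Fx : F --> x by move=> /Fx[n _ nU]; exists n => y; exact: nU.
apply/cvg_sup => k V [W [[B [C oC CB] BW] Wx WV]].
have Cx : C (set_val (x k)) by move: Wx; rewrite -BW -CB.
have : nbhs (set_val (x k) : R[i]^o) C by apply: open_nbhs_nbhs.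
move=> /nbhs_ballP[e e0 eC].
have eE : e = (complex.Re e)%:C by rewrite RRe_real// ger0_real// ltW.
have re0 : 0 < complex.Re e by move: e0; rewrite /= eE ltcR.
pose n := maxn (Num.truncn (complex.Re e)^-1) `|k|.+1.
exists n => // y /= yn; apply: WV; rewrite -BW -CB /=; apply: eC.
rewrite /ball /= /ball_ eE normC_lt.
rewrite (le_lt_trans (@dist_coord n x y k _))//; first by rewrite leq_maxr.
rewrite (lt_le_trans yn)// -[leRHS]invrK lef_pV2 ?posrE ?invr_gt0//.
rewrite ltW// (lt_le_trans (truncnS_gt _))// ler_nat ltnS.
exact: leq_maxl.
Qed.

(** [h n] is the distance to the complement of [G] in the [n]-th pseudometric,
    scaled by [n + 1] and truncated at 1. *)
Lemma open_exhaust (G : set (Xtop R)) : open G ->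
  exists h : nat -> Xtop R -> R, [/\ forall n, continuous (h n),
    forall n x, 0 <= h n x <= 1, forall n x, ~ G x -> h n x = 0 &
    forall x, G x -> exists n, h n x = 1].
Proof.
move=> oG; have [C0|/set0P[c Cc]] := eqVneq (~` G) set0.
  exists (fun _ _ => 1); split=> //.
  - by move=> n; exact: continuous_cst.
  - by move=> n x; rewrite ler01 lexx.
  - by move=> n x nG; have : (~` G) x by []; rewrite C0.
  - by move=> x _; exists 0%N.
pose E n x := [set dist n x y | y in ~` G].
have E0 n x : E n x !=set0 by exists (dist n x c); exists c.
have El n x : has_lbound (E n x).
  by exists 0 => _ [y _ <-]; exact: dist_ge0.
pose g n x := inf (E n x).
have gle n x y : ~ G y -> g n x <= dist n x y.
  by move=> Gy; apply: ge_inf => //; exists y.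
have geg n x r : (forall y, ~ G y -> r <= dist n x y) -> r <= g n x.
  by move=> h; apply: lb_le_inf => // _ [y Gy <-]; exact: h.
have glip n x y : g n x <= dist n x y + g n y.
  rewrite -lerBlDl; apply: geg => z Gz; rewrite lerBlDl.
  by rewrite (le_trans (gle _ _ _ Gz))// dist_tri.
have gcont n : continuous (g n).
  apply: continuous_near => x e e0; have := dist_near n x e0.
  apply: filterS => y; apply: le_lt_trans.
  have h1 := glip n x y; have h2 := glip n y x; rewrite dist_sym in h2.
  by rewrite ler_norml; apply/andP; split; lra.
exists (fun n x => Num.min 1 (n.+1%:R * g n x)); split.
- by move=> n; apply: continuous_trunc; exact: gcont.
- move=> n x; rewrite ge_min lexx/= andbT le_min ler01/= mulr_ge0//.
  by apply: geg => y _; exact: dist_ge0.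
- move=> n x Gx; have : g n x <= 0 by rewrite -(dist_xx n x) gle.
  have : 0 <= g n x by apply: geg => y _; exact: dist_ge0.
  move=> h1 h2; have -> : g n x = 0 by apply/eqP; rewrite eq_le h1 h2.
  by rewrite mulr0 min_r.
- move=> x Gx; have : nbhs x G by apply: open_nbhs_nbhs.
  move=> /nbhs_dist[n nG]; exists n; apply: min_l.
  rewrite -ler_pdivrMl// mulr1; apply: geg => y Gy.
  by rewrite leNgt; apply/negP => /nG.
Qed.

Lemma continuous_measurableX (phi : Xtop R -> R) : continuous phi ->
  measurable_fun [set: Xspace R] (phi : Xspace R -> R).
Proof.
move=> /continuousP cphi.
apply: (measurability _ (RGenOInfty.measurableE R)) => _ [_ [r ->] <-].
rewrite setTI; apply: sub_sigma_algebra; apply: cphi.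
exact: interval_open.
Qed.

End distances.

Section determination.
Context {R : realType}.
Implicit Types (n : nat).

(** The running maxima of the functions of [open_exhaust]. *)
Lemma open_limit (G : set (Xtop R)) : open G ->
  exists H : nat -> Xtop R -> R, [/\ forall n, continuous (H n),
    forall n x, `|H n x| <= 1 &
    forall x, H n x @[n --> \oo] --> (\1_G x : R)].
Proof.
move=> /open_exhaust[h [hc h01 hG0 hG1]].
pose H := fix H n x : R := if n is k.+1 then Num.max (H k x) (h n x) else h 0%N x.
have HS n x : H n.+1 x = Num.max (H n x) (h n.+1 x) by [].
have H01 n x : 0 <= H n x <= 1.
  elim: n => [|n /andP[IH0 IH1]]; first exact: h01.
  have /andP[a b] := h01 n.+1 x.
  by rewrite HS le_max IH0 ge_max IH1 b.
have hH n x : h n x <= H n x.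
  by case: n => [|n]; [exact: lexx|rewrite HS le_max lexx orbT].
have Hmono n m x : (n <= m)%N -> H n x <= H m x.
  elim: m => [|m IH]; first by rewrite leqn0 => /eqP ->.
  rewrite leq_eqVlt => /predU1P[->//|]; rewrite ltnS => /IH nm.
  by rewrite (le_trans nm)// HS le_max lexx.
exists H; split.
- elim=> [|n IH]; first exact: hc.
  exact: (continuous_maxr IH (hc n.+1)).
- by move=> n x; have /andP[a b] := H01 n x; rewrite ger0_norm.
- move=> x; have [Gx|Gx] := pselect (G x).
    have [n0 hn0] := hG1 x Gx; rewrite indicE mem_set//.
    apply: cvg_near_cst; near=> n.
    have n0n : (n0 <= n)%N by near: n; exact: nbhs_infty_ge.
    apply/eqP; rewrite eq_le; have /andP[_ ->] := H01 n x.
    by rewrite /= -[leLHS]hn0 (le_trans (hH n0 x))// Hmono.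
  rewrite indicE memNset//; apply: cvg_near_cst; apply: nearW => n.
  elim: n => [|n IH]; first exact: hG0.
  by rewrite HS IH hG0// maxxx.
Unshelve. all: by end_near. Qed.

(** A functional which is additive and continuous for bounded pointwise limits
    is determined by its values on continuous functions: the sets whose
    indicators it annihilates form a Dynkin class that contains the open sets. *)
Lemma determined_by_continuous (Lam : (Xspace R -> R) -> R) :
  (forall u v : Xspace R -> R, bmeasurable u -> bmeasurable v ->
     Lam (fun x => u x - v x) = Lam u - Lam v) ->
  (forall (u_ : nat -> Xspace R -> R) (u : Xspace R -> R),
     (forall n, measurable_fun [set: Xspace R] (u_ n)) ->
     (forall n x, `|u_ n x| <= 1) -> measurable_fun [set: Xspace R] u ->
     (forall x, u_ n x @[n --> \oo] --> u x) ->
     Lam (u_ n) @[n --> \oo] --> Lam u) ->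
  (forall phi : Xtop R -> R, continuous phi -> Lam phi = 0) ->
  forall A : set (Xspace R), measurable A -> Lam (\1_A) = 0.
Proof.
move=> LamB Lamlim Lam0.
have Lam_lim0 (u_ : nat -> Xspace R -> R) (u : Xspace R -> R) :
    (forall n, measurable_fun [set: Xspace R] (u_ n)) ->
    (forall n x, `|u_ n x| <= 1) -> measurable_fun [set: Xspace R] u ->
    (forall x, u_ n x @[n --> \oo] --> u x) ->
    (forall n, Lam (u_ n) = 0) -> Lam u = 0.
  move=> mu_ u1 mu ul L0; have := Lamlim u_ u mu_ u1 mu ul.
  have -> : (fun n => Lam (u_ n)) = fun=> 0 by apply/funext.
  by move=> h; rewrite -(cvg_lim (@Rhausdorff R) h) lim_cst.
have Lcst (c : R) : Lam (fun=> c) = 0.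
  by apply: Lam0; exact: continuous_cst.
have LC (A : set (Xspace R)) : measurable A -> Lam \1_A = 0 -> Lam \1_(~` A) = 0.
  move=> mA LA; have -> : \1_(~` A) = (fun x : Xspace R => 1 - \1_A x :> R).
    apply/funext => x; rewrite !indicE in_setC.
    by case: (x \in A); rewrite /= ?subrr ?subr0.
  rewrite LamB ?Lcst ?LA ?subrr//; first exact: bmeasurable_cst.
  exact: bmeasurable_indic.
have LU (A B : set (Xspace R)) : measurable A -> measurable B ->
    A `&` B = set0 -> Lam \1_A = 0 -> Lam \1_B = 0 -> Lam \1_(A `|` B) = 0.
  move=> mA mB AB LA LB.
  have -> : \1_(A `|` B) = (fun x : Xspace R => \1_A x - (0 - \1_B x) :> R).
    apply/funext => x; rewrite !indicE in_setU sub0r opprK.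
    have : ~ (A x /\ B x) by move=> [a b]; have : (A `&` B) x by []; rewrite AB.
    have [|] := boolP (x \in A); have [|] := boolP (x \in B); rewrite ?inE => a b ab //=.
    - by exfalso; apply: ab.
    - by rewrite addr0.
    - by rewrite add0r.
    - by rewrite addr0.
  have bB := bmeasurable_indic (R := R) mB.
  have b0 := bmeasurable_cst (T := Xspace R) (0 : R).
  rewrite LamB; [|exact: bmeasurable_indic|exact: bmeasurableB].
  by rewrite LamB// Lcst LA LB !subr0.
(* Open sets are closed under intersection and generate the measurable sets. *)
have opens (G : set (Xspace R)) : (@open (Xtop R)) G -> Lam \1_G = 0.
  move=> oG; have [H [Hc H1 Hlim]] := open_limit oG.
  have mG : measurable G by exact: sub_sigma_algebra.
  apply: (Lam_lim0 H) => //.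
  - by move=> n; exact: continuous_measurableX.
  - by move=> n; exact: Lam0.
move=> A mA.
apply: (@dynkin_induction _ (Xspace R) (@open (Xtop R)) (fun A => Lam \1_A = 0)) => //.
- by move=> B C oB oC; exact: openI.
- by apply: opens; exact: openT.
- move=> F mF tF LF.
  pose U n := \big[setU/set0]_(k < n) F k.
  have mU n : measurable (U n) by apply: bigsetU_measurable.
  have LUn n : Lam \1_(U n) = 0.
    elim: n => [|n IH]; first by rewrite /U big_ord0; apply: opens; exact: open0.
    have UF0 : U n `&` F n = set0.
      apply/seteqP; split=> // x [+ Fx]; rewrite /U -bigcup_mkord => -[k /= kn Fkx].
      have kE : k = n by apply: tF => //; exists x.
      by rewrite kE ltnn in kn.
    have -> : U n.+1 = U n `|` F n by rewrite /U big_ord_recr.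
    exact: LU.
  have mUo : measurable_fun [set: Xspace R] (\1_(\bigcup_k F k) : _ -> R).
    by apply: measurable_indic; exact: bigcupT_measurable.
  apply: (Lam_lim0 (fun n => \1_(U n)) _ _ _ mUo) => //.
  - by move=> n x; rewrite indicE normr_nat lern1 leq_b1.
  - move=> x; have [[k _ Fkx]|nF] := pselect ((\bigcup_k F k) x).
      rewrite [X in _ --> X]indicE mem_set; last by exists k.
      apply: cvg_near_cst; near=> n.
      rewrite indicE mem_set// /U -bigcup_mkord; exists k => //=.
      by near: n; exact: nbhs_infty_gt.
    rewrite [X in _ --> X]indicE memNset//; apply: cvg_near_cst; near=> n.
    rewrite indicE memNset// /U -bigcup_mkord => -[k _ Fkx].
    by apply: nF; exists k.
Unshelve. all: by end_near. Qed.

Lemma probability_eq (mu nu : probability (Xspace R) R) :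
  (forall phi : Xtop R -> R, continuous phi ->
    (\int[mu]_x (phi x))%R = (\int[nu]_x (phi x))%R) ->
  forall A : set (Xspace R), measurable A -> mu A = nu A.
Proof.
move=> munu A mA.
have := @determined_by_continuous
  (fun u => (\int[mu]_x u x)%R - (\int[nu]_x u x)%R).
move=> /(_ _ _ _ A mA)/= h.
have {h} : (\int[mu]_x \1_A x)%R - (\int[nu]_x \1_A x)%R = 0 :> R.
  apply: h.
  - by move=> u v bu bv; rewrite !expectB//; ring.
  - by move=> u_ u mu_ u1 mmu ul; apply: cvgB; exact: expect_lim.
  - by move=> phi cphi; rewrite munu// subrr.
rewrite !expect_indic// => /eqP; rewrite subr_eq0 => /eqP e.
by rewrite -[LHS]fineK ?fin_num_measure// e fineK// fin_num_measure.
Qed.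

(** * Trigonometric polynomials *)

Definition trig (s : seq (R[i] * seq (int * bool))) (x : Xspace R) : R[i] :=
  \sum_(al <- s) al.1 * mono al.2 (coord x).

Definition conj_seq (l : seq (int * bool)) := [seq (kb.1, ~~ kb.2) | kb <- l].

Lemma mono_conj l (y : int -> R[i]) : mono (conj_seq l) y = (mono l y)^*.
Proof.
rewrite /mono big_map rmorph_prod; apply: eq_bigr => -[k b] _ /=.
by case: b; rewrite /= ?conjcK.
Qed.

Lemma mono_cat l1 l2 (y : int -> R[i]) : mono (l1 ++ l2) y = mono l1 y * mono l2 y.
Proof. by rewrite /mono big_cat. Qed.

Lemma trig_cat s1 s2 x : trig (s1 ++ s2) x = trig s1 x + trig s2 x.
Proof. by rewrite /trig big_cat. Qed.

Lemma trig_scale (c : R[i]) s x :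
  trig [seq (c * al.1, al.2) | al <- s] x = c * trig s x.
Proof.
by rewrite /trig big_map mulr_sumr; apply: eq_bigr => al _; rewrite mulrA.
Qed.

Lemma trig_conj s x :
  trig [seq ((al.1)^*, conj_seq al.2) | al <- s] x = (trig s x)^*.
Proof.
rewrite /trig big_map rmorph_sum; apply: eq_bigr => al _ /=.
by rewrite mono_conj rmorphM.
Qed.

Lemma trig_mul s1 s2 x :
  trig [seq (a.1 * b.1, a.2 ++ b.2) | a <- s1, b <- s2] x = trig s1 x * trig s2 x.
Proof.
rewrite /trig big_allpairs_dep/= mulr_suml; apply: eq_bigr => a _.
rewrite mulr_sumr; apply: eq_bigr => b _ /=.
by rewrite mono_cat; ring.
Qed.

Lemma ccontinuous_trig s : ccontinuous (fun x : Xtop R => trig s x).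
Proof.
elim: s => [|[a l] s IH].
  have -> : (fun x : Xtop R => trig [::] x) = fun=> 0.
    by apply/funext => x; rewrite /trig big_nil.
  exact: ccontinuous_cst.
have -> : (fun x : Xtop R => trig ((a, l) :: s) x) =
    (fun x => a * mono l (coord x) + trig s x).
  by apply/funext => x; rewrite /trig big_cons.
apply: ccontinuousD => //; apply: ccontinuousM; first exact: ccontinuous_cst.
exact: ccontinuous_mono.
Qed.

(** The real parts of trigonometric polynomials form an algebra that separates
    the points of a compact space. *)
Lemma trig_dense (phi : Xtop R -> R) (e : R) : continuous phi -> 0 < e ->
  exists s, forall x, `|phi x - complex.Re (trig s x)| <= e.
Proof.
move=> cphi e0.
pose A := [set g : Xtop R -> R | exists s, g = (fun x => complex.Re (trig s x))].
have [|||||g [s ->] gs] := @Stone_Weierstrass R (Xtop R) point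
    compact_Xtop A _ _ _ _ _ phi cphi e e0.
- move=> c; exists [:: (c%:C, [::])]; apply/funext => x.
  by rewrite /trig big_seq1 /mono big_nil mulr1.
- move=> _ _ [s1 ->] [s2 ->]; exists (s1 ++ s2); apply/funext => x.
  by rewrite trig_cat ReD.
- move=> _ _ [s1 ->] [s2 ->].
  (* [2 Re z Re w = Re (z w) + Re (z v)], [v] being the conjugate of [w]. *)
  exists ([seq ((2^-1)%:C * al.1, al.2) | al <-
    [seq (a.1 * b.1, a.2 ++ b.2) | a <- s1, b <- s2] ++
    [seq (a.1 * b.1, a.2 ++ b.2) | a <- s1,
       b <- [seq ((al.1)^*, conj_seq al.2) | al <- s2]]]).
  apply/funext => x; rewrite trig_scale trig_cat !trig_mul trig_conj.
  case: (trig s1 x) (trig s2 x) => [a b] [c f] /=; by field.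
- by move=> _ [s ->]; have [] := ccontinuous_trig s.
- move=> x y xy.
  have [k kxy] : exists k, coord x k <> coord y k.
    apply/existsNP => h; apply: xy; apply/funext => k; apply: val_inj.
    by have := h k; rewrite /coord.
  have [re|im] : complex.Re (coord x k) <> complex.Re (coord y k) \/
      complex.Im (coord x k) <> complex.Im (coord y k).
    case: (coord x k) (coord y k) kxy => [a b] [a' b'] /= kxy.
    by apply/not_andP => -[aa bb]; apply: kxy; rewrite aa bb.
  + exists (fun z => complex.Re (trig [:: (1, [:: (k, false)])] z)).
      by eexists.
    by rewrite /trig !big_seq1 /mono !big_seq1 !mul1r.
  + exists (fun z => complex.Re (trig [:: (0 -i* 1, [:: (k, false)])] z)).
      by eexists.
    rewrite /trig !big_seq1 /mono !big_seq1 /= => h; apply: im; move: h.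
    case: (coord x k) (coord y k) => [a b] [a' b'] /=.
    by rewrite !mul0r !mulN1r !opprK !add0r.
by exists s.
Qed.

End determination.

(** * Measurable maps into the sequence space *)

Section measurability_into_sequences.
Context {R : realType} {d : measure_display} {T : measurableType d}.
Implicit Types (g h : T -> R[i]).

Lemma cmeasurable_cst (c : R[i]) : cmeasurable (fun _ : T => c).
Proof. by split; exact: measurable_cst. Qed.

Lemma cmeasurable_conj g : cmeasurable g -> cmeasurable (fun x => (g x)^*).
Proof.
move=> [gr gi]; split.
  have -> : (fun x => complex.Re (g x)^*) = (fun x => complex.Re (g x)).
    by apply/funext => x; rewrite Re_conj.
  exact: gr.
have -> : (fun x => complex.Im (g x)^*) = (\- (fun x => complex.Im (g x))).
  by apply/funext => x; rewrite Im_conj.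
exact: measurable_funN.
Qed.

Lemma cmeasurableD g h : cmeasurable g -> cmeasurable h ->
  cmeasurable (fun x => g x + h x).
Proof.
move=> [gr gi] [hr hi]; split.
  have -> : (fun x => complex.Re (g x + h x)) =
      (fun x => complex.Re (g x)) \+ (fun x => complex.Re (h x)).
    by apply/funext => x; rewrite ReD.
  exact: measurable_funD.
have -> : (fun x => complex.Im (g x + h x)) =
    (fun x => complex.Im (g x)) \+ (fun x => complex.Im (h x)).
  by apply/funext => x; rewrite ImD.
exact: measurable_funD.
Qed.

Lemma cmeasurableM g h : cmeasurable g -> cmeasurable h ->
  cmeasurable (fun x => g x * h x).
Proof.
move=> [gr gi] [hr hi]; split.
  have -> : (fun x => complex.Re (g x * h x)) =
      (fun x => complex.Re (g x) * complex.Re (h x)) \-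
      (fun x => complex.Im (g x) * complex.Im (h x)).
    by apply/funext => x; rewrite ReM.
  by apply: measurable_funB; exact: measurable_funM.
have -> : (fun x => complex.Im (g x * h x)) =
    (fun x => complex.Re (g x) * complex.Im (h x)) \+
    (fun x => complex.Im (g x) * complex.Re (h x)).
  by apply/funext => x; rewrite ImM.
by apply: measurable_funD; exact: measurable_funM.
Qed.

Lemma cmeasurable_prod (I : Type) (r : seq I) (F : I -> T -> R[i]) :
  (forall i, cmeasurable (F i)) -> cmeasurable (fun x => \prod_(i <- r) F i x).
Proof.
move=> mF; elim: r => [|i r IH].
  have -> : (fun x => \prod_(i <- [::]) F i x) = fun=> 1.
    by apply/funext => x; rewrite big_nil.
  exact: cmeasurable_cst.
have -> : (fun x => \prod_(j <- i :: r) F j x) =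
    (fun x => F i x * \prod_(j <- r) F j x).
  by apply/funext => x; rewrite big_cons.
exact: cmeasurableM.
Qed.

Lemma cmeasurable_sum (I : Type) (r : seq I) (F : I -> T -> R[i]) :
  (forall i, cmeasurable (F i)) -> cmeasurable (fun x => \sum_(i <- r) F i x).
Proof.
move=> mF; elim: r => [|i r IH].
  have -> : (fun x => \sum_(i <- [::]) F i x) = fun=> 0.
    by apply/funext => x; rewrite big_nil.
  exact: cmeasurable_cst.
have -> : (fun x => \sum_(j <- i :: r) F j x) =
    (fun x => F i x + \sum_(j <- r) F j x).
  by apply/funext => x; rewrite big_cons.
exact: cmeasurableD.
Qed.

(** The indicator of an open set of sequences is a limit of continuous functions,
    and these are uniform limits of trigonometric polynomials, so that
    measurability into the sequence space can be tested on coordinates. *)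
Lemma measurable_into_Xspace (F : T -> Xspace R) :
  (forall k, cmeasurable (fun t => coord (F t) k)) ->
  measurable_fun [set: T] F.
Proof.
move=> mF.
have mmono l : cmeasurable (fun t => mono l (coord (F t))).
  by apply: cmeasurable_prod => -[k []] /=; [exact: cmeasurable_conj|exact: mF].
have mtrig s : cmeasurable (fun t => trig s (F t)).
  apply: cmeasurable_sum => -[a l] /=.
  exact: (cmeasurableM (cmeasurable_cst a) (mmono l)).
have mphi (phi : Xtop R -> R) : continuous phi ->
    measurable_fun [set: T] (fun t => phi (F t)).
  move=> cphi.
  have /choice[s sP] : forall n : nat, exists s, forall y,
      `|phi y - complex.Re (trig s y)| <= n.+1%:R^-1.
    by move=> n; apply: trig_dense.
  apply: (measurable_fun_cvg (h := fun n t => complex.Re (trig (s n) (F t)))).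
    by move=> n; have [] := mtrig (s n).
  move=> t _; apply/cvgrPdist_le => e e0; near=> n.
  rewrite (le_trans (sP n (F t)))// -[leRHS]invrK lef_pV2 ?posrE ?invr_gt0//.
  rewrite ltW// (lt_le_trans (truncnS_gt _))// ler_nat ltnS.
  by near: n; exact: nbhs_infty_ge.
apply: (@measurability _ _ _ (Xspace R) _ _ (@open (Xtop R))) => // _ [G oG <-].
rewrite setTI; have [H [Hc _ Hlim]] := open_limit oG.
apply/(measurable_indicP R).
apply: (measurable_fun_cvg (h := fun n t => H n (F t))).
  by move=> n; exact: mphi.
by move=> t _; exact: Hlim.
Unshelve. all: by end_near. Qed.

End measurability_into_sequences.

(** * Characters of the torus *)

Section circle_character.
Context {R : realType}.

Lemma circle_proj_surj (z : circle R) : exists a : R, z = circle_proj a.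
Proof. by exists (repr z); rewrite /circle_proj reprK. Qed.

Lemma circle_projD (a b : R) :
  circle_proj (a + b) = circle_proj a + circle_proj b :> circle R.
Proof. by rewrite /circle_proj; exact: (raddfD (\pi_(circle R))%qT). Qed.

Lemma circle_proj0 : circle_proj (0 : R) = 0 :> circle R.
Proof. exact: (raddf0 (\pi_(circle R))%qT). Qed.

Lemma circle_projN (a : R) : circle_proj (- a) = - circle_proj a :> circle R.
Proof. exact: (raddfN (\pi_(circle R))%qT). Qed.

Lemma circle_projMz (a : R) (m : int) :
  circle_proj (a * m%:~R) = circle_proj a *~ m :> circle R.
Proof. by rewrite mulrzr; exact: (raddfMz (\pi_(circle R))%qT). Qed.

Lemma circle_proj_sum (I : Type) (r : seq I) (F : I -> R) :
  circle_proj (\sum_(i <- r) F i) = \sum_(i <- r) circle_proj (F i) :> circle R.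
Proof.
by apply: (big_morph (circle_proj : R -> circle R) circle_projD circle_proj0).
Qed.

Lemma circle_proj_eq (a b : R) :
  circle_proj a = circle_proj b :> circle R <-> a - b \is a Num.int.
Proof.
rewrite -integersE Quotient.idealrBE; split=> [|/eqP//].
by move=> h; apply/eqP.
Qed.

Lemma expi_2pi_int (a : R) : a \is a Num.int -> expi (2 * pi * a) = 1.
Proof.
have N (n : nat) : expi (2 * pi * n%:R) = 1 :> R[i].
  rewrite mulrC expi_natmul.
  have -> : expi (2 * pi) = 1 :> R[i].
    by rewrite mulr_natl /expi cos2pi sin2pi.
  by rewrite expr1n.
move=> /intrP[[n|n] ->]; first exact: N.
by rewrite NegzE mulrNz mulrN expiN N conjc1.
Qed.

Definition circle_char (z : circle R) : R[i] := expi (2 * pi * repr z).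

Lemma circle_charE (a : R) : circle_char (circle_proj a) = expi (2 * pi * a).
Proof.
have : circle_proj (repr (circle_proj a)) = circle_proj a :> circle R.
  by rewrite /circle_proj reprK.
move=> /circle_proj_eq aint; rewrite /circle_char.
set r := repr _ in aint *.
by rewrite -[r](subrK a) mulrDr expiD expi_2pi_int// mul1r.
Qed.

Lemma circle_charD (z w : circle R) :
  circle_char (z + w) = circle_char z * circle_char w.
Proof.
have [a ->] := circle_proj_surj z; have [b ->] := circle_proj_surj w.
by rewrite -circle_projD !circle_charE mulrDr expiD.
Qed.

Lemma circle_char0 : circle_char 0 = 1.
Proof. by rewrite -circle_proj0 circle_charE mulr0 expi0. Qed.

Lemma circle_charN (z : circle R) : circle_char (- z) = (circle_char z)^*.
Proof.
have [a ->] := circle_proj_surj z.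
by rewrite -circle_projN !circle_charE mulrN expiN.
Qed.

Lemma circle_char_sum (I : Type) (r : seq I) (F : I -> circle R) :
  circle_char (\sum_(i <- r) F i) = \prod_(i <- r) circle_char (F i).
Proof. by apply: (big_morph _ circle_charD circle_char0). Qed.

Lemma normc_circle_char z : normc (circle_char z) = 1.
Proof. exact: normc_expi. Qed.

Lemma measurable_circle_fun d (T : measurableType d) (g : circle R -> T) :
  measurable_fun [set: R] (fun a : R => g (circle_proj a)) ->
  measurable_fun [set: circle R] g.
Proof.
move=> mg _ A mA; rewrite setTI.
have := mg measurableT A mA; rewrite setTI.
exact.
Qed.

Lemma cmeasurable_circle_char (m : int) :
  cmeasurable (fun z : circle R => circle_char (z *~ m)).
Proof.
have E a : circle_char (circle_proj a *~ m) = expi (2 * pi * (a * m%:~R)).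
  by rewrite -circle_projMz circle_charE.
have ml : measurable_fun [set: R] (fun a : R => 2 * pi * (a * m%:~R)).
  apply: measurable_funM; first exact: measurable_cst.
  by apply: measurable_funM; [exact: measurable_id|exact: measurable_cst].
split; apply: measurable_circle_fun; under eq_fun do rewrite E /=.
  apply: (measurableT_comp (f := cos)) => //.
  by apply: continuous_measurable_fun; exact: continuous_cos.
apply: (measurableT_comp (f := sin)) => //.
by apply: continuous_measurable_fun; exact: continuous_sin.
Qed.

(** Splitting off the ends of the domain of [acos] leaves an open interval, where
    [acos] is continuous, hence measurable. *)
Definition acosm (a : R) : R :=
  if -1 < a < 1 then acos a else if 0 <= a then 0 else pi.

(** The argument of a complex number of modulus one, in turns, between
    -1/2 and 1/2. *)
Definition arg (z : R[i]) : R :=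
  if 0 <= complex.Im z then acosm (complex.Re z) / (2 * pi)
  else - (acosm (complex.Re z) / (2 * pi)).

Lemma acosmE (a : R) : 0 <= a <= pi -> acosm (cos a) = a.
Proof.
move=> api; have aK := @cosK R a; rewrite in_itv/= in aK.
rewrite /acosm; case: ifPn => [_|]; first exact: aK.
rewrite negb_and -!leNgt => /orP[h|h].
  have c1 : cos a = -1 by apply/eqP; rewrite eq_le h cos_geN1.
  rewrite c1 -(aK api) c1 acosN1 (_ : 0 <= -1 = false)//.
  by apply/negbTE; rewrite -ltNge ltrN10.
have c1 : cos a = 1 by apply/eqP; rewrite eq_le h cos_le1.
by rewrite c1 ler01 -(aK api) c1 acos1.
Qed.

Lemma argK (z : circle R) : circle_proj (arg (circle_char z)) = z.
Proof.
have [a0 ->] := circle_proj_surj z.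
pose a := a0 - (Num.floor a0)%:~R.
have -> : circle_proj a0 = circle_proj a :> circle R.
  by apply/circle_proj_eq; rewrite /a opprB addrC subrK intr_int.
have a01 : 0 <= a < 1.
  have /andP[f1 f2] := floor_itv a0; rewrite /a subr_ge0 f1/=.
  by rewrite ltrBlDl -[1]/(1%:~R) -intrD.
have pi2 : 0 < 2 * pi :> R by rewrite mulr_gt0// pi_gt0.
have /andP[a0' a1'] := a01.
(* The upper half circle; on the lower one [acos] sees the opposite angle. *)
rewrite circle_charE /arg; have [h|h] := leP a 2^-1.
  have r : 0 <= 2 * pi * a <= pi.
    by rewrite mulr_ge0 ?(ltW pi2)//= mulrAC ler_piMl ?pi_ge0//; lra.
  rewrite /=; have -> : 0 <= sin (2 * pi * a) by rewrite sin_ge0_pi.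
  by rewrite acosmE// mulrC mulKf// gt_eqF.
have r : 0 < 2 * pi * (1 - a) < pi.
  by rewrite mulr_gt0 ?subr_gt0//= mulrAC gtr_pMl ?pi_gt0//; lra.
have -> : expi (2 * pi * a) = (expi (2 * pi * (1 - a)))^* :> R[i].
  have -> : 2 * pi * a = 2 * pi * 1 - 2 * pi * (1 - a) by ring.
  by rewrite expiB expi_2pi_int ?rpred1// mul1r.
have sp : 0 < sin (2 * pi * (1 - a)) by rewrite sin_gt0_pi.
rewrite /= oppr_ge0 leNgt sp/= acosmE; last first.
  by case/andP: r => r1 r2; rewrite !ltW.
rewrite mulrC mulKf ?gt_eqF//; apply/circle_proj_eq.
by rewrite opprB addrAC subrr sub0r rpredN rpred1.
Qed.

Lemma measurable_arg d (T : measurableType d) (g : T -> R[i]) :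
  cmeasurable g -> measurable_fun [set: T] (fun t => arg (g t)).
Proof.
move=> [gr gi].
have macosm : measurable_fun [set: R] acosm.
  apply: measurable_fun_if => //.
  - apply: measurable_and; apply: measurable_fun_ltr => //.
  - rewrite setTI.
    have -> : (fun t : R => -1 < t < 1) @^-1` [set true] = `]-1, 1[%classic.
      by apply/seteqP; split=> t /=; rewrite in_itv/=.
    apply: open_continuous_measurable_fun; first exact: interval_open.
    by move=> t; rewrite inE/= in_itv/= => t1; exact: continuous_acos.
  - apply: measurable_funTS; apply: measurable_fun_ifT => //.
    exact: measurable_fun_ler.
have m1 : measurable_fun [set: T] (fun t => acosm (complex.Re (g t)) / (2 * pi)).
  apply: measurable_funM; last exact: measurable_cst.
  exact: measurableT_comp.
apply: measurable_fun_ifT => //.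
  exact: measurable_fun_ler.
exact: measurable_funN.
Qed.

End circle_character.

(** * The unipotent system as a space of sequences *)

Lemma lowD d (G H : {poly int}) : low d G -> low d H -> low d (G + H).
Proof.
by move=> /lowP G0 /lowP H0; apply/lowP => j jd; rewrite coefD G0// H0// addr0.
Qed.

Lemma lowN d (G : {poly int}) : low d (- G) = low d G.
Proof. by apply: eq_forallb => j; rewrite coefN oppr_eq0. Qed.

Lemma lowB d (G H : {poly int}) : low d G -> low d H -> low d (G - H).
Proof. by move=> G0 H0; apply: lowD; rewrite ?lowN. Qed.

Lemma low0 d : low d 0.
Proof. by apply/lowP => j _; rewrite coef0. Qed.

Lemma lowM d (H G : {poly int}) : low d G -> low d (H * G).
Proof.
move=> /lowP G0; apply/lowP => j jd; rewrite coefM; apply: big1 => i _.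
by rewrite G0 ?mulr0// (leq_trans (leq_subr _ _)).
Qed.

Lemma low_sum d (I : Type) (r : seq I) (F : I -> {poly int}) :
  (forall i, low d (F i)) -> low d (\sum_(i <- r) F i).
Proof.
by move=> lF; apply: (big_ind (fun G => low d G)) => [|G H|i _]; [exact: low0|exact: lowD|].
Qed.

Lemma low_eqm d (G H : {poly int}) : low d (G - H) -> low d G = low d H.
Proof.
move=> GH; apply/idP/idP => h; last by rewrite -(subrK H G) lowD.
by have -> : H = G - (G - H); [rewrite opprB addrC subrK|exact: lowB].
Qed.

(** [U] is invertible as a power series. *)
Lemma low_unit d (U G : {poly int}) : U`_0 = 1 -> low d (U * G) = low d G.
Proof.
move=> U0; apply/idP/idP; last exact: lowM.
move=> /lowP UG; apply/lowP; elim/ltn_ind => j IH jd.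
have := UG j jd; rewrite coefM big_ord_recl U0 mul1r subn0 big1 ?addr0// => i _.
rewrite IH ?mulr0//= /bump; last by rewrite (leq_trans (leq_subr _ _)).
by have := ltn_ord i; lia.
Qed.

Section powers_of_shift.
Variable d : nat.

(** The inverse of [1 + X] modulo [X ^ (d + 1)]. *)
Definition shift_inv : {poly int} := \sum_(i < d.+1) (- 'X) ^+ i.

Lemma shift_invP : low d ((1 + 'X) * shift_inv - 1).
Proof.
have -> : (1 + 'X) * shift_inv - 1 = - (- 'X) ^+ d.+1.
  have := subrX1 (- 'X : {poly int}) d.+1; rewrite -/shift_inv => e.
  by rewrite -[(- 'X) ^+ d.+1](subrK 1) e; ring.
rewrite lowN; apply/lowP => j jd.
by rewrite exprNn coefMXn ltnS jd.
Qed.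

(** Powers of [1 + X] with integer exponents, modulo [X ^ (d + 1)]. *)
Definition zpow (k : int) : {poly int} :=
  match k with Posz n => (1 + 'X) ^+ n | Negz n => shift_inv ^+ n.+1 end.

Lemma zpowS (k : int) : low d ((1 + 'X) * zpow k - zpow (k + 1)).
Proof.
case: k => [n|[|n]].
- have -> : Posz n + 1 = Posz n.+1 by lia.
  by rewrite /= exprS subrr low0.
- have -> : Negz 0 + 1 = Posz 0 by lia.
  by rewrite /= expr1 expr0; exact: shift_invP.
- have -> : Negz n.+1 + 1 = Negz n by rewrite !NegzE; lia.
  rewrite /= exprS mulrA -[X in _ - X]mul1r -mulrBl mulrC.
  by apply: lowM; exact: shift_invP.
Qed.

Lemma zpowD (K : nat) (k : int) :
  low d ((1 + 'X) ^+ K * zpow k - zpow (k + K%:Z)).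
Proof.
elim: K => [|K IH]; first by rewrite mul1r addr0 subrr low0.
have -> : (1 + 'X) ^+ K.+1 * zpow k - zpow (k + K.+1%:Z) =
    (1 + 'X) * ((1 + 'X) ^+ K * zpow k - zpow (k + K%:Z)) +
    ((1 + 'X) * zpow (k + K%:Z) - zpow (k + K%:Z + 1)).
  have -> : k + K.+1%:Z = k + K%:Z + 1 by rewrite -addn1 PoszD addrA.
  by rewrite exprS; ring.
by apply: lowD; [exact: lowM|exact: zpowS].
Qed.

Lemma zpow_shift (K : nat) (k : int) : 0 <= k + K%:Z ->
  low d ((1 + 'X) ^+ K * zpow k - (1 + 'X) ^+ absz (k + K%:Z)).
Proof.
move=> kK; have -> : (1 + 'X : {poly int}) ^+ absz (k + K%:Z) = zpow (k + K%:Z).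
  by case: (k + K%:Z) kK.
exact: zpowD.
Qed.

(** As [gpoly], but without translation: modulo [X ^ (d + 1)] the negative powers
    of [1 + X] are polynomials. *)
Definition wpoly (l : seq (int * bool)) : {poly int} :=
  \sum_(kb <- l) (if kb.2 then - zpow kb.1 else zpow kb.1).

(** Translation multiplies by a power of the unit [1 + X]. *)
Lemma low_wpoly (K : nat) l : (forall kb, kb \in l -> 0 <= kb.1 + K%:Z) ->
  low d (wpoly l) = low d (gpoly K l).
Proof.
move=> lK; rewrite -(@low_unit d ((1 + 'X) ^+ K)); last first.
  by have [] := coef_1DXn K.
apply: low_eqm; rewrite /wpoly /gpoly mulr_sumr -sumrB big_seq.
apply: (big_ind (fun G => low d G)) => [|G H|kb /lK kbK]; [exact: low0|exact: lowD|].
have z := zpow_shift kbK; case: kb.2 => //.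
by rewrite mulrN -opprD lowN.
Qed.

Definition shift_seq (n : nat) (l : seq (int * bool)) :=
  [seq (kb.1 + n%:Z, kb.2) | kb <- l].

Lemma wpoly_cat l1 l2 : wpoly (l1 ++ l2) = wpoly l1 + wpoly l2.
Proof. by rewrite /wpoly big_cat. Qed.

Lemma wpoly_conj l : wpoly (conj_seq l) = - wpoly l.
Proof.
rewrite /wpoly big_map -sumrN; apply: eq_bigr => -[k b] _ /=.
by case: b; rewrite /= ?opprK.
Qed.

Lemma wpoly_shift n l :
  low d ((1 + 'X) ^+ n * wpoly l - wpoly (shift_seq n l)).
Proof.
rewrite /wpoly big_map mulr_sumr -sumrB; apply: low_sum => -[k b] /=.
have := zpowD n k; case: b => //= h.
by rewrite mulrN -opprD lowN.
Qed.

End powers_of_shift.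

Section torus.
Context {R : realType} (d : nat).
Local Notation torus := (d.+1.-tuple (circle R)).
Implicit Types (y : torus) (P Q : {poly int}).

(** The action of polynomials in [S - 1] on the last coordinate, where [S] is
    the unipotent map. *)
Definition pairing P y : circle R :=
  \sum_(j < d.+1) tnth y (rev_ord j) *~ P`_j.

Lemma pairingD P Q y : pairing (P + Q) y = pairing P y + pairing Q y.
Proof.
by rewrite -big_split; apply: eq_bigr => j _; rewrite coefD mulrzDr.
Qed.

Lemma pairingN P y : pairing (- P) y = - pairing P y.
Proof. by rewrite -sumrN; apply: eq_bigr => j _; rewrite coefN mulrNz. Qed.

Lemma pairing0 y : pairing 0 y = 0.
Proof. by apply: big1 => j _; rewrite coef0. Qed.

Lemma pairing_sum (I : Type) (r : seq I) (F : I -> {poly int}) y :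
  pairing (\sum_(i <- r) F i) y = \sum_(i <- r) pairing (F i) y.
Proof.
by apply: (big_morph (pairing^~ y)) => [P Q|]; rewrite (pairingD, pairing0).
Qed.

Lemma pairingZ (c : int) P y : pairing (c *: P) y = pairing P y *~ c.
Proof.
rewrite /pairing (big_morph (fun z => z *~ c) (mulrzDl c) (mul0rz _ c)).
apply: eq_bigr => j _.
by rewrite coefZ mulrC mulrzA.
Qed.

Lemma pairing_low P Q y : low d (P - Q) -> pairing P y = pairing Q y.
Proof.
move=> /lowP PQ; apply: eq_bigr => j _; congr (_ *~ _).
by apply/eqP; rewrite -subr_eq0 -coefB PQ// -ltnS.
Qed.

(** In degree [j] the pairing sees the coordinate [d - j], to which [unipotent]
    adds the coordinate [d - j - 1]; the last summand drops out at [j = d]. *)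
Lemma pairing_unipotent P y : pairing P (unipotent y) = pairing ((1 + 'X) * P) y.
Proof.
rewrite mulrDl mul1r pairingD /pairing.
have -> : \sum_(j < d.+1) tnth (unipotent y) (rev_ord j) *~ P`_j =
    \sum_(j < d.+1) tnth y (rev_ord j) *~ P`_j +
    \sum_(j < d.+1) (if (0 < rev_ord j)%N then tnth y (inord (rev_ord j).-1)
       else 0) *~ P`_j.
  by rewrite -big_split; apply: eq_bigr => j _; rewrite tnth_mktuple mulrzDl.
congr (_ + _).
rewrite big_ord_recr/= subnn/= mul0rz addr0.
rewrite [RHS]big_ord_recl coefXM mulr0z add0r.
apply: eq_bigr => j _ /=; rewrite coefXM/=.
have jd := ltn_ord j; rewrite subSS subn_gt0 jd; congr (tnth y _ *~ _).
by apply: val_inj; rewrite /= inordK /bump; lia.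
Qed.

Lemma pairing_Xn j y : pairing 'X^(rev_ord j) y = tnth y j.
Proof.
rewrite /pairing (bigD1 (rev_ord j))//= coefXn eqxx rev_ordK big1 ?addr0// => i ij.
by rewrite coefXn -val_eqE/= in ij *; rewrite (negPf ij).
Qed.

Lemma pairing_char P y :
  circle_char (pairing P y) =
  \prod_(j <- index_enum 'I_d.+1) circle_char (tnth y (rev_ord j) *~ P`_j).
Proof. exact: circle_char_sum. Qed.

Lemma orbit_in_disc (z : circle R) : circle_char z \in unit_disc R.
Proof.
by rewrite inE /unit_disc /= normE normc_circle_char.
Qed.

(** The values of the character of the last coordinate along the orbit of [y]:
    the [k]-th power of [unipotent] acts on that coordinate as [(1 + X) ^ k]. *)
Definition orbit_seq y : Xspace R :=
  fun k => exist _ (circle_char (pairing (zpow d k) y)) (orbit_in_disc _).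

Lemma coord_orbit y k : coord (orbit_seq y) k = circle_char (pairing (zpow d k) y).
Proof. by []. Qed.

Lemma coord_inj (x x' : Xspace R) : (forall k, coord x k = coord x' k) -> x = x'.
Proof. by move=> h; apply/funext => k; apply: val_inj; have := h k. Qed.

Lemma shift_orbit y : shiftX (orbit_seq y) = orbit_seq (unipotent y).
Proof.
apply: coord_inj => k; rewrite coord_orbit pairing_unipotent.
by rewrite (pairing_low y (zpowS d k)).
Qed.

Lemma mono_orbit l y :
  mono l (coord (orbit_seq y)) = circle_char (pairing (wpoly d l) y).
Proof.
rewrite /wpoly pairing_sum circle_char_sum; apply: eq_bigr => -[k b] _ /=.
by case: b; rewrite ?pairingN ?circle_charN.
Qed.

Lemma cmeasurable_pairing P : cmeasurable (fun y => circle_char (pairing P y)).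
Proof.
have -> : (fun y => circle_char (pairing P y)) = (fun y =>
    \prod_(j <- index_enum 'I_d.+1) circle_char (tnth y (rev_ord j) *~ P`_j)).
  by apply/funext => y; exact: pairing_char.
apply: cmeasurable_prod => j.
have [cr ci] := @cmeasurable_circle_char R P`_j.
split.
  exact: (measurableT_comp cr (measurable_tnth (rev_ord j))).
exact: (measurableT_comp ci (measurable_tnth (rev_ord j))).
Qed.

Lemma measurable_orbit_seq : measurable_fun [set: torus] orbit_seq.
Proof.
by apply: measurable_into_Xspace => k; exact: cmeasurable_pairing.
Qed.

HB.instance Definition _ :=
  isMeasurableFun.Build _ _ _ _ orbit_seq measurable_orbit_seq.

(** The coordinate [d - j] of a point is the [j]-th difference at 0 of the
    arguments of its orbit sequence, since [X ^ j = ((1 + X) - 1) ^ j]. *)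
Definition torus_of_seq (x : Xspace R) : torus :=
  [tuple circle_proj (\sum_(k < d.+1)
     arg (coord x k%:Z) * ((('X - 1) ^+ rev_ord i : {poly int})`_k)%:~R) | i < d.+1].

Lemma orbit_seqK : cancel orbit_seq torus_of_seq.
Proof.
move=> y; apply: eq_from_tnth => i; rewrite tnth_mktuple circle_proj_sum.
pose q : {poly int} := ('X - 1) ^+ rev_ord i.
have -> : \sum_(k < d.+1) circle_proj (arg (coord (orbit_seq y) k%:Z) * (q`_k)%:~R) =
    pairing (\sum_(k < d.+1) q`_k *: (1 + 'X) ^+ k) y.
  rewrite pairing_sum; apply: eq_bigr => k _.
  by rewrite circle_projMz coord_orbit argK pairingZ.
have -> : \sum_(k < d.+1) q`_k *: (1 + 'X) ^+ k = 'X^(rev_ord i).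
  have -> : 'X^(rev_ord i) = q \Po (1 + 'X).
    by rewrite /q rmorphXn rmorphB/= comp_polyX comp_polyC addrAC subrr add0r.
  rewrite comp_polyE; apply/esym.
  have sq : (size q <= d.+1)%N.
    by rewrite /q -[1]/(1%:P) size_exp_XsubC; exact: ltn_ord.
  rewrite (big_ord_widen d.+1 (fun k => q`_k *: (1 + 'X) ^+ k) sq) big_mkcond.
  by apply: eq_bigr => k _; case: ltnP => // h; rewrite nth_default// scale0r.
by rewrite pairing_Xn.
Qed.

Lemma cmeasurable_coord k : cmeasurable (fun x : Xspace R => coord x k).
Proof.
have [cr ci] := @ccontinuous_coord R k.
by split; exact: continuous_measurableX.
Qed.

Lemma measurable_torus_of_seq : measurable_fun [set: Xspace R] torus_of_seq.
Proof.
apply/measurable_fun_tnthP => i.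
have -> : (@tnth d.+1 (circle R))^~ i \o torus_of_seq = (fun x => circle_proj
    (\sum_(k < d.+1) arg (coord x k%:Z) *
      ((('X - 1) ^+ rev_ord i : {poly int})`_k)%:~R)).
  by apply/funext => x; rewrite /= tnth_mktuple.
apply: measurableT_comp; first exact: measurable_circle_proj.
apply: measurable_sum => k; apply: measurable_funM; last exact: measurable_cst.
by apply: measurable_arg; exact: cmeasurable_coord.
Qed.

End torus.

(** * Fourier coefficients of the Haar measure *)

Section Fourier.
Context {R : realType}.

(** The constant 1 makes the integrand nonnegative, as required to integrate
    against the uniform distribution without a prior proof of integrability. *)
Lemma integral_cos_period (b : R) (m : int) : m != 0 ->
  (\int[lebesgue_measure]_(a in `[0%R, 1%R]) (1 + cos (b + 2 * pi * m%:~R * a))%R%:E =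
   1%:E)%E.
Proof.
move=> m0; pose w : R := 2 * pi * m%:~R.
have w0 : w != 0.
  by rewrite !mulf_neq0 ?intr_eq0// gt_eqF// pi_gt0.
pose F a := a + w^-1 * sin (b + w * a).
pose aff := cst b + w \*: (@id R : R -> R^o).
have affE : aff = (fun a => b + w * a) by apply/funext.
have FE : F = (@id R : R -> R^o) + w^-1 \*: (sin \o aff).
  by apply/funext => a; rewrite affE.
have dF a : is_derive a (1 : R) F (1 + cos (b + w * a)).
  have d0 : is_derive a (1 : R) (w \*: (@id R : R -> R^o)) (w *: (1 : R)).
    exact: is_deriveZ.
  have d1 := is_deriveD (is_derive_cst b a (1 : R)) d0.
  have d2 := @is_derive1_comp R sin aff a _ _ (is_derive_sin _) d1.
  have d3 := is_deriveD (is_derive_id a (1 : R)) (is_deriveZ w^-1 d2).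
  rewrite FE; apply: is_derive_eq d3 _.
  rewrite affE /GRing.scale/= mulr1 add0r mulrCA mulVf// mulr1.
  by [].
have cF : continuous F by move=> a; apply: differentiable_continuous; apply/derivable1_diffP; have [] := dF a.
rewrite (@continuous_FTC2 R (fun a => 1 + cos (b + w * a)) F 0 1 ltr01).
- rewrite /F mulr0 !addr0 mulr1 add0r.
  have -> : sin (b + w) = sin b.
    have : expi (b + w) = expi b :> R[i].
      by rewrite expiD expi_2pi_int ?mulr1// intr_int.
    by move=> /(congr1 (@complex.Im R)).
  by rewrite -EFinB; congr (_%:E); rewrite addrK.
- apply: continuous_subspaceT => a.
  apply: cvgD; first exact: cvg_cst.
  apply: (@continuous_comp _ _ _ (fun a : R => b + w * a) cos).
    by apply: cvgD; [exact: cvg_cst|apply: cvgM; [exact: cvg_cst|exact: cvg_id]].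
  exact: continuous_cos.
- split.
  + by move=> a _; have [] := dF a.
  + by apply: cvg_at_right_filter; exact: cF.
  + by apply: cvg_at_left_filter; exact: cF.
- by move=> a _; rewrite derive1E; have [_ ->] := dF a.
Qed.

Lemma measurable_cos_affine (b w : R) :
  measurable_fun [set: R] (fun a : R => cos (b + w * a)).
Proof.
apply: (measurableT_comp (f := cos)).
  by apply: continuous_measurable_fun; exact: continuous_cos.
apply: measurable_funD; first exact: measurable_cst.
by apply: measurable_funM; [exact: measurable_cst|exact: measurable_id].
Qed.

Lemma bmeasurable_phase d (T : measurableType d) (a : R[i]) (g : T -> R[i]) :
  cmeasurable g -> (forall t, normc (g t) <= 1) ->
  bmeasurable (fun t => complex.Re (a * g t)).
Proof.
move=> mg g1; split.
  by have [] := cmeasurableM (cmeasurable_cst a) mg.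
exists (normc a) => t; rewrite (le_trans (normc_Re _))// normcM.
by rewrite ler_piMr// normc_ge0.
Qed.

Lemma haar_circle_char (b : R) (m : int) : m != 0 ->
  (\int[haar_circle]_z complex.Re (expi b * circle_char (z *~ m)))%R = 0.
Proof.
move=> m0; rewrite /haar_circle.
have c1 (z : circle R) : normc (circle_char (z *~ m)) <= 1.
  by rewrite normc_circle_char.
have bm := bmeasurable_phase (expi b) (cmeasurable_circle_char m) c1.
rewrite expect_push//.
have E (a : R) : complex.Re (expi b * circle_char (circle_proj a *~ m)) =
    cos (b + 2 * pi * m%:~R * a).
  by rewrite -circle_projMz circle_charE -expiD /=; congr cos; ring.
under eq_Rintegral do rewrite E.
have mc := measurable_cos_affine b (2 * pi * m%:~R).
have bc : bmeasurable (fun a : measurableTypeR R => cos (b + 2 * pi * m%:~R * a)).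
  by split => //; exists 1 => a; exact: cos_max.
have := expectD (uniform_prob (@ltr01 R)) (bmeasurable_cst 1) bc.
rewrite expect_cst => e; apply: (addrI 1); rewrite addr0 -e.
rewrite /Rintegral integral_uniform.
- by rewrite integral_cos_period// subr0 invr1 mul1e.
- by apply/measurable_EFinP; apply: measurable_funD => //; exact: measurable_cst.
- by move=> a; rewrite lee_fin -lerBlDl sub0r cos_geN1.
Qed.

(** Orthogonality of characters, by integration over the first coordinate. The
    phase [b] makes the induction work: it absorbs the remaining coordinates when
    the first frequency is not zero. *)
Lemma haar_torus_char n (m : 'I_n -> int) (b : R) :
  (\int[haar_torus n]_y complex.Re (expi b *
     circle_char (\sum_(i < n) tnth y i *~ m i)))%R =
  if [forall i, m i == 0] then cos b else 0.
Proof.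
have cm k (m' : 'I_k -> int) : cmeasurable
    (fun y : k.-tuple (circle R) => circle_char (\sum_(i < k) tnth y i *~ m' i)).
  have -> : (fun y : k.-tuple (circle R) => circle_char (\sum_(i < k) tnth y i *~ m' i)) =
      (fun y => \prod_(i <- index_enum 'I_k) circle_char (tnth y i *~ m' i)).
    by apply/funext => y; rewrite circle_char_sum.
  apply: cmeasurable_prod => i; have [cr ci] := @cmeasurable_circle_char R (m' i).
  split; first exact: (measurableT_comp cr (measurable_tnth i)).
  exact: (measurableT_comp ci (measurable_tnth i)).
elim: n m b => [|n IH] m b.
  rewrite [in RHS](_ : [forall i, m i == 0]); last by apply/forallP => -[].
  rewrite -[RHS](expect_cst (haar_torus 0)); apply: eq_Rintegral => y _.
  by rewrite big_ord0 circle_char0 mulr1.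
have bu : bmeasurable (fun y : n.+1.-tuple (circle R) => complex.Re (expi b *
     circle_char (\sum_(i < n.+1) tnth y i *~ m i))).
  apply: bmeasurable_phase; first exact: cm.
  by move=> y; rewrite normc_circle_char.
transitivity (\int[(haar_circle \x haar_torus n)%E]_z complex.Re (expi b *
     circle_char (\sum_(i < n.+1) tnth (torus_cons z) i *~ m i)))%R.
  exact: (expect_push (haar_circle \x haar_torus n)%E (@torus_cons R n) bu).
pose m' i := m (lift ord0 i).
have E (z : circle R * n.-tuple (circle R)) :
    complex.Re (expi b * circle_char (\sum_(i < n.+1) tnth (torus_cons z) i *~ m i)) =
    complex.Re (expi b * (circle_char (z.1 *~ m ord0) *
      circle_char (\sum_(i < n) tnth z.2 i *~ m' i))).
  rewrite big_ord_recl circle_charD tnth0; congr (complex.Re (_ * (_ * circle_char _))).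
  by apply: eq_bigr => i _; rewrite /torus_cons tnthS; case: z.
under eq_Rintegral do rewrite E.
pose f (z : circle R * n.-tuple (circle R)) : R :=
  complex.Re (expi b * (circle_char (z.1 *~ m ord0) *
      circle_char (\sum_(i < n) tnth z.2 i *~ m' i))).
have mf : bmeasurable f.
  apply: bmeasurable_phase; last first.
    by move=> z; rewrite normcM !normc_circle_char mulr1.
  have [c1r c1i] := @cmeasurable_circle_char R (m ord0).
  have [c2r c2i] := cm n m'.
  apply: cmeasurableM; split.
  - exact: (measurableT_comp c1r measurable_fst).
  - exact: (measurableT_comp c1i measurable_fst).
  - exact: (measurableT_comp c2r measurable_snd).
  - exact: (measurableT_comp c2i measurable_snd).
have intf := bmeasurable_integrable (haar_circle \x haar_torus n)%E mf.
have [m00|m00] := eqVneq (m ord0) 0; last first.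
  rewrite ifF; last by apply/negbTE/forallPn; exists ord0.
  rewrite /Rintegral -(@integral21_prod_meas1 _ _ _ _ _ haar_circle (haar_torus n))//.
  rewrite -[RHS](expect_cst (haar_torus n)); congr fine.
  apply: eq_integral => y _; rewrite /fubini_G.
  have [a aE] := circle_proj_surj (\sum_(i < n) tnth y i *~ m' i).
  have fE z : f (z, y) = complex.Re (expi (b + 2 * pi * a) * circle_char (z *~ m ord0)).
    rewrite /f (_ : circle_char (\sum_(i < n) tnth (z, y).2 i *~ m' i) =
      expi (2 * pi * a)); last by rewrite -circle_charE -aE.
    by rewrite expiD; congr complex.Re; ring.
  transitivity (\int[haar_circle]_z (complex.Re (expi (b + 2 * pi * a) *
      circle_char (z *~ m ord0)))%:E)%E.
    by apply: eq_integral => z _; congr EFin; exact: fE.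
  rewrite expect_EFin ?haar_circle_char//.
  apply: bmeasurable_phase; first exact: cmeasurable_circle_char.
  by move=> z; rewrite normc_circle_char.
have -> : [forall i, m i == 0] = [forall i, m' i == 0].
  apply/forallP/forallP => h i; first exact: h.
  by case: (unliftP ord0 i) => [j ->|->]; [exact: h|rewrite m00].
rewrite /Rintegral -(@integral12_prod_meas1 _ _ _ _ _ haar_circle (haar_torus n))//.
rewrite -[RHS](expect_cst haar_circle); congr fine.
apply: eq_integral => z _; rewrite /fubini_F.
have fE y : f (z, y) = complex.Re (expi b * circle_char (\sum_(i < n) tnth y i *~ m' i)).
  by rewrite /f m00 mulr0z circle_char0 mul1r.
transitivity (\int[haar_torus n]_y (complex.Re (expi b *
    circle_char (\sum_(i < n) tnth y i *~ m' i)))%:E)%E.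
  by apply: eq_integral => y _; congr EFin; exact: fE.
rewrite expect_EFin ?IH//.
apply: bmeasurable_phase; first exact: cm.
by move=> y; rewrite normc_circle_char.
Qed.

End Fourier.

(** * Moments of the unipotent system *)

Section small_averages.
Context {R : realType}.
Variable N : nat -> nat.
Implicit Types (u v : nat -> nat -> R[i]).

Lemma small_avgD u v : small_avg N u -> small_avg N v ->
  small_avg N (fun m n => u m n + v m n).
Proof.
move=> su sv e e0; have e2 : 0 < e / 2 by rewrite divr_gt0.
have := sv _ e2; have := su _ e2; apply: filterS2 => m h1 h2.
rewrite big_split/= (le_trans (ler_normcD _ _))//.
by rewrite [e]splitr mulrDl lerD.
Qed.

Lemma small_avgZ (c : R[i]) u : small_avg N u -> small_avg N (fun m n => c * u m n).
Proof.
move=> su e e0; have c0 : 0 < normc c + 1 by rewrite ltr_wpDl// normc_ge0.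
have := su _ (divr_gt0 e0 c0); apply: filterS => m h.
rewrite -mulr_sumr normcM.
apply: (@le_trans _ _ ((normc c + 1) * (e / (normc c + 1) * (N m)%:R))).
  by rewrite ler_pM ?normc_ge0// lerDl.
by rewrite mulrA [_ * (e / _)]mulrC divfK// gt_eqF.
Qed.

Lemma small_avg0 : small_avg N (fun _ _ => 0 : R[i]).
Proof.
move=> e e0; apply: nearW => m.
by rewrite big1// normc0 mulr_ge0// ltW.
Qed.

End small_averages.

Section moment_values.
Context {R : realType}.
Variable d : nat.

(** The common value of the moments. It is 1 exactly if the signed sum over the
    exponents of each polynomial of degree at most [d] is 0. *)
Definition kappa (l : seq (int * bool)) : bool := low d (wpoly d l).

(** The value that the moments give to the integral of a trigonometric
    polynomial. *)
Definition ksum (s : seq (R[i] * seq (int * bool))) : R[i] :=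
  \sum_(al <- s) al.1 * (kappa al.2)%:R.

Lemma bmeasurable_trig s : bmeasurable (fun y : Xspace R => complex.Re (trig s y)).
Proof.
have [c _] := @ccontinuous_trig R s; split; first exact: continuous_measurableX.
by have [M _ hM] := cont_bounded compact_Xtop c; exists M.
Qed.

Definition torus_system : probability (Xspace R) R :=
  distribution (@haar_torus R d.+1) (@orbit_seq R d).

(** The monomials are characters on the orbit sequences; the phases 0 and [pi / 2]
    give their real and imaginary parts, hence the case of a general coefficient. *)
Lemma torus_moment (a : R[i]) l :
  (\int[torus_system]_y complex.Re (a * mono l (coord y)))%R =
  complex.Re (a * (kappa l)%:R).
Proof.
have char1 (b : R) : (\int[@haar_torus R d.+1]_y complex.Re (expi b *
    circle_char (pairing (wpoly d l) y)))%R = cos b * (kappa l)%:R.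
  have := @haar_torus_char R d.+1 (fun i => (wpoly d l)`_(rev_ord i)) b.
  have -> : [forall i : 'I_d.+1, (wpoly d l)`_(rev_ord i) == 0] = kappa l.
    apply/forallP/lowP => h j.
      move=> jd; have := h (rev_ord (Ordinal (jd : (j < d.+1)%N))).
      by rewrite rev_ordK => /eqP.
    by apply/eqP/h; rewrite -ltnS ltn_ord.
  move=> e; transitivity (if kappa l then cos b else 0); last first.
    by case: (kappa l); rewrite ?mulr1 ?mulr0.
  rewrite -e; apply: eq_Rintegral => y _; congr (complex.Re (_ * circle_char _)).
  rewrite /pairing (reindex_inj rev_ord_inj)/=.
  by apply: eq_bigr => i _; rewrite rev_ordK.
have bch c : bmeasurable (fun y : d.+1.-tuple (circle R) =>
    complex.Re (c * circle_char (pairing (wpoly d l) y))).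
  apply: bmeasurable_phase; first exact: cmeasurable_pairing.
  by move=> y; rewrite normc_circle_char.
have bmon : bmeasurable (fun y : Xspace R => complex.Re (a * mono l (coord y))).
  have := bmeasurable_trig [:: (a, l)]; congr bmeasurable.
  by apply/funext => y; rewrite /trig big_seq1.
rewrite /torus_system expect_push//.
transitivity (\int[@haar_torus R d.+1]_y
  (complex.Re a * complex.Re (expi 0 * circle_char (pairing (wpoly d l) y)) +
   complex.Im a * complex.Re (expi (pi / 2) * circle_char (pairing (wpoly d l) y))))%R.
  apply: eq_Rintegral => y _; rewrite mono_orbit expi0 mul1r.
  have -> : expi (pi / 2) = 'i :> R[i] by rewrite /expi cos_pihalf sin_pihalf.
  by case: a {bmon} (circle_char _) => [a1 a2] [z1 z2] /=; ring.
have b1 := bmeasurableM (bmeasurable_cst (complex.Re a)) (bch (expi 0)).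
have b2 := bmeasurableM (bmeasurable_cst (complex.Im a)) (bch (expi (pi / 2))).
rewrite expectD// !expectZ// !char1 cos0 cos_pihalf mul0r mulr0 addr0 mul1r.
by case: a {bmon b1 b2} => [a1 a2] /=; case: (kappa l); rewrite /= ?mulr1 ?mulr0 ?mul0r; ring.
Qed.

Lemma torus_trig s :
  (\int[torus_system]_y complex.Re (trig s y))%R = complex.Re (ksum s).
Proof.
transitivity (\int[torus_system]_y
    (\sum_(al <- s) complex.Re (al.1 * mono al.2 (coord y))))%R.
  apply: eq_Rintegral => y _; rewrite /trig.
  by apply: (big_morph (@complex.Re R)) => // z w; rewrite ReD.
rewrite expect_sum; last first.
  move=> al; have := bmeasurable_trig [:: al]; congr bmeasurable.
  by apply/funext => y; rewrite /trig big_seq1.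
rewrite (eq_bigr _ (fun al _ => torus_moment al.1 al.2)) /ksum.
by apply/esym/(big_morph (@complex.Re R)) => // z w; rewrite ReD.
Qed.

Lemma kappa_shift n l : kappa (shift_seq n l) = kappa l.
Proof.
rewrite /kappa -(low_eqm (wpoly_shift d n l)) low_unit//.
by have [] := coef_1DXn n.
Qed.

Lemma bigsum_ge (l : seq (int * bool)) kb : kb \in l ->
  0 <= kb.1 + (\sum_(kb <- l) absz kb.1)%N%:Z.
Proof.
move=> kbl; have : (absz kb.1 <= \sum_(kb <- l) absz kb.1)%N.
  by rewrite (big_rem kb)//= leq_addr.
lia.
Qed.

(** [(1 + X) ^ r - 1] vanishes to order exactly one at 0, so that composition
    with it multiplies the leading coefficient by a power of [r] and preserves the
    order of vanishing. *)
Lemma low_comp (r : nat) (G : {poly int}) : (0 < r)%N ->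
  low d (G \Po ((1 + 'X) ^+ r - 1)) = low d G.
Proof.
move=> r0; have [Y0 Y1] := coef_1DXn_sub1 r.
set Y := _ - 1 in Y0 Y1 *.
have YXn j : forall i, (i < j)%N -> (Y ^+ j)`_i = 0.
  elim: j => // j IH i; rewrite ltnS => ij; rewrite exprS.
  by have [h _] := coefM_order Y0 IH; exact: h.
have YXj j : (Y ^+ j)`_j = r%:Z ^+ j.
  elim: j => [|j IH]; first by rewrite expr0 coef1.
  have [_ h] := coefM_order Y0 (YXn j).
  by rewrite exprS h Y1 IH exprS.
have cE i : (G \Po Y)`_i = \sum_(k < size G) G`_k * (Y ^+ k)`_i.
  by rewrite comp_polyE coef_sum; apply: eq_bigr => k _; rewrite coefZ.
apply/idP/idP => [/lowP h|/lowP h]; last first.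
  apply/lowP => i id; rewrite cE; apply: big1 => k _.
  have [kd|kd] := leqP k d; first by rewrite h// mul0r.
  by rewrite YXn ?mulr0// (leq_ltn_trans id).
apply/negPn/negP => /lowPn[j jd [Gj Glt]].
have := h j jd; rewrite cE.
have js : (j < size G)%N.
  by rewrite ltnNge; apply/negP => sj; move: Gj; rewrite nth_default.
rewrite (bigD1 (Ordinal js))//= big1 ?addr0 ?YXj => [|k kj].
  move=> /eqP; rewrite mulf_eq0 (negPf Gj)/= expf_eq0 => /andP[_].
  by rewrite eqz_nat -[_ == _]negbK -lt0n r0.
have [kj'|kj'] := leqP k j.
  rewrite Glt ?mul0r// ltn_neqAle kj' andbT.
  by move: kj; rewrite -val_eqE.
by rewrite YXn ?mulr0.
Qed.

(** The source of strong stationarity: dilation of the exponents by [r] replaces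
    [1 + X] by [(1 + X) ^ r]. *)
Lemma kappa_dilate (r : nat) l : (0 < r)%N ->
  kappa [seq (r%:Z * kb.1, kb.2) | kb <- l] = kappa l.
Proof.
move=> r0; set l' := map _ _; pose K := (\sum_(kb <- l) absz kb.1)%N.
rewrite /kappa (@low_wpoly d K l); last by move=> kb; exact: bigsum_ge.
rewrite (@low_wpoly d (r * K)%N l'); last first.
  move=> _ /mapP[kb kbl ->] /=; rewrite PoszM -mulrDr mulr_ge0//.
  exact: bigsum_ge.
rewrite -[RHS](low_comp _ r0); congr (low d _).
rewrite /gpoly /l' big_map rmorph_sum big_seq [RHS]big_seq/=.
apply: eq_bigr => -[k b] kl; rewrite [LHS]/= .
have -> : absz (r%:Z * k + (r * K)%N%:Z) = (r * absz (k + K%:Z)%R)%N.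
  by rewrite PoszM -mulrDr abszM.
have e : (1 + 'X) ^+ absz (k + K%:Z)%R \Po ((1 + 'X) ^+ r - 1) =
    (1 + 'X : {poly int}) ^+ (r * absz (k + K%:Z)%R)%N.
  by rewrite rmorphXn/= comp_polyD comp_polyX comp_polyC addrC subrK exprM.
by case: b {kl}; rewrite /= ?comp_polyN ?linearN/= e.
Qed.

End moment_values.

(** * The Furstenberg system *)

Section furstenberg.
Context {R : realType}.
Variables (d : nat) (N : nat -> nat) (x : Xspace R).
Hypothesis N_pos : forall m : nat, (0 < m)%N -> (0 < N m)%N.
Hypothesis x_moments : forall l, small_avg N
  (fun m n => mono l (coord (shiftX_z n%:Z x)) - (kappa d l)%:R : R[i]).

Lemma trig_averages s : small_avg N
  (fun m n => trig s (shiftX_z n%:Z x) - ksum d s : R[i]).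
Proof.
elim: s => [|[a l] s IH].
  have -> : (fun m n => trig [::] (shiftX_z n%:Z x) - ksum d [::]) =
      (fun (m n : nat) => 0 : R[i]).
    by apply/funext => m; apply/funext => n; rewrite /trig /ksum !big_nil subrr.
  exact: small_avg0.
have -> : (fun m n => trig ((a, l) :: s) (shiftX_z n%:Z x) - ksum d ((a, l) :: s)) =
   (fun m n : nat => a * (mono l (coord (shiftX_z n%:Z x)) - (kappa d l)%:R) +
     (trig s (shiftX_z n%:Z x) - ksum d s)).
  apply/funext => m; apply/funext => n; rewrite /trig /ksum !big_cons/=.
  by rewrite mulrBr opprD addrACA.
by apply: small_avgD => //; apply: small_avgZ; exact: x_moments.
Qed.

Lemma avg_const (m : nat) (c : R) : (0 < N m)%N ->
  (N m)%:R^-1 * \sum_(1 <= n < (N m).+1) c = c.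
Proof.
move=> N0; rewrite big_const_nat iter_addr addr0 subSS subn0 -[c *+ _]mulr_natl.
by rewrite mulKf// pnatr_eq0 -lt0n.
Qed.

(** The averages of trigonometric polynomials converge to their integrals, as
    both are given by the moments, and trigonometric polynomials are dense. *)
Lemma torus_system_furstenberg : furstenberg_system x N (@torus_system R d).
Proof.
move=> phi cphi; apply/cvgrPdist_le => e e0.
have e3 : 0 < e / 3 by rewrite divr_gt0.
have [s hs] := trig_dense cphi e3.
have bphi : bmeasurable (phi : Xspace R -> R).
  split; first exact: continuous_measurableX.
  by have [M _ hM] := cont_bounded compact_Xtop cphi; exists M.
have near1 := trig_averages s e3.
near=> m.
have m0 : (0 < m)%N by near: m; exact: nbhs_infty_gt.
have N0 := N_pos m0; have NR0 : 0 < (N m)%:R :> R by rewrite ltr0n.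
have h1 : normc (\sum_(1 <= n < (N m).+1) (trig s (shiftX_z n%:Z x) - ksum d s))
    <= e / 3 * (N m)%:R by near: m.
have h2 : `|(\int[@torus_system R d]_y phi y)%R - complex.Re (ksum d s)| <= e / 3.
  rewrite -torus_trig; apply: expect_close => //; exact: bmeasurable_trig.
pose A u := (N m)%:R^-1 * \sum_(1 <= n < (N m).+1) u n : R.
have h3 : `|A (fun n => complex.Re (trig s (shiftX_z n%:Z x))) -
    complex.Re (ksum d s)| <= e / 3.
  rewrite -[complex.Re (ksum d s)](avg_const _ N0) /A -mulrBr -sumrB.
  rewrite normrM ger0_norm ?invr_ge0// mulrC ler_pdivrMr//.
  apply: le_trans h1; apply: le_trans (normc_Re _).
  rewrite le_eqVlt; apply/orP; left; apply/eqP; congr `|_|.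
  have -> : complex.Re (\sum_(1 <= n < (N m).+1) (trig s (shiftX_z n%:Z x) - ksum d s)) =
      \sum_(1 <= n < (N m).+1) complex.Re (trig s (shiftX_z n%:Z x) - ksum d s).
    by apply: (big_morph (@complex.Re R)) => // z w; rewrite ReD.
  by apply: eq_bigr => n _; rewrite ReB.
have h4 : `|A (fun n => phi (shiftX_z n%:Z x)) -
    A (fun n => complex.Re (trig s (shiftX_z n%:Z x)))| <= e / 3.
  rewrite /A -mulrBr -sumrB normrM ger0_norm ?invr_ge0// mulrC ler_pdivrMr//.
  rewrite (le_trans (ler_norm_sum _ _ _))//.
  apply: (@le_trans _ _ (\sum_(1 <= n < (N m).+1) e / 3)).
    by apply: ler_sum => n _; exact: hs.
  by rewrite big_const_nat iter_addr addr0 subSS subn0 -[leLHS]mulr_natr.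
rewrite -/(A (fun n => phi (shiftX_z n%:Z x))).
move: h2 h3 h4; set I := Rintegral _ _ _; set B := A _; set C := A _.
set D := complex.Re _ => h2 h3 h4.
have -> : I - C = (I - D) - (B - D) - (C - B) by ring.
rewrite (le_trans (ler_normB _ _))// (le_trans (lerD (ler_normB _ _) (lexx _)))//.
lra.
Unshelve. all: by end_near. Qed.

Variable mu : probability (Xspace R) R.
Hypothesis mu_furst : furstenberg_system x N mu.

Lemma furstenberg_unique (A : set (Xspace R)) : measurable A ->
  mu A = @torus_system R d A.
Proof.
apply: probability_eq => phi cphi.
have h1 := mu_furst cphi; have h2 := torus_system_furstenberg cphi.
by rewrite -(cvg_lim (@Rhausdorff R) h1) -(cvg_lim (@Rhausdorff R) h2).
Qed.

Lemma furstenberg_expect (u : Xspace R -> R) :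
  (\int[mu]_y u y)%R = (\int[@torus_system R d]_y u y)%R.
Proof.
rewrite /Rintegral; congr fine; apply: eq_measure_integral => A mA _.
exact: furstenberg_unique.
Qed.

Lemma furstenberg_trig s :
  (\int[mu]_y complex.Re (trig s y))%R = complex.Re (ksum d s).
Proof. by rewrite furstenberg_expect torus_trig. Qed.

Lemma cintegral_mono l :
  cintegral mu (fun y => mono l (coord y)) = (kappa d l)%:R.
Proof.
have re : (\int[mu]_y complex.Re (mono l (coord y)))%R =
    complex.Re ((kappa d l)%:R : R[i]).
  have := furstenberg_trig [:: (1, l)].
  rewrite /ksum big_seq1 mul1r => <-; apply: eq_Rintegral => y _.
  by rewrite /trig big_seq1 mul1r.
have im : (\int[mu]_y complex.Im (mono l (coord y)))%R =
    complex.Im ((kappa d l)%:R : R[i]).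
  have E (z : R[i]) : complex.Im z = complex.Re (- 'i * z).
    by case: z => a b /=; ring.
  have := furstenberg_trig [:: (- 'i, l)].
  rewrite /ksum big_seq1/= -E => <-; apply: eq_Rintegral => y _.
  by rewrite /trig big_seq1 -E.
by rewrite /cintegral re im; case: (kappa d l).
Qed.

Lemma furstenberg_strongly_stationary : strongly_stationary mu.
Proof.
move=> l r n F l0 r0 hF.
have /choice[b bF] : forall j, exists b : bool,
    F j = fun y => if b then (F0 y)^* else F0 y.
  by move=> j; have [->|->] := hF j; [exists false|exists true].
pose L := [seq (n j, b j) | j <- index_enum 'I_l].
have E (q : nat) y : \prod_(j < l) F j (shiftX_z (q%:Z * n j) y) =
    mono [seq (q%:Z * kb.1, kb.2) | kb <- L] (coord y).
  rewrite /mono /L !big_map; apply: eq_bigr => j _; rewrite bF /=.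
  by rewrite /F0 /shiftX_z add0r.
have E1 : (fun y => \prod_(j < l) F j (shiftX_z (n j) y)) =
    (fun y => mono L (coord y)).
  apply/funext => y; have := E 1%N y.
  under eq_bigr do rewrite mul1r.
  move=> ->; congr mono; rewrite -[RHS]map_id; apply: eq_map => -[k c] /=.
  by rewrite mul1r.
have Er : (fun y => \prod_(j < l) F j (shiftX_z (r%:Z * n j) y)) =
    (fun y => mono [seq (r%:Z * kb.1, kb.2) | kb <- L] (coord y)).
  by apply/funext => y; exact: E.
by rewrite E1 Er !cintegral_mono kappa_dilate.
Qed.

Lemma measurable_shiftX : measurable_fun [set: Xspace R] (@shiftX R).
Proof.
apply: measurable_into_Xspace => k.
exact: (cmeasurable_coord (k + 1)).
Qed.

HB.instance Definition _ :=
  isMeasurableFun.Build _ _ _ _ (@shiftX R) measurable_shiftX.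

Lemma mono_shiftX l (y : Xspace R) :
  mono l (coord (shiftX y)) = mono (shift_seq 1 l) (coord y).
Proof. by rewrite /mono big_map. Qed.

(** Shifting multiplies the exponent polynomial by the unit [1 + X], hence
    preserves the moments, which determine the measure. *)
Lemma mu_invariant (u : Xspace R -> R) : bmeasurable u ->
  (\int[mu]_y u (shiftX y))%R = (\int[mu]_y u y)%R.
Proof.
move=> bu; rewrite -(expect_push mu (@shiftX R) bu).
rewrite /Rintegral; congr fine; apply: eq_measure_integral => A mA _.
apply: (@probability_eq R (distribution mu (@shiftX R)) mu) => // phi cphi.
have bphi : bmeasurable (phi : Xspace R -> R).
  split; first exact: continuous_measurableX.
  by have [M _ hM] := cont_bounded compact_Xtop cphi; exists M.
apply/eqP; rewrite -subr_eq0 -normr_eq0 eq_le normr_ge0 andbT.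
apply/ler_addgt0Pr => e e0; rewrite add0r.
have e2 : 0 < e / 2 by rewrite divr_gt0.
have [s hs] := trig_dense cphi e2.
have bs := bmeasurable_trig s.
have h1 := expect_close (distribution mu (@shiftX R)) bphi bs hs.
have h2 := expect_close mu bphi bs hs.
have h3 : (\int[distribution mu (@shiftX R)]_y complex.Re (trig s y))%R =
    (\int[mu]_y complex.Re (trig s y))%R.
  rewrite expect_push// furstenberg_trig.
  transitivity (\int[mu]_y complex.Re (trig [seq (al.1, shift_seq 1 al.2) | al <- s] y))%R.
    apply: eq_Rintegral => y _; congr complex.Re.
    by rewrite /trig big_map; apply: eq_bigr => al _; rewrite mono_shiftX.
  rewrite furstenberg_trig; congr complex.Re; rewrite /ksum big_map.
  by apply: eq_bigr => al _; rewrite kappa_shift.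
move: h1 h2; rewrite h3; set I := Rintegral _ _ _; set J := Rintegral _ _ _.
set K := Rintegral _ _ _ => h1 h2.
have -> : I - K = (I - J) - (K - J) by ring.
by rewrite (le_trans (ler_normB _ _))// [leRHS]splitr lerD.
Qed.

(** * The Furstenberg system is the unipotent system *)

(** Countably many equations between measurable functions of the coordinates. *)
Lemma orbit_closure_measurable :
  measurable [set y : Xspace R | orbit_seq (torus_of_seq d y) = y].
Proof.
pose E (k : int) := [set y : Xspace R |
  coord (orbit_seq (torus_of_seq d y)) k = coord y k].
have mE k : measurable (E k).
  have [cr ci] := @cmeasurable_coord R k.
  have mo := measurableT_comp (@measurable_orbit_seq R d) (@measurable_torus_of_seq R d).
  have mr := measurable_funB (measurableT_comp cr mo) cr.
  have mi := measurable_funB (measurableT_comp ci mo) ci.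
  have := measurableI _ _ (mr measurableT _ (measurable_set1 0))
    (mi measurableT _ (measurable_set1 0)).
  rewrite !setTI; congr measurable; apply/seteqP; split=> y /=.
    rewrite /E /= => -[/eqP]; rewrite subr_eq0 => /eqP h1 /eqP.
    rewrite subr_eq0 => /eqP h2; apply/eqP; rewrite eq_complex.
    by apply/andP; split; apply/eqP.
  move=> h; split; apply/eqP; rewrite subr_eq0; apply/eqP.
    exact: (congr1 (@complex.Re R) h).
  exact: (congr1 (@complex.Im R) h).
have -> : [set y : Xspace R | orbit_seq (torus_of_seq d y) = y] =
    \bigcap_n (E n%:Z `&` E (- n%:Z)).
  apply/seteqP; split=> y /=; first by move=> h n _; split; rewrite /E /= h.
  move=> h; apply: coord_inj => k.
  have [h1 h2] := h (absz k) I.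
  by have [->|->] : k = `|k|%N%:Z \/ k = - `|k|%N%:Z by lia.
by apply: bigcapT_measurable => n; exact: measurableI.
Qed.

(** [orbit_seq] intertwines the two maps and carries the Haar measure to [mu];
    [torus_of_seq] inverts it on the set of full measure of orbit sequences. *)
Lemma furstenberg_isomorphic :
  isomorphic_systems mu shiftX (@haar_torus R d.+1) (@unipotent R d).
Proof.
pose X0 := [set y : Xspace R | orbit_seq (torus_of_seq d y) = y].
have mX0 : measurable X0 := orbit_closure_measurable.
have X0o (y : d.+1.-tuple (circle R)) : X0 (orbit_seq y).
  exact: (congr1 (@orbit_seq R d) (orbit_seqK y)).
have mu_pre A : measurable A -> mu A = haar_torus d.+1 (@orbit_seq R d @^-1` A).
  by move=> mA; rewrite furstenberg_unique.
have Tpush y : X0 y -> shiftX y = orbit_seq (unipotent (torus_of_seq d y)).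
  by move=> y0; rewrite -shift_orbit y0.
exists X0, setT, (torus_of_seq d); split.
- split=> //.
    apply: etrans (mu_pre _ (measurableC mX0)) _.
    have -> : @orbit_seq R d @^-1` (~` X0) = set0; last by rewrite measure0.
    by apply/seteqP; split=> // y /= h; apply: h; exact: X0o.
  by move=> _ [y y0 <-]; rewrite Tpush.
- by split=> //; rewrite setCT measure0.
- split=> //.
  + move=> y z; rewrite !inE => y0 z0 e.
    by rewrite -y0 -z0 e.
  + by move=> y _; exists (orbit_seq y) => //; exact: orbit_seqK.
- split.
  + move=> B mB _; have mp : measurable (X0 `&` torus_of_seq d @^-1` B).
      apply: measurableI => //; rewrite -[X in measurable X]setTI.
      exact: measurable_torus_of_seq.
    split=> //; apply: etrans (mu_pre _ mp) _; congr (haar_torus _ _).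
    apply/seteqP; split=> y /=; first by rewrite orbit_seqK => -[].
    by move=> By; split; [exact: X0o|rewrite orbit_seqK].
  + move=> A mA AX0.
    have -> : torus_of_seq d @` A = @orbit_seq R d @^-1` A.
      apply/seteqP; split=> [_ [y Ay <-]|y Ay] /=; first by rewrite AX0.
      by exists (orbit_seq y) => //; exact: orbit_seqK.
    rewrite -[X in measurable X]setTI; exact: measurable_orbit_seq.
- by move=> y y0; rewrite Tpush// orbit_seqK.
Qed.

End furstenberg.

(** * Triviality of the spectrum *)

Section spectrum_triviality.
Context {R : realType}.
Variables (d : nat) (mu : probability (Xspace R) R).
Hypothesis mu_trig : forall s,
  (\int[mu]_y complex.Re (trig s y))%R = complex.Re (ksum d s).
Hypothesis mu_inv : forall u : Xspace R -> R, bmeasurable u ->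
  (\int[mu]_y u (shiftX y))%R = (\int[mu]_y u y)%R.

Lemma expect_trig_sqr s : (\int[mu]_y (normc (trig s y) ^+ 2))%R =
  \sum_(a <- s) \sum_(b <- s)
    complex.Re (a.1 * (b.1)^* * (kappa d (a.2 ++ conj_seq b.2))%:R).
Proof.
pose q := [seq (a.1 * b.1, a.2 ++ b.2) | a <- s,
  b <- [seq ((al.1)^*, conj_seq al.2) | al <- s]].
have ReS (I : Type) (r : seq I) (F : I -> R[i]) :
    complex.Re (\sum_(i <- r) F i) = \sum_(i <- r) complex.Re (F i).
  by apply: (big_morph (@complex.Re R)) => // z w; rewrite ReD.
transitivity (\int[mu]_y complex.Re (trig q y))%R.
  by apply: eq_Rintegral => y _; rewrite trig_mul trig_conj Re_mulJ.
rewrite mu_trig /ksum big_allpairs_dep/= ReS; apply: eq_bigr => a _.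
by rewrite ReS big_map.
Qed.

(** The real inner product of [h] with a trigonometric polynomial is shown to
    vanish for each monomial, then for all trigonometric polynomials by linearity,
    and for all bounded functions by density. *)
Section eigenfunction.
Variables (h : Xspace R -> R[i]) (lam : R[i]).
Hypothesis h_meas : cmeasurable h.
Hypothesis h_le1 : forall y, normc (h y) <= 1.
Hypothesis lam1 : normc lam = 1.
Hypothesis lam_neq1 : lam != 1.
Hypothesis h_eigen : {ae mu, forall y, h (shiftX y) = lam * h y}.

Let J (a : R[i]) s := (\int[mu]_y complex.Re (a * (h y * trig s y)))%R.

Lemma cmeasurable_trig s : cmeasurable (fun y : Xspace R => trig s y).
Proof. by have [cr ci] := @ccontinuous_trig R s; split; exact: continuous_measurableX. Qed.

Lemma bm_htrig a s :
  bmeasurable (fun y : Xspace R => complex.Re (a * (h y * trig s y))).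
Proof.
split.
  have [] // := cmeasurableM (cmeasurable_cst a) (cmeasurableM h_meas (cmeasurable_trig s)).
exists (normc a * \sum_(al <- s) normc al.1) => y.
rewrite (le_trans (normc_Re _))// normcM ler_wpM2l ?normc_ge0//.
rewrite normcM (le_trans (ler_piMl (normc_ge0 _) (h_le1 y)))//.
rewrite /trig (le_trans (normc_sum _ _ _))//; apply: ler_sum => al _.
by rewrite normcM ler_piMr ?normc_ge0 ?mono_le1.
Qed.

Lemma bm_trig_sqr s : bmeasurable (fun y : Xspace R => normc (trig s y) ^+ 2).
Proof.
have := bmeasurable_trig [seq (a.1 * b.1, a.2 ++ b.2) | a <- s,
  b <- [seq ((al.1)^*, conj_seq al.2) | al <- s]].
by congr bmeasurable; apply/funext => y; rewrite trig_mul trig_conj Re_mulJ.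
Qed.

Lemma JD a b s : J (a + b) s = J a s + J b s.
Proof.
rewrite /J -expectD; [|exact: bm_htrig|exact: bm_htrig].
by apply: eq_Rintegral => y _; rewrite mulrDl ReD.
Qed.

Lemma JN a s : J (- a) s = - J a s.
Proof.
have := JD a (- a) s; rewrite subrr.
have -> : J 0 s = 0.
  rewrite -[RHS](expect_cst mu 0); apply: eq_Rintegral => y _.
  by rewrite mul0r.
by move=> /esym/eqP; rewrite addrC addr_eq0 => /eqP.
Qed.

Lemma J_cat a s1 s2 : J a (s1 ++ s2) = J a s1 + J a s2.
Proof.
rewrite /J -expectD; [|exact: bm_htrig|exact: bm_htrig].
by apply: eq_Rintegral => y _; rewrite trig_cat !mulrDr ReD.
Qed.

Lemma J_scale a c l : J a [:: (c, l)] = J (a * c) [:: (1, l)].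
Proof.
apply: eq_Rintegral => y _; rewrite /trig !big_seq1/= mul1r.
by congr complex.Re; ring.
Qed.

(** The inequality of Cauchy and Schwarz for [h] and [trig s], with a free
    parameter [k] in place of a square root. *)
Lemma J_le (a : R[i]) s (k Q : R) : 0 < k ->
  (\int[mu]_y (normc (trig s y) ^+ 2))%R <= Q ->
  J a s <= normc a * (Q / (2 * k) + k / 2).
Proof.
move=> k0 sQ.
have bq := bm_trig_sqr s.
have b1 := bmeasurableM (bmeasurable_cst (2 * k)^-1) bq.
have b2 := bmeasurableD b1 (bmeasurable_cst (T := Xspace R) (k / 2)).
have b3 := bmeasurableM (bmeasurable_cst (normc a)) b2.
apply: (@le_trans _ _ (\int[mu]_y (normc a *
    ((2 * k)^-1 * normc (trig s y) ^+ 2 + k / 2)))%R).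
  apply: le_expect => //; first exact: bm_htrig.
  move=> y; rewrite (le_trans (ler_norm _))// (le_trans (normc_Re _))// normcM.
  rewrite ler_wpM2l ?normc_ge0// normcM.
  rewrite (le_trans (ler_piMl (normc_ge0 _) (h_le1 y)))//.
  set z := normc _; rewrite -subr_ge0.
  have -> : (2 * k)^-1 * z ^+ 2 + k / 2 - z = (z - k) ^+ 2 / (2 * k).
    by field; rewrite gt_eqF.
  by rewrite divr_ge0 ?sqr_ge0// mulr_ge0// ltW.
rewrite expectZ// expectD//; last exact: bmeasurable_cst.
rewrite (expectZ mu _ bq) expect_cst ler_wpM2l ?normc_ge0// lerD2r mulrC.
by rewrite ler_wpM2r// invr_ge0 mulr_ge0// ltW.
Qed.

(** The measure is invariant, and [h] takes the factor [lam] under the shift. *)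
Lemma J_shift a l : J a [:: (1, shift_seq 1 l)] = J (a * lam^*) [:: (1, l)].
Proof.
have lamJ : lam^* * lam = 1 by rewrite mulrC mulcJ_norm1.
have bml := bm_htrig (a * lam^*) [:: (1, l)].
rewrite {2}/J -(mu_inv bml).
pose u (y : Xspace R) := complex.Re (a * lam^* * (h (shiftX y) * trig [:: (1, l)] (shiftX y))).
pose v (y : Xspace R) := complex.Re (a * (h y * trig [:: (1, shift_seq 1 l)] y)).
rewrite -[RHS]/(\int[mu]_y u y)%R -[LHS]/(\int[mu]_y v y)%R /Rintegral; congr fine.
apply: ae_eq_integral => //.
- by apply/measurable_EFinP; have [] := bm_htrig a [:: (1, shift_seq 1 l)].
- apply/measurable_EFinP; have [mb _] := bml.
  exact: (measurableT_comp mb (@measurable_shiftX R)).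
- apply: filterS h_eigen => y hy _ /=; congr EFin.
  rewrite /u /v hy /trig !big_seq1/= !mul1r mono_shiftX.
  have -> : a * lam^* * (lam * h y * mono (shift_seq 1 l) (coord y)) =
      a * (lam^* * lam) * (h y * mono (shift_seq 1 l) (coord y)) by ring.
  by rewrite lamJ mulr1.
Qed.

Lemma J_shiftn a n l :
  J (a * lam ^+ n) [:: (1, shift_seq n l)] = J a [:: (1, l)].
Proof.
elim: n a => [|n IH] a.
  rewrite expr0 mulr1; congr (J a [:: (1, _)]).
  by rewrite /shift_seq -[RHS]map_id; apply: eq_map => -[k b] /=; rewrite addr0.
have -> : shift_seq n.+1 l = shift_seq 1 (shift_seq n l).
  rewrite /shift_seq -map_comp; apply: eq_map => -[k b] /=.
  by rewrite -addrA -PoszD addn1.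
rewrite J_shift.
have -> : a * lam ^+ n.+1 * lam^* = a * lam ^+ n.
  by rewrite exprSr mulrA -mulrA mulcJ_norm1// mulr1.
exact: IH.
Qed.

(** The shifted monomial and the monomial itself are at distance 0 in mean
    square, so that [J] takes the same value on both; by [J_shift] these values
    differ by the factor [lam^*], which is not 1. *)
Lemma J_invariant a l : low d ('X * wpoly d l) -> J a [:: (1, l)] = 0.
Proof.
move=> lowX.
pose s : seq (R[i] * seq (int * bool)) := [:: (1, shift_seq 1 l); (-1, l)].
have kap n n' : low d (((1 + 'X) ^+ n - (1 + 'X) ^+ n') * wpoly d l) ->
    kappa d (shift_seq n l ++ conj_seq (shift_seq n' l)).
  rewrite /kappa wpoly_cat wpoly_conj => lw.
  rewrite -(low_eqm (G := ((1 + 'X) ^+ n - (1 + 'X) ^+ n') * wpoly d l))//.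
  have -> : ((1 + 'X) ^+ n - (1 + 'X) ^+ n') * wpoly d l -
      (wpoly d (shift_seq n l) - wpoly d (shift_seq n' l)) =
      ((1 + 'X) ^+ n * wpoly d l - wpoly d (shift_seq n l)) -
      ((1 + 'X) ^+ n' * wpoly d l - wpoly d (shift_seq n' l)) by ring.
  by apply: lowB; exact: wpoly_shift.
have sl : l = shift_seq 0 l.
  by rewrite /shift_seq -[LHS]map_id; apply: eq_map => -[k b] /=; rewrite addr0.
have k11 := kap 1%N 1%N; have k00 := kap 0%N 0%N.
have k10 := kap 1%N 0%N; have k01 := kap 0%N 1%N.
rewrite -!sl in k00 k10 k01.
have sqr0 : (\int[mu]_y (normc (trig s y) ^+ 2))%R = 0.
  have e11 := k11 ltac:(by rewrite subrr mul0r low0).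
  have e00 := k00 ltac:(by rewrite subrr mul0r low0).
  have e10 : kappa d (shift_seq 1 l ++ conj_seq l).
    by apply: k10; rewrite expr1 expr0 addrAC subrr add0r.
  have e01 : kappa d (l ++ conj_seq (shift_seq 1 l)).
    by apply: k01; rewrite expr1 expr0 opprD addrA subrr add0r mulNr lowN.
  rewrite expect_trig_sqr /s !big_cons !big_nil/= e11 e10 e01 e00 /=.
  by ring.
have Js0 b : J b s = 0.
  have Jle c : J c s <= 0.
    apply/ler_addgt0Pr => e e0; rewrite add0r.
    have c1 : 0 < normc c + 1 by rewrite ltr_wpDl// normc_ge0.
    have k0 : 0 < 2 * e / (normc c + 1) by rewrite divr_gt0// mulr_gt0.
    have h0 : (\int[mu]_y (normc (trig s y) ^+ 2))%R <= 0 by rewrite sqr0.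
    apply: le_trans (J_le c k0 h0) _; rewrite mul0r add0r.
    apply: (@le_trans _ _ ((normc c + 1) * (2 * e / (normc c + 1) / 2))).
      by rewrite ler_wpM2r ?lerDl// divr_ge0// ltW.
    by rewrite le_eqVlt; apply/orP; left; apply/eqP; field; rewrite gt_eqF.
  by apply/eqP; rewrite eq_le Jle/= -oppr_le0 -JN Jle.
have Jeq b : J (b * (lam^* - 1)) [:: (1, l)] = 0.
  have := Js0 b; rewrite -[s]/([:: (1, shift_seq 1 l)] ++ [:: (-1, l)]) J_cat.
  by rewrite J_shift (J_scale b (-1)) -JD mulrN1 mulrBr mulr1.
have lamJ : lam^* - 1 != 0.
  rewrite subr_eq0; apply: contra lam_neq1 => /eqP e.
  by rewrite -(conjCK lam) e rmorph1.
by have := Jeq (a / (lam^* - 1)); rewrite divfK.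
Qed.

(** The translates of the monomial are orthonormal, because the differences
    [(1 + X) ^ n - (1 + X) ^ n'] vanish to order exactly one at 0. Hence the
    sum of [M] translates, weighted by powers of [lam], has mean square [M],
    whereas [J] is additive and takes the same value at each of them. *)
Lemma J_orthogonal a l : ~~ low d ('X * wpoly d l) -> J a [:: (1, l)] = 0.
Proof.
move=> /lowPn[j jd [Gj Glt]].
have [i ij] : exists i, j = i.+1.
  by case: j Gj {jd Glt} => [|i _]; [rewrite coefXM|exists i].
subst j; rewrite coefXM/= in Gj.
have Gi k : (k < i)%N -> (wpoly d l)`_k = 0.
  by move=> ki; have := Glt k.+1 ki; rewrite coefXM.
have orth n n' : n != n' ->
    kappa d (shift_seq n l ++ conj_seq (shift_seq n' l)) = false.
  move=> nn'; rewrite /kappa wpoly_cat wpoly_conj.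
  rewrite -(low_eqm (G := ((1 + 'X) ^+ n - (1 + 'X) ^+ n') * wpoly d l)); last first.
    have -> : ((1 + 'X) ^+ n - (1 + 'X) ^+ n') * wpoly d l -
        (wpoly d (shift_seq n l) - wpoly d (shift_seq n' l)) =
        ((1 + 'X) ^+ n * wpoly d l - wpoly d (shift_seq n l)) -
        ((1 + 'X) ^+ n' * wpoly d l - wpoly d (shift_seq n' l)) by ring.
    by apply: lowB; exact: wpoly_shift.
  apply/negbTE/negP => /lowP/(_ _ jd).
  have [a0 a1] := coef_1DXn n; have [b0 b1] := coef_1DXn n'.
  have H0 : ((1 + 'X : {poly int}) ^+ n - (1 + 'X) ^+ n')`_0 = 0.
    by rewrite coefB a0 b0 subrr.
  have [_ ->] := coefM_order H0 Gi.
  rewrite coefB a1 b1 => /eqP; rewrite mulf_eq0 (negPf Gj) orbF subr_eq0.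
  by rewrite eqz_nat (negPf nn').
have kap n : kappa d (shift_seq n l ++ conj_seq (shift_seq n l)).
  by rewrite /kappa wpoly_cat wpoly_conj subrr low0.
have lamn n : normc (lam ^+ n) = 1.
  by elim: n => [|n IH]; rewrite ?expr0 ?normc1// exprS normcM lam1 IH mulr1.
pose s (M : nat) : seq (R[i] * seq (int * bool)) :=
  [seq (lam ^+ n, shift_seq n l) | n <- iota 0 M].
have sqr M : (\int[mu]_y (normc (trig (s M) y) ^+ 2))%R = M%:R.
  rewrite expect_trig_sqr /s big_map.
  transitivity (\sum_(n <- iota 0 M) (1 : R)); last first.
    by rewrite big_const_seq count_predT size_iota iter_addr addr0.
  rewrite big_seq [RHS]big_seq; apply: eq_bigr => n nM.
  rewrite big_map (bigD1_seq n) ?iota_uniq//= kap big1 => [|n' n'n]; last first.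
    by rewrite orth 1?eq_sym// mulr0.
  by rewrite addr0 mulr1 mulcJ_norm1//= lamn.
have Jsum M b : J b (s M) = M%:R * J b [:: (1, l)].
  elim: M => [|M IH].
    rewrite mul0r -[RHS](expect_cst mu 0); apply: eq_Rintegral => y _.
    by rewrite /s /trig big_nil !mulr0.
  rewrite /s -addn1 iotaD/= map_cat J_cat -/(s M) IH add0n /= (J_scale b (lam ^+ M)) J_shiftn.
  by rewrite natrD mulrDl mul1r.
have Jle b : J b [:: (1, l)] <= 0.
  apply/ler_addgt0Pr => e e0; rewrite add0r.
  (* For [M = k ^ 2] the bound on [J] is [normc b * k], against [k ^ 2] equal terms. *)
  pose k := (Num.truncn (normc b / e)).+1.
  have k0 : 0 < k%:R :> R by [].
  have sq : (\int[mu]_y (normc (trig (s (k ^ 2)%N) y) ^+ 2))%R <= (k ^ 2)%:R.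
    by rewrite sqr.
  have := J_le b k0 sq; rewrite Jsum natrX.
  have -> : k%:R ^+ 2 / (2 * k%:R) + k%:R / 2 = k%:R :> R.
    by field; rewrite gt_eqF.
  rewrite expr2 -mulrA [normc b * _]mulrC ler_pM2l// => hk.
  rewrite -(ler_pM2l k0) (le_trans hk)//.
  by have := truncnS_gt (normc b / e); rewrite -/k ltr_pdivrMr// => /ltW.
by apply/eqP; rewrite eq_le Jle/= -oppr_le0 -JN Jle.
Qed.

Lemma J0 a s : J a s = 0.
Proof.
elim: s => [|[c l] s IH].
  rewrite -[RHS](expect_cst mu 0); apply: eq_Rintegral => y _.
  by rewrite /trig big_nil !mulr0.
rewrite -cat1s J_cat IH addr0 J_scale.
by have [/J_invariant->|/J_orthogonal->] := boolP (low d ('X * wpoly d l)).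
Qed.

Lemma bm_Re a : bmeasurable (fun y : Xspace R => complex.Re (a * h y)).
Proof. exact: bmeasurable_phase. Qed.

(** Continuous functions are uniform limits of real parts of trigonometric
    polynomials, which are again trigonometric polynomials. *)
Lemma eigen_vanish_cont a (phi : Xtop R -> R) : continuous phi ->
  (\int[mu]_y (complex.Re (a * h y) * phi y))%R = 0.
Proof.
move=> cphi.
have bphi : bmeasurable (phi : Xspace R -> R).
  split; first exact: continuous_measurableX.
  by have [M _ hM] := cont_bounded compact_Xtop cphi; exists M.
apply/eqP; rewrite -normr_eq0 eq_le normr_ge0 andbT.
apply/ler_addgt0Pr => e e0; rewrite add0r.
have a1 : 0 < normc a + 1 by rewrite ltr_wpDl// normc_ge0.
have [s hs] := trig_dense cphi (divr_gt0 e0 a1).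
pose q := [seq ((2^-1)%:C * al.1, al.2) | al <-
  s ++ [seq ((al.1)^*, conj_seq al.2) | al <- s]].
have qE y : trig q y = (complex.Re (trig s y))%:C.
  rewrite trig_scale trig_cat trig_conj; case: (trig s y) => [u v].
  by apply/eqP; rewrite eq_complex/=; apply/andP; split; apply/eqP; field.
have Jq : (\int[mu]_y (complex.Re (a * h y) * complex.Re (trig s y)))%R = 0.
  rewrite -(J0 a q); apply: eq_Rintegral => y _; rewrite qE.
  by move: (complex.Re (trig s y)) (h y) (a) => w [h1 h2] [u1 u2] /=; ring.
have b1 := bmeasurableM (bm_Re a) bphi.
have b2 := bmeasurableM (bm_Re a) (bmeasurable_trig s).
rewrite -[X in `|X|]subr0 -[X in _ - X]Jq.
apply: expect_close => // y; rewrite -mulrBr normrM.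
apply: (@le_trans _ _ ((normc a + 1) * (e / (normc a + 1)))).
  apply: ler_pM => //; rewrite (le_trans (normc_Re _))// normcM.
  rewrite (le_trans (ler_piMr (normc_ge0 _) (h_le1 y)))//.
  by rewrite lerDl.
by rewrite mulrC divfK// gt_eqF.
Qed.

(** The integral against continuous functions determines that against
    indicators. *)
Lemma eigen_vanish_ae a : {ae mu, forall y, complex.Re (a * h y) = 0}.
Proof.
have vanish (A : set (Xspace R)) : measurable A ->
    (\int[mu]_y (complex.Re (a * h y) * \1_A y))%R = 0.
  apply: (@determined_by_continuous R
    (fun u => (\int[mu]_y (complex.Re (a * h y) * u y))%R)).
  - move=> u v bu bv; rewrite -expectB; [|exact: bmeasurableM (bm_Re a) _|exact: bmeasurableM (bm_Re a) _].
    by apply: eq_Rintegral => y _; rewrite mulrBr.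
  - move=> u_ u mu_ u1 mmu ul.
    have [mr _] := bm_Re a.
    apply: (@expect_lim _ _ _ mu _ _ (normc a)).
    + by move=> n; exact: measurable_funM.
    + move=> n y; rewrite normrM -[leRHS]mulr1 ler_pM//.
      rewrite (le_trans (normc_Re _))// normcM.
      by rewrite (le_trans (ler_piMr (normc_ge0 _) (h_le1 y))).
    + exact: measurable_funM.
    + by move=> y; apply: cvgM; [exact: cvg_cst|exact: ul].
  - by move=> phi cphi; exact: eigen_vanish_cont.
have bR := bm_Re a; have [mR _] := bR.
have := @integral_ae_eq _ _ _ mu setT measurableT (cst 0%E)
  (EFin \o (fun y => complex.Re (a * h y))).
move=> /(_ (bmeasurable_integrable mu bR)) /(_ (measurable_cst _)) ae.
have : ae_eq mu setT (EFin \o (fun y => complex.Re (a * h y))) (cst 0%E).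
  apply: ae => A _ mA; rewrite integral0.
  have V0 : (\int[mu]_y (complex.Re (a * h y) * \1_A y)%:E)%E = 0%E.
    rewrite -[LHS]fineK; last first.
      apply: integrable_fin_num => //; apply: bmeasurable_integrable.
      exact: bmeasurableM bR (bmeasurable_indic mA).
    by have := vanish A mA; rewrite /Rintegral => ->.
  rewrite -V0 integral_mkcond; apply: eq_integral => y _.
  by rewrite patchE indicE; case: ifPn; rewrite /= ?mulr1 ?mulr0.
by apply: filterS => y /(_ I)/= [].
Qed.

Lemma eigen_vanish : {ae mu, forall y, h y = 0}.
Proof.
have h1 := eigen_vanish_ae 1; have h2 := eigen_vanish_ae (- 'i).
apply: filterS2 h1 h2 => y; rewrite mul1r.
case: (h y) => [u v] /= ->.
by rewrite mulr0 mulN1r opprK add0r => ->.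
Qed.

End eigenfunction.

(** An eigenfunction [g] is made bounded by the invariant factor
    [expR (- normc g ^+ 2)]. *)
Lemma trivial_spectrum : spectrum mu shiftX = [set 0].
Proof.
apply/seteqP; split=> [alpha|_ ->]; last first.
  split; first by rewrite lexx ltr01.
  exists (fun=> 1); split.
  - split; first exact: cmeasurable_cst.
    have -> : (fun y : Xspace R => ((complex.Re `|1 : R[i]|) ^+ 2)%:E) = cst 1%:E.
      by apply/funext => y; rewrite normr1 /= expr1n.
    by rewrite integral_cst// mul1e (le_lt_trans (probability_le1 _ _))// ltry.
  - move=> h; have : {ae mu, forall y : Xspace R, False}.
      by apply: filterS h => y /eqP; rewrite oner_eq0.
    move=> [A [mA A0 TA]]; have AT : A = setT.
      by apply/seteqP; split=> // y _; apply: TA => /=; exact.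
    have := probability_setT mu; rewrite -AT => mA1.
    have : mu A = 0%E by [].
    by rewrite mA1 => /eqP; rewrite onee_eq0.
  - by apply: aeW => y; rewrite mulr0 expi0 mulr1.
move=> [/andP[al0 al1] [g [[gm _] gneq0 geig]]] /=.
apply/eqP/negPn/negP => alneq0; apply: gneq0.
have algt0 : 0 < alpha by rewrite lt_neqAle eq_sym alneq0.
pose lam : R[i] := expi (2 * pi * alpha).
(* Otherwise [alpha] would be an integer strictly between 0 and 1. *)
have lam_neq1 : lam != 1.
  apply/negP => /eqP; rewrite /lam -circle_charE => e.
  have := argK (circle_proj alpha : circle R); rewrite e.
  have := argK (0 : circle R); rewrite circle_char0 => ->.
  rewrite -circle_proj0 => /circle_proj_eq; rewrite sub0r rpredN => /intrP[k ak].
  move: algt0 al1; rewrite ak ltr0z -[1]/(1%:~R) ltr_int; lia.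
pose v (y : Xspace R) := complex.Re (g y) ^+ 2 + complex.Im (g y) ^+ 2.
pose h (y : Xspace R) := g y * (expR (- v y))%:C.
have vE y : v y = normc (g y) ^+ 2.
  by rewrite /v; case: (g y) => a b /=; rewrite sqr_sqrtr// addr_ge0 ?sqr_ge0.
have [gr gi] := gm.
have h_meas : cmeasurable h.
  apply: cmeasurableM => //; split; last exact: measurable_cst.
  apply: (measurableT_comp (f := expR)); first exact: measurable_expR.
  apply: measurable_funN.
  by apply: measurable_funD; exact: measurable_funX.
have h_le1 y : normc (h y) <= 1.
  rewrite normcM normc_real ger0_norm ?expR_ge0// expRN ler_pdivrMr ?expR_gt0//.
  rewrite mul1r vE (le_trans _ (expR_ge1Dx _))//.
  set z := normc _; have := sqr_ge0 (z - 1); rewrite sqrrB expr1n mulr1.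
  have := sqr_ge0 z; rewrite mulr2n; lra.
have h_eigen : {ae mu, forall y, h (shiftX y) = lam * h y}.
  apply: filterS geig => y gy; rewrite /h !vE gy normcM normc_expi mul1r.
  by rewrite mulrA.
have := @eigen_vanish h lam h_meas h_le1 (normc_expi _) lam_neq1 h_eigen.
apply: filterS => y /eqP; rewrite mulf_eq0 => /orP[/eqP//|].
by rewrite eq_complex /= gt_eqF ?expR_gt0.
Qed.

End spectrum_triviality.

(** * Furstenberg systems of MRT functions *)

Theorem theorem2p18 (R : realType) (f : nat -> R[i]) (t s : nat -> int)
    (d : nat) (N : nat -> nat) (x : Xspace R)
    (f_MRT : MRT f t s)
    (x_f : extends f x)
    (N_pos : forall m : nat, (0 < m)%N -> (0 < N m)%N)
    (N_incr : increasing_from1 (fun m => (N m)%:Z))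
    (N_growth : growth R t s d N) :
  (exists mu : probability (Xspace R) R, furstenberg_system x N mu) /\
  (forall mu : probability (Xspace R) R, furstenberg_system x N mu ->
     [/\ spectrum mu shiftX = [set 0],
         strongly_stationary mu &
         isomorphic_systems mu shiftX (haar_torus d.+1) (@unipotent R d)]).
Proof.
have x_moments l :
    small_avg N (fun m n => mono l (coord (shiftX_z n%:Z x)) - (kappa d l)%:R).
  (* A translation that makes all exponents of [l] nonnegative. *)
  rewrite /kappa (low_wpoly (K := (\sum_(kb <- l) absz kb.1)%N) _).
    exact: moments f_MRT x_f N_pos N_incr N_growth _ _ (@bigsum_ge l).
  exact: bigsum_ge.
split.
  by exists (torus_system d); exact: torus_system_furstenberg N_pos x_moments.
move=> mu mu_furst; split.
- apply: (@trivial_spectrum R d mu).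
    exact: furstenberg_trig N_pos x_moments mu mu_furst.
  exact: mu_invariant N_pos x_moments mu mu_furst.
- exact: furstenberg_strongly_stationary N_pos x_moments mu mu_furst.
- exact: furstenberg_isomorphic N_pos x_moments mu mu_furst.
Qed.
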